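(* In the one-dimensional setting of the context, let $u(t,x,y)=\mathbb E[f(X_T^{t,x,y},Y_T^{t,y})]$ and let $(u^h_n)_{n=0,\dots,N}$ be the hybrid scheme with $\Pi^h_{\Delta x}(y)=(A^h_{\Delta x}(y))^{-1}B^h_{\Delta x}(y)$, where $A^h_{\Delta x}(y)$ is the implicit upwind finite difference operator and $B^h_{\Delta x}(y)$ the explicit quadrature operator defined in the context. Assume that - $\frac{\nu'}{\nu},\frac{\nu''}{\nu}\in L^1(\mathbb R,d\nu)$; - the Markov chain $(\hat Y^h_n)_{n=0,\dots,N}$ satisfies Assumptions $\mathcal H_1$ and $\mathcal H_2$ (stated in the context); - $u\in C^{\infty,4}_{\mathrm{pol},T}(\mathbb R,\mathcal D)$. Then there exist $\bar h,C>0$ such that for every $h<\bar h$ and $\Delta x<1$ $$\big|u(0,\cdot,Y_0)-u^h_0(\cdot,Y_0)\big|_\infty\le C\,(h+\Delta x).$$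
   Context: Setting. $\mathcal D\subseteq\mathbb R$ is a convex domain or the closure of one; $T>0$; $f:\mathbb R\times\mathcal D\to\mathbb R$; $dX_t=\mu_X(Y_t)dt+\sigma_X(Y_t)dB_t+\gamma_X(Y_t)dH_t$, $X_0\in\mathbb R$; $dY_t=\mu_Y(Y_t)dt+\sigma_Y(Y_t)dW_t$, $Y_0\in\mathcal D$, with $B,W$ independent one-dimensional Brownian motions and $H$ a real compound Poisson process independent of $(B,W)$, with intensity $\lambda$ and i.i.d. jumps having a density $p_{J_1}$; $\nu(x)=\lambda p_{J_1}(x)$ is the Lévy density; $d\nu=\nu(x)dx$. $(X^{t,x,y},Y^{t,y})$ is the solution starting from $(x,y)$ at time $t$. Standing assumptions: there is a unique weak solution, living in $\mathbb R\times\mathcal D$ a.s.; $u$ solves $\partial_tu+\mathcal Lu=0$ on $[0,T)\times\mathbb R\times\mathcal D$, $u(T,x,y)=f(x,y)$ on $\mathbb R\times\mathcal D$, where $\mathcal Lg=\frac12\sigma_X^2(y)\partial_x^2g+\frac12\sigma_Y^2(y)\partial_y^2g+\mu_X(y)\partial_xg+\mu_Y(y)\partial_yg+\int(g(x+\gamma_X(y)\zeta,y)-g(x,y))\nu(\zeta)d\zeta$; $\mu_X,\mu_Y,\sigma_X$ have polynomial growth; either $\gamma_X\equiv0$ or $\inf_{y\in\mathcal D}|\gamma_X(y)|\ge\varepsilon$ for some $\varepsilon>0$. Set $\nu_y\equiv0$ if $\gamma_X\equiv0$ and $\nu_y(x)=\frac1{|\gamma_X(y)|}\nu\big(\frac{x}{\gamma_X(y)}\big)$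 otherwise. Function spaces. $C^{q}_{\mathrm{pol},T}(\mathbb R\times\mathcal D)$: functions $v\in C^{\lfloor q/2\rfloor,q}([0,T)\times\mathbb R\times\mathcal D)$ for which, for some $C,a>0$, $\sup_{t<T}|\partial_t^k\partial_x^{l'}\partial_y^lv(t,x,y)|\le C(1+|(x,y)|^a)$ whenever $2k+l'+l\le q$. $C^{p,q}_{\mathrm{pol},T}(\mathbb R,\mathcal D)$, $p\in[1,\infty]$: those $v\in C^q_{\mathrm{pol},T}(\mathbb R\times\mathcal D)$ for which, for some $C,a>0$, $\sup_{t<T}|\partial_t^k\partial_x^{l'}\partial_y^lv(t,\cdot,y)|_{L^p(\mathbb R,dx)}\le C(1+|y|^a)$ for $y\in\mathcal D$, $2k+l'+l\le q$. Scheme. $h=T/N$, $N\in\mathbb N^*$, $\Delta x>0$, $\mathcal X=\{x_i=X_0+i\Delta x\}_{i\in\mathbb Z}$, functions on $\mathcal X$ being identified with sequences indexed by $\mathbb Z$. $|\varphi|_\infty=\sup_{x\in\mathcal X}|\varphi(x)|$ is the norm of $l_\infty(\mathcal X)$ (for functions on $\mathbb R$: of the restriction to $\mathcal X$). With $\alpha=\frac{h}{\Delta x}\mu_X(y)$, $\beta=\frac{h}{2\Delta x^2}\sigma_X^2(y)$, the infinite matrix $A^h_{\Delta x}(y)$ has entries $-\beta-|\alpha|\mathbf 1_{\alpha<0}$ if $i=j+1$; $1+2\beta+|\alpha|$ if $i=j$; $-\beta-|\alpha|\mathbf 1_{\alpha>0}$ if $i=j-1$; $0$ if $|i-j|>1$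 (it is invertible on $l_\infty(\mathcal X)$). $B^h_{\Delta x}(y)$ has entries $h\nu_y((j-i)\Delta x)\Delta x$ if $j\ne i$ and $1+h\big(\nu_y(0)\Delta x-\sum_{l\in\mathbb Z}\nu_y(l\Delta x)\Delta x\big)$ if $i=j$. For each $h$, $(\hat Y^h_n)_{n=0,\dots,N}$ is a Markov chain with state space $\mathcal Y^h_n\subseteq\mathcal D$ at step $n$, $\hat Y^h_0=Y_0$, independent of $B$ and $H$. $u^h_N(x,y)=f(x,y)$ on $\mathcal X\times\mathcal Y_N^h$ and, for $n=N-1,\dots,0$, $u^h_n(x,y)=\mathbb E[\Pi^h_{\Delta x}(y)u^h_{n+1}(\cdot,\hat Y^h_{n+1})(x)\mid\hat Y^h_n=y]$ on $\mathcal X\times\mathcal Y^h_n$. Assumption $\mathcal H_1$: there is $\bar h>0$ such that for every $h<\bar h$ and $n=0,\dots,N-1$: $\mathbb E[\hat Y^h_{n+1}-\hat Y^h_n\mid\hat Y^h_n]=\mu_Y(\hat Y^h_n)h+f_h(\hat Y^h_n)$, $\mathbb E[(\hat Y^h_{n+1}-\hat Y^h_n)^2\mid\hat Y^h_n]=\sigma_Y^2(\hat Y^h_n)h+g_h(\hat Y^h_n)$, $\mathbb E[(\hat Y^h_{n+1}-\hat Y^h_n)^3\mid\hat Y^h_n]=j_h(\hat Y^h_n)$, where $f_h,g_h,j_h:\mathcal D\to\mathbb R$ and, for some $p>1$, $C>0$, $\|f_h(\hat Y^h_n)\|_p,\|g_h(\hat Y^h_n)\|_p,\|j_h(\hat Y^h_n)\|_p\le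 Ch^2$ for all $h<\bar h$, $n=0,\dots,N$ ($\|\cdot\|_p$ the norm of $L^p(\Omega)$). Assumption $\mathcal H_2$: there is $\bar h>0$ such that for every $p>1$ there is $C_p>0$ with $\|\hat Y^h_n\|_p\le C_p$ for $h<\bar h$, $0\le n\le N$, and $\|\hat Y^h_{n+1}-\hat Y^h_n\|_p\le C_p\sqrt h$ for $h<\bar h$, $0\le n\le N-1$.
   Formalization: The terminal condition is taken in the classical sense: u(t,x,y) tends to f(x,y) as t increases to T, besides u(T,·)=f. Without this the claim fails, e.g. for σ_X=1, other coefficients 0, f the indicator of the rationals, on a rational grid. *)

(* Defs.v *)
From HB Require Import structures.
From mathcomp Require Export all_boot all_order all_algebra.
From mathcomp Require Export all_classical all_reals all_analysis.
Export Order.TTheory GRing.Theory Num.Theory.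
Export numFieldNormedType.Exports.

Set Implicit Arguments.
Unset Strict Implicit.
Unset Printing Implicit Defensive.

Global Open Scope classical_set_scope.
Global Open Scope ring_scope.

(* Functions of [y] are only meaningful on [dom]; [payoff] is f. *)
Record model (R : realType) := Model {
  horizon : R;
  dom : set R;
  X0 : R;
  Y0 : R;
  muX : R -> R;
  sigX : R -> R;
  gamX : R -> R;
  muY : R -> R;
  sigY : R -> R;
  payoff : R -> R -> R;
  intensity : R;
  jumpdens : R -> R }.

Definition levy {R : realType} (M : model R) (x : R) : R :=
  intensity M * jumpdens M x.

Definition convex_domain_or_closure {R : realType} (D : set R) : Prop :=
  exists O : set R,
    [/\ open O, O !=set0, is_interval O & (D = O \/ D = closure O)].

Definition poly_growth {R : realType} (D : set R) (g : R -> R) : Prop :=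
  exists C a : R,
    [/\ 0 < C, 0 < a & forall y, D y -> `|g y| <= C * (1 + `|y| `^ a)].

Definition probability_density {R : realType} (p : R -> R) : Prop :=
  [/\ measurable_fun setT p, (forall x, 0 <= p x) &
      (\int[lebesgue_measure]_x (p x)%:E = 1)%E].

Definition standing_coefficients {R : realType} (M : model R) : Prop :=
  [/\ 0 < horizon M, convex_domain_or_closure (dom M), dom M (Y0 M),
      0 < intensity M & probability_density (jumpdens M)] /\
  [/\ measurable_fun (dom M) (muX M), measurable_fun (dom M) (sigX M),
      measurable_fun (dom M) (gamX M), measurable_fun (dom M) (muY M) &
      measurable_fun (dom M) (sigY M)] /\
  [/\ poly_growth (dom M) (muX M), poly_growth (dom M) (muY M) &
      poly_growth (dom M) (sigX M)] /\
  ((forall y, dom M y -> gamX M y = 0) \/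
   exists2 e : R, 0 < e & forall y, dom M y -> e <= `|gamX M y|).

Section processes.
Context {d : measure_display} {Om : measurableType d} {R : realType}.
Implicit Types (P : probability Om R) (F : R -> set (set Om)).

Definition independent_classes P (G1 G2 : set (set Om)) : Prop :=
  forall E1 E2, G1 E1 -> G2 E2 -> P (E1 `&` E2) = (P E1 * P E2)%E.

Definition sigma_process (I : Type) (S : set I) (X : I -> Om -> R)
    : set (set Om) :=
  <<s [set E | exists i A, [/\ S i, measurable A & E = X i @^-1` A]] >>.

Definition is_filtration F : Prop :=
  (forall t, 0 <= t -> sigma_algebra setT (F t)) /\
  (forall s t, 0 <= s -> s <= t -> F s `<=` F t) /\
  (forall t, 0 <= t -> F t `<=` measurable).

Definition adapted F (S : set R) (X : R -> Om -> R) : Prop :=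
  forall t A, S t -> measurable A -> F t (X t @^-1` A).

Definition brownian_motion P F (B : R -> Om -> R) : Prop :=
  [/\ adapted F `[0, +oo[ B,
      {ae P, forall w, B 0 w = 0},
      {ae P, forall w, {within `[0, +oo[, continuous (fun t => B t w)}} &
      forall s t E A, 0 <= s -> s < t -> F s E -> measurable A ->
        P (E `&` [set w | A (B t w - B s w)]) =
        (P E * normal_prob 0 (Num.sqrt (t - s)) A)%E].

(* [tau] are the jump times and [J] the jump sizes of [H].  The sum over
   [\in] has finitely many terms almost surely. *)
Definition compound_poisson P F (lam : R) (p : R -> R) (H : R -> Om -> R)
    (tau J : nat -> Om -> R) : Prop :=
  let gap k w := if k is k'.+1 then tau k w - tau k' w else tau 0%N w in
  [/\ (forall k, measurable_fun setT (tau k) /\ measurable_fun setT (J k)),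
      (forall n (A A' : nat -> set R),
        (forall k, measurable (A k) /\ measurable (A' k)) ->
        P [set w | forall k, (k < n)%N -> A k (gap k w) /\ A' k (J k w)] =
        (\prod_(k < n) (exponential_prob lam (A k) *
                        \int[lebesgue_measure]_(x in A' k) (p x)%:E))%E),
      {ae P, forall w, forall t, 0 <= t ->
        H t w = \sum_(k \in [set k | tau k w <= t]) J k w},
      adapted F `[0, +oo[ H &
      forall s t E A, 0 <= s -> s <= t -> F s E -> measurable A ->
        P (E `&` [set w | A (H t w - H s w)]) =
        (P E * P [set w | A (H t w - H s w)%R])%E].

Definition driving_noise P F (lam : R) (p : R -> R) (B W H : R -> Om -> R)
    (tau J : nat -> Om -> R) : Prop :=
  let sig := sigma_process `[0, +oo[ in
  [/\ is_filtration F, brownian_motion P F B, brownian_motion P F W &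
      compound_poisson P F lam p H tau J] /\
  independent_classes P (sig B) (sig W) /\
  independent_classes P <<s sig B `|` sig W >> (sig H).

(* Convergence to 0 in probability; the measurable set [A] makes the notion
   insensitive to the values of [P] on non-measurable sets. *)
Definition cvg0_in_probability P (Z : nat -> Om -> \bar R) : Prop :=
  forall e de : R, 0 < e -> 0 < de -> \forall n \near \oo,
    exists A, [/\ measurable A, (P A <= de%:E)%E &
      forall w, ~ A w -> (`|Z n w| <= e%:E)%E].

(* xi_0 1_]r_0, r_1] + ... + xi_(m-1) 1_]r_(m-1), r_m] *)
Record simple_process := SimpleProcess {
  pieces : nat;
  grid : nat -> R;
  value : nat -> Om -> R }.

Definition is_simple F (t s : R) (S : simple_process) : Prop :=
  [/\ t <= grid S 0, grid S (pieces S) <= s,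
      (forall i, (i < pieces S)%N -> grid S i <= grid S i.+1),
      (forall i A, (i < pieces S)%N -> measurable A ->
         F (grid S i) (value S i @^-1` A)) &
      (forall i, (i < pieces S)%N ->
         exists C : R, forall w, `|value S i w| <= C)].

Definition simple_eval (S : simple_process) (r : R) (w : Om) : R :=
  \sum_(i < pieces S | grid S i < r <= grid S i.+1) value S i w.

Definition simple_integral (B : R -> Om -> R) (S : simple_process) (w : Om)
    : R :=
  \sum_(i < pieces S) value S i w * (B (grid S i.+1) w - B (grid S i) w).

(* [I] is (a version of) the Ito integral of [phi] against [B] on [t, s]. *)
Definition ito_integral P F (B : R -> Om -> R) (t s : R)
    (phi : R -> Om -> R) (I : Om -> R) : Prop :=
  exists S : nat -> simple_process,
    [/\ (forall n, is_simple F t s (S n)),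
        cvg0_in_probability P (fun n w =>
          (\int[lebesgue_measure]_(r in `[t, s])
             ((simple_eval (S n) r w - phi r w) ^+ 2)%:E)%E) &
        cvg0_in_probability P (fun n w => (simple_integral B (S n) w - I w)%:E)].

Definition drift_integral (t s : R) (phi : R -> Om -> R) (w : Om) : R :=
  \int[lebesgue_measure]_(r in `[t, s]) phi r w.

Definition drift_integrable P (t s : R) (phi : R -> Om -> R) : Prop :=
  {ae P, forall w,
    lebesgue_measure.-integrable `[t, s] (fun r => (phi r w)%:E)}.

(* The integral of [phi] against the compound Poisson process over ]t, s]. *)
Definition jump_integral (tau J : nat -> Om -> R) (t s : R)
    (phi : R -> Om -> R) (w : Om) : R :=
  \sum_(k \in [set k | t < tau k w <= s]) phi (tau k w) w * J k w.

(* [phi] is a version of E[Z | V], i.e. E[Z | V] = phi(V). *)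
Definition is_condexp P (Z V : Om -> R) (phi : R -> R) : Prop :=
  [/\ P.-integrable setT (EFin \o Z), P.-integrable setT (EFin \o (phi \o V)) &
      forall A, measurable A ->
        (\int[P]_(w in V @^-1` A) (Z w)%:E =
         \int[P]_(w in V @^-1` A) (phi (V w))%:E)%E].

End processes.
Arguments simple_process {d} Om R.

(* Solution on [t, T] started from (x, y) at time t.  Since Y is continuous,
   the left limits Y_(r-) in the jump term are Y_r. *)
Definition weak_solution {R : realType} (M : model R) (t x y : R)
    {d : measure_display} {Om : measurableType d} (P : probability Om R)
    (X Y : R -> Om -> R) : Prop :=
  let T := horizon M in
  exists (F : R -> set (set Om)) (B W H : R -> Om -> R)
         (tau J : nat -> Om -> R),
    driving_noise P F (intensity M) (jumpdens M) B W H tau J /\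
    [/\ adapted F `[t, T] X, adapted F `[t, T] Y,
        {ae P, forall w,
           (forall s, t <= s < T -> X r w @[r --> s^'+] --> X s w) /\
           (forall s, t < s <= T -> cvg (X r w @[r --> s^'-]))},
        {ae P, forall w, {within `[t, T], continuous (fun s => Y s w)}} &
        {ae P, forall w, forall s, t <= s <= T -> dom M (Y s w)}] /\
    forall s, t <= s <= T ->
      [/\ drift_integrable P t s (fun r w => muX M (Y r w)),
          drift_integrable P t s (fun r w => muY M (Y r w)) &
          exists IX IY : Om -> R,
          [/\ ito_integral P F B t s (fun r w => sigX M (Y r w)) IX,
              ito_integral P F W t s (fun r w => sigY M (Y r w)) IY,
              {ae P, forall w, X s w =
                 x + drift_integral t s (fun r w => muX M (Y r w)) w + IX w
                 + jump_integral tau J t s (fun r w => gamX M (Y r w)) w} &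
              {ae P, forall w, Y s w =
                 y + drift_integral t s (fun r w => muY M (Y r w)) w + IY w}]].

Definition same_law {R : realType} (t T : R)
    {d1 : measure_display} {Om1 : measurableType d1} (P1 : probability Om1 R)
    (X1 Y1 : R -> Om1 -> R)
    {d2 : measure_display} {Om2 : measurableType d2} (P2 : probability Om2 R)
    (X2 Y2 : R -> Om2 -> R) : Prop :=
  forall (n : nat) (s : 'I_n -> R) (A A' : 'I_n -> set R),
    (forall i, t <= s i <= T) ->
    (forall i, measurable (A i) /\ measurable (A' i)) ->
    P1 [set w | forall i, A i (X1 (s i) w) /\ A' i (Y1 (s i) w)] =
    P2 [set w | forall i, A i (X2 (s i) w) /\ A' i (Y2 (s i) w)].

Definition weak_wellposed {R : realType} (M : model R) : Prop :=
  forall t x y, 0 <= t <= horizon M -> dom M y ->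
    (exists (d : measure_display) (Om : measurableType d)
            (P : probability Om R) (X Y : R -> Om -> R),
       weak_solution M t x y P X Y) /\
    (forall (d1 d2 : measure_display)
            (Om1 : measurableType d1) (P1 : probability Om1 R)
            (X1 Y1 : R -> Om1 -> R)
            (Om2 : measurableType d2) (P2 : probability Om2 R)
            (X2 Y2 : R -> Om2 -> R),
       weak_solution M t x y P1 X1 Y1 -> weak_solution M t x y P2 X2 Y2 ->
       same_law t (horizon M) P1 X1 Y1 P2 X2 Y2).

(* u(t, x, y) = E[f(X_T, Y_T)].  The expectation is taken over the almost sure
   event Y_T \in D because f is only specified on R x D. *)
Definition is_value_function {R : realType} (M : model R) (u : R -> R -> R -> R)
    : Prop :=
  forall t x y, 0 <= t <= horizon M -> dom M y ->
  forall (d : measure_display) (Om : measurableType d) (P : probability Om R)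
         (X Y : R -> Om -> R),
    weak_solution M t x y P X Y ->
    let T := horizon M in
    let E := Y T @^-1` dom M in
    P.-integrable E (fun w => (payoff M (X T w) (Y T w))%:E) /\
    ((u t x y)%:E = \int[P]_(w in E) (payoff M (X T w) (Y T w))%:E)%E.

(* Derivatives relative to a set: one-sided at the endpoints. *)
Definition diff_quot {R : realType} (g : R -> R) (x z : R) : R :=
  (g z - g x) / (z - x).

Definition is_derive_within {R : realType} (A : set R) (g : R -> R) (x l : R)
    : Prop :=
  diff_quot g x z @[z --> within A x^'] --> l.

Definition derive_within {R : realType} (A : set R) (g : R -> R) (x : R) : R :=
  lim (diff_quot g x z @[z --> within A x^']).

(* [w k l' l] is the partial derivative of [v] of orders k in t, l' in x and
   l in y.  All the derivatives with 2k + l' + l <= q are required to exist,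
   whatever the order of differentiation, and to be continuous. *)
Definition partial_derivatives {R : realType} (T : R) (D : set R) (q : nat)
    (v : R -> R -> R -> R) (w : nat -> nat -> nat -> R -> R -> R -> R) : Prop :=
  (forall t x y, 0 <= t < T -> D y -> w 0%N 0%N 0%N t x y = v t x y) /\
  forall k l' l,
    ((2 * k + l' + l <= q)%N ->
       {within [set z : R * R * R | 0 <= z.1.1 < T /\ D z.2],
         continuous (fun z : R * R * R => w k l' l z.1.1 z.1.2 z.2)}) /\
    forall t x y, 0 <= t < T -> D y ->
      [/\ (2 * k.+1 + l' + l <= q)%N ->
            is_derive_within `[0, T[ (fun s => w k l' l s x y) t
              (w k.+1 l' l t x y),
          (2 * k + l'.+1 + l <= q)%N ->
            is_derive x (1 : R) (fun z => w k l' l t z y) (w k l'.+1 l t x y) &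
          (2 * k + l' + l.+1 <= q)%N ->
            is_derive_within D (fun z => w k l' l t x z) y
              (w k l' l.+1 t x y)].

(* C^{p,q}_{pol,T}(R, D) *)
Definition Cpol {R : realType} (T : R) (D : set R) (p : \bar R) (q : nat)
    (v : R -> R -> R -> R) : Prop :=
  exists w, partial_derivatives T D q v w /\
    (exists C a : R, [/\ 0 < C, 0 < a &
      forall k l' l t x y, (2 * k + l' + l <= q)%N -> 0 <= t < T -> D y ->
        `|w k l' l t x y| <=
          C * (1 + Num.sqrt (x ^+ 2 + y ^+ 2) `^ a)]) /\
    (exists C a : R, [/\ 0 < C, 0 < a &
      forall k l' l t y, (2 * k + l' + l <= q)%N -> 0 <= t < T -> D y ->
        (Lnorm lebesgue_measure p (fun x => (w k l' l t x y)%:E) <=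
          (C * (1 + `|y| `^ a))%:E)%E]).

Definition generator {R : realType} (M : model R) (g : R -> R -> R) (x y : R)
    : R :=
  2^-1 * sigX M y ^+ 2 * derive1n 2 (g ^~ y) x
  + 2^-1 * sigY M y ^+ 2 *
      derive_within (dom M) (derive_within (dom M) (g x)) y
  + muX M y * derive1 (g ^~ y) x
  + muY M y * derive_within (dom M) (g x) y
  + \int[lebesgue_measure]_z ((g (x + gamX M y * z) y - g x y) * levy M z).

(* The terminal value is attained in the classical sense: u(t, x, y) tends to
   f(x, y) as t increases to T.  Without this clause f could be altered on a
   null set without changing u before time T. *)
Definition solves_pide {R : realType} (M : model R) (u : R -> R -> R -> R)
    : Prop :=
  let T := horizon M in
  (forall t x y, 0 <= t < T -> dom M y ->
     derive_within `[0, T[ (fun s => u s x y) t + generator M (u t) x y = 0) /\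
  (forall x y, dom M y ->
     u T x y = payoff M x y /\ u t x y @[t --> T^'-] --> payoff M x y).

(* L^1(R, d nu), where d nu = nu(x) dx *)
Definition L1_levy {R : realType} (M : model R) (g : R -> R) : Prop :=
  lebesgue_measure.-integrable setT (fun x => (g x * levy M x)%:E).

Definition levy_regular {R : realType} (M : model R) : Prop :=
  let nu := levy M in
  [/\ (forall x, derivable nu x 1), (forall x, derivable (derive1 nu) x 1),
      L1_levy M (fun x => derive1 nu x / nu x) &
      L1_levy M (fun x => derive1n 2 nu x / nu x)].

(* Functions on the grid X0 + Z dx are sequences indexed by [int]. *)
Definition linf_norm {R : realType} (v : int -> R) : \bar R :=
  ereal_sup (range (fun i => (`|v i|)%:E)).

Definition linf {R : realType} (v : int -> R) : Prop := (linf_norm v < +oo)%E.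

Definition sumZ {R : realType} (F : int -> R) : R :=
  lim ((fun n : nat => \sum_(k < n.*2.+1) F (k%:Z - n%:Z)) @ \oo).

Definition matvec {R : realType} (A : int -> int -> R) (v : int -> R)
    : int -> R :=
  fun i => sumZ (fun j => A i j * v j).

(* A^-1 v for [A] invertible on l_oo *)
Definition linf_inverse {R : realType} (A : int -> int -> R) (v : int -> R)
    : int -> R :=
  get [set w | linf w /\ matvec A w = v].

Section scheme.
Context {R : realType} (M : model R).

Definition nu_y (y x : R) : R :=
  if `[< forall z, dom M z -> gamX M z = 0 >] then 0
  else `|gamX M y|^-1 * levy M (x / gamX M y).

Definition matA (h dx y : R) (i j : int) : R :=
  let alpha := h / dx * muX M y in
  let beta := h / (2 * dx ^+ 2) * sigX M y ^+ 2 in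
  if i == j + 1 then - beta - `|alpha| * (alpha < 0)%R%:R
  else if i == j then 1 + 2 * beta + `|alpha|
  else if i == j - 1 then - beta - `|alpha| * (alpha > 0)%R%:R
  else 0.

Definition matB (h dx y : R) (i j : int) : R :=
  if j == i then
    1 + h * (nu_y y 0 * dx - sumZ (fun l => nu_y y (l%:~R * dx) * dx))
  else h * nu_y y ((j - i)%:~R * dx) * dx.

Definition Pi_op (h dx y : R) (v : int -> R) : int -> R :=
  linf_inverse (matA h dx y) (matvec (matB h dx y) v).

Definition step (N : nat) : R := horizon M / N%:R.

Definition node (dx : R) (i : int) : R := X0 M + i%:~R * dx.

(* [S n] is the state space at step n and [K n] the transition kernel from
   step n to step n.+1.  [scheme_rev k] is u^h_(N - k). *)
Fixpoint scheme_rev (S : nat -> set R)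
    (K : nat -> R.-pker (measurableTypeR R) ~> (measurableTypeR R))
    (N : nat) (dx : R) (k : nat) (i : int) (y : R) : R :=
  if k is k'.+1 then
    let n := (N - k)%N in
    \int[K n y]_(z in S n.+1)
      Pi_op (step N) dx y (fun j => scheme_rev S K N dx k' j z) i
  else payoff M (node dx i) y.

Definition scheme (S : nat -> set R)
    (K : nat -> R.-pker (measurableTypeR R) ~> (measurableTypeR R))
    (N : nat) (dx : R) (n : nat) : int -> R -> R :=
  scheme_rev S K N dx (N - n)%N.

Definition markov_chain {d : measure_display} {Om : measurableType d}
    (P : probability Om R) (N : nat) (S : nat -> set R)
    (K : nat -> R.-pker (measurableTypeR R) ~> (measurableTypeR R))
    (Yh : nat -> Om -> R) : Prop :=
  [/\ (forall n, (n <= N)%N ->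
        [/\ measurable_fun setT (Yh n), measurable (S n), S n `<=` dom M &
            forall w, S n (Yh n w)]),
      (forall w, Yh 0%N w = Y0 M),
      (forall n y, (n < N)%N -> S n y -> K n y (S n.+1) = 1%E) &
      forall n (A : nat -> set R), (n < N)%N -> (forall k, measurable (A k)) ->
        P [set w | forall k, (k <= n.+1)%N -> A k (Yh k w)] =
        (\int[P]_(w in [set w | forall k, (k <= n)%N -> A k (Yh k w)])
           K n (Yh n w) (A n.+1))%E].

(* The chain with N steps is [Yh N]; a condition on h = T/N < hbar is a
   condition on N. *)
Definition assumption_H1 {d : measure_display} {Om : measurableType d}
    (P : probability Om R) (Yh : nat -> nat -> Om -> R) : Prop :=
  exists hbar : R, 0 < hbar /\
  exists fh gh jh : nat -> R -> R,
  (forall N, measurable_fun (dom M) (fh N) /\ measurable_fun (dom M) (gh N) /\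
             measurable_fun (dom M) (jh N)) /\
  (forall N n, (0 < N)%N -> step N < hbar -> (n < N)%N ->
    let incr w := Yh N n.+1 w - Yh N n w in
    [/\ is_condexp P incr (Yh N n) (fun y => muY M y * step N + fh N y),
        is_condexp P (fun w => incr w ^+ 2) (Yh N n)
          (fun y => sigY M y ^+ 2 * step N + gh N y) &
        is_condexp P (fun w => incr w ^+ 3) (Yh N n) (jh N)]) /\
  exists p C : R, [/\ 1 < p, 0 < C &
    forall N n, (0 < N)%N -> step N < hbar -> (n <= N)%N ->
    forall phi, (phi = fh N \/ phi = gh N \/ phi = jh N) ->
      (Lnorm P p%:E (fun w => (phi (Yh N n w))%:E) <=
         (C * step N ^+ 2)%:E)%E].

Definition assumption_H2 {d : measure_display} {Om : measurableType d}
    (P : probability Om R) (Yh : nat -> nat -> Om -> R) : Prop :=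
  exists hbar : R, 0 < hbar /\
  forall p : R, 1 < p -> exists Cp : R, [/\ 0 < Cp,
    (forall N n, (0 < N)%N -> step N < hbar -> (n <= N)%N ->
      (Lnorm P p%:E (fun w => (Yh N n w)%:E) <= Cp%:E)%E) &
    (forall N n, (0 < N)%N -> step N < hbar -> (n < N)%N ->
      (Lnorm P p%:E (fun w => (Yh N n.+1 w - Yh N n w)%:E) <=
         (Cp * Num.sqrt (step N))%:E)%E)].

End scheme.

(* Main.v *)
(* The error of the scheme propagates like a backward recursion along the chain.
   The upwind matrix is diagonally dominant with row sums 1, so its inverse is a
   sup-norm contraction; the quadrature operator has norm at most 1 + 2 h L,
   where L bounds the Riemann sums of the Levy density.  Hence Pi = A^-1 B is
   stable, and one step multiplies the error by 1 + 2 h L and adds a local error.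
   For the local error, expand u(t + h, x, z) to third order in z - y: applying
   Pi to the coefficients and integrating against the transition kernel leaves
   the PIDE, which vanishes, plus h (h + dx) times a polynomial weight in y, the
   defects of the first three conditional moments, and a remainder
   h^2 + h (z - y)^2 + (z - y)^4.  The bound on the error at time t_n is a
   function theta_n of y, defined by this recursion with values in [0, +oo], and
   only its expectation along the chain is estimated, from H1, H2 and Young's
   inequality.  Since the initial state is deterministic, the expectation of
   theta_0 is its value at Y0. *)
Require Import Defs.
From mathcomp Require Import measurable_realfun ess_sup_inf.
From mathcomp Require Import zify ring lra.

Set Implicit Arguments.
Unset Strict Implicit.
Unset Printing Implicit Defensive.

(** * Sequences indexed by the integers and the upwind matrix *)

(** Three obstacles shape the argument. Measurability in [y] of the numerical solution is never
    established, so each of its kernel integrals is squeezed between integrals of a polynomial in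
    [z - y] plus or minus a measurable majorant. The moment identities of H1 hold only almost surely
    along the chain, while the scheme is defined state by state; hence no useful bound at a
    prescribed [y], and a majorant allowed to be infinite. The derivatives of [u] are controlled
    only before the horizon; the last step is recovered by a limit from the terminal condition. The
    third order in [z - y] is forced: H2 bounds the absolute third moment only by [h^(3/2)], which
    would accumulate to [sqrt h], whereas H1 makes the conditional third moment [O(h^2)]. The
    quadrature error is measured by the L1 norm of the derivative of the integrand, and the lower
    bound on [|gamX|] keeps the effective step [dx / |gamX|] controlled uniformly in [y]. In
    expectation, N local errors of size [h (h + dx)] add up to [T (h + dx)], while the amplification
    [(1 + 2 h L)^N] stays below [exp (2 T L)]. *)

Section bilateral_sums.
Context {R : realType}.
Implicit Types (F G : int -> R).

Definition psumZ F (n : nat) : R := \sum_(k < n.*2.+1) F (k%:Z - n%:Z).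

Lemma sumZE F : sumZ F = limn (psumZ F).
Proof. by []. Qed.

Lemma psumZ_recr F n :
  psumZ F n.+1 = F (- n.+1%:Z) + psumZ F n + F n.+1%:Z.
Proof.
rewrite /psumZ doubleS big_ord_recr big_ord_recl /=.
congr (F _ + _ + F _); [lia| |lia].
by apply: eq_bigr => i _; congr F; rewrite /bump /=; lia.
Qed.

Lemma psumZD F G n : psumZ (fun j => F j + G j) n = psumZ F n + psumZ G n.
Proof. exact: big_split. Qed.

Lemma psumZM (a : R) F n : psumZ (fun j => a * F j) n = a * psumZ F n.
Proof. by rewrite /psumZ big_distrr. Qed.

Lemma ler_psumZ F G n : (forall j, F j <= G j) -> psumZ F n <= psumZ G n.
Proof. by move=> FG; apply: ler_sum => i _; exact: FG. Qed.

Lemma ler_norm_psumZ F n : `|psumZ F n| <= psumZ (fun j => `|F j|) n.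
Proof. exact: ler_norm_sum. Qed.

Lemma cvg_psumZ_delta (i : int) (c : R) :
  psumZ (fun j => if j == i then c else 0) n @[n --> \oo] --> c.
Proof.
apply: cvg_near_cst; exists `|i|%N => // n /= ni.
have lt : (absz (i + Posz n)%R < n.*2.+1)%N by lia.
rewrite /psumZ (bigD1 (Ordinal lt)) //= ifT; last by apply/eqP; lia.
rewrite big1 ?addr0 // => k /eqP nk.
by case: ifPn => // /eqP e; case: nk; apply: val_inj => /=; lia.
Qed.

Lemma cvg_psumZ_tri F (i : int) :
  (forall j, j != i - 1 -> j != i -> j != i + 1 -> F j = 0) ->
  psumZ F n @[n --> \oo] --> F (i - 1) + F i + F (i + 1).
Proof.
move=> F0.
pose d k j := if j == k then F k else 0.
have FE : F = fun j => (d (i - 1) j + d i j) + d (i + 1) j.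
  apply/funext => j; rewrite /d.
  have [->|j1] := eqVneq j (i - 1).
    rewrite !ifF ?addr0 //; apply/negbTE; lia.
  have [->|j2] := eqVneq j i.
    rewrite !ifF ?addr0 ?add0r //; apply/negbTE; lia.
  have [->|j3] := eqVneq j (i + 1); first by rewrite !add0r.
  by rewrite F0 // !addr0.
rewrite {1}FE; under eq_fun do rewrite !psumZD.
apply: cvgD; first apply: cvgD; exact: cvg_psumZ_delta.
Qed.

Definition summableZ F := exists L : R, forall n, psumZ (fun j => `|F j|) n <= L.

Lemma psumZ_nondecreasing F : (forall j, 0 <= F j) -> nondecreasing_seq (psumZ F).
Proof.
move=> F0; apply/nondecreasing_seqP => n; rewrite psumZ_recr.
by have := F0 (- n.+1%:Z); have := F0 n.+1%:Z; lra.
Qed.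

(** [F] is the difference of the nonnegative families [F + |F|] and [|F|], whose symmetric partial
    sums are monotone and bounded. *)
Lemma summableZ_cvg F : summableZ F -> cvgn (psumZ F).
Proof.
move=> [L FL].
have ge0 j : 0 <= F j + `|F j| by have := ler_norm (- F j); rewrite normrN; lra.
have c1 : cvgn (psumZ (fun j => `|F j|)).
  apply: nondecreasing_is_cvgn; first exact: psumZ_nondecreasing.
  by exists L => _ [n _ <-]; exact: FL.
have c2 : cvgn (psumZ (fun j => F j + `|F j|)).
  apply: nondecreasing_is_cvgn; first exact: psumZ_nondecreasing.
  exists (2 * L) => _ [n _ <-]; rewrite psumZD.
  have := FL n; have := ler_norm_psumZ F n; have := ler_norm (psumZ F n); lra.
have -> : psumZ F = psumZ (fun j => F j + `|F j|) - psumZ (fun j => `|F j|).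
  by apply/funext => n; rewrite !fctE psumZD addrK.
exact: is_cvgB.
Qed.

Lemma sumZD F G : summableZ F -> summableZ G ->
  sumZ (fun j => F j + G j) = sumZ F + sumZ G.
Proof.
move=> /summableZ_cvg cF /summableZ_cvg cG; rewrite !sumZE -limD //.
by congr (limn _); apply/funext => n; rewrite psumZD.
Qed.

Lemma sumZM (a : R) F : summableZ F -> sumZ (fun j => a * F j) = a * sumZ F.
Proof.
move=> /summableZ_cvg cF; rewrite !sumZE; apply/cvg_lim => //.
rewrite (_ : psumZ _ = fun n => a * psumZ F n).
  exact: cvgM (cvg_cst _) cF.
by apply/funext => n; rewrite psumZM.
Qed.

Lemma norm_sumZ_le F (L : R) : (forall n, psumZ (fun j => `|F j|) n <= L) ->
  `|sumZ F| <= L.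
Proof.
move=> FL; have cF : cvgn (psumZ F) by apply: summableZ_cvg; exists L.
rewrite sumZE -lim_norm //; apply: limr_le; first exact: is_cvg_norm.
by apply: nearW => n; apply: le_trans (FL n); exact: ler_norm_psumZ.
Qed.

End bilateral_sums.

Section bounded_sequences.
Context {R : realType}.
Implicit Types v w : int -> R.

(** Stability needs explicit real constants; the extended norm [linf_norm] matters only through its
    finiteness, which [linf_inverse] requires. *)
Definition bdd v (c : R) := forall i, `|v i| <= c.

Lemma linf_bdd v c : bdd v c -> linf v.
Proof.
move=> vc; rewrite /linf /linf_norm (@le_lt_trans _ _ c%:E) ?ltry //.
by apply: ge_ereal_sup => _ [i _ <-]; rewrite lee_fin.
Qed.

Lemma bdd_linf v : linf v -> exists c, bdd v c.
Proof.
rewrite /linf /linf_norm => vfin.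
have vi i : ((`|v i|)%:E <= ereal_sup (range (fun i => (`|v i|)%:E)))%E.
  by apply: ereal_sup_ubound; exists i.
exists (fine (linf_norm v)) => i; rewrite -lee_fin fineK ?vi //.
by rewrite fin_real // vfin andbT (lt_le_trans _ (vi 0)) // ltNyr.
Qed.

End bounded_sequences.

(** * Diagonally dominant three-point operators on bounded sequences *)

Section upwind_inverse.
Context {R : realType}.
Variables (A : int -> int -> R) (a b : R).
Hypotheses (a0 : 0 <= a) (b0 : 0 <= b).
Hypothesis AE : forall v i,
  matvec A v i = (1 + (a + b)) * v i - a * v (i - 1) - b * v (i + 1).

Let s0 : 0 < 1 + (a + b).
Proof. by rewrite ltr_pwDl ?addr_ge0. Qed.

(** With [m] the supremum of [|w|], perhaps not attained, isolating the diagonal term gives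
    [(1 + a + b) m <= c + (a + b) m], so [m <= c]. Boundedness of [w] is essential: when [a + b > 0]
    the homogeneous recurrence has unbounded solutions. *)
Lemma upwind_max_principle v w c :
  linf w -> matvec A w = v -> bdd v c -> bdd w c.
Proof.
move=> /bdd_linf[c0 wc0] Awv vc i.
have step C : bdd w C -> bdd w ((c + (a + b) * C) / (1 + (a + b))).
  move=> wC j; rewrite ler_pdivlMr //.
  have := AE w j; rewrite Awv => e.
  have {}e : (1 + (a + b)) * w j = v j + (a * w (j - 1) + b * w (j + 1)) by lra.
  rewrite mulrC -[1 + (a + b)](ger0_norm (ltW s0)) -normrM e.
  rewrite (le_trans (ler_normD _ _)) // lerD //.
  rewrite (le_trans (ler_normD _ _)) // mulrDl !normrM (ger0_norm a0) (ger0_norm b0).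
  by rewrite lerD // ler_wpM2l.
pose m := sup (range (fun i => `|w i|)).
have sm : has_sup (range (fun i => `|w i|)).
  by split; [exists `|w 0|, 0|exists c0 => _ [j _ <-]].
have wm : bdd w m by move=> j; apply: ub_le_sup; [exact: sm.2|exists j].
apply: (le_trans (wm i)).
have : m <= (c + (a + b) * m) / (1 + (a + b)).
  apply: ge_sup; first exact: sm.1.
  by move=> _ [j _ <-]; exact: step.
by rewrite ler_pdivlMr // mulrDr mulr1; lra.
Qed.

Let q := (a + b) / (1 + (a + b)).
Let q01 : 0 <= q < 1.
Proof.
rewrite divr_ge0 ?addr_ge0 ?ler01 //= ltr_pdivrMr // mul1r; lra.
Qed.

Let T (v w : int -> R) (i : int) : R :=
  (v i + a * w (i - 1) + b * w (i + 1)) / (1 + (a + b)).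

Let T_contraction v w w' C : bdd (fun i => w i - w' i) C ->
  bdd (fun i => T v w i - T v w' i) (q * C).
Proof.
move=> wC i; rewrite /T /q -mulrBl normrM normfV.
rewrite (ger0_norm (ltW s0)).
rewrite mulrAC; apply: ler_wpM2r; first by rewrite invr_ge0 ltW.
rewrite (_ : _ - _ = a * (w (i - 1) - w' (i - 1)) + b * (w (i + 1) - w' (i + 1))); last by lra.
rewrite (le_trans (ler_normD _ _)) // mulrDl !normrM (ger0_norm a0) (ger0_norm b0).
by rewrite lerD // ler_wpM2l.
Qed.

(** Jacobi iteration from 0 with ratio [q = (a + b) / (1 + a + b) < 1]. The ball of radius [c] is
    invariant, and pointwise limits are enough because the fixed-point equation at [i] involves
    three coordinates only. *)
Lemma upwind_surjective v c : bdd v c -> exists2 w, linf w & matvec A w = v.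
Proof.
move=> vc.
have c0 : 0 <= c by apply: le_trans (vc 0).
pose w_ n := iter n (T v) (fun=> 0).
have q0 : 0 <= q by case/andP: q01.
have q1 : q < 1 by case/andP: q01.
have step n : bdd (fun i => w_ n.+1 i - w_ n i) (c * q ^+ n).
  elim: n => [i|n IH] /=.
    rewrite expr0 mulr1 subr0 /T !mulr0 !addr0 normrM normfV.
    rewrite (ger0_norm (ltW s0)).
    rewrite ler_pdivrMr //.
    by rewrite (le_trans (vc i)) // ler_peMr // lerDl addr_ge0.
  by rewrite exprS mulrCA; exact: T_contraction.
have cw i : cvgn (fun n => w_ n i).
  have -> : (fun n => w_ n i) = series (fun n => w_ n.+1 i - w_ n i).
    by apply/funext => n; rewrite /series /= telescope_sumr // subr0.
  apply: normed_cvg; apply: (series_le_cvg _ _ (fun n => step n i)) => [n|n|] //.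
    by rewrite mulr_ge0 ?exprn_ge0.
  apply: is_cvg_geometric_series; rewrite ger0_norm //.
have wb n : bdd (w_ n) c.
  elim: n => [i|n IH i] /=; first by rewrite normr0.
  rewrite /T normrM normfV (ger0_norm (ltW s0)).
  rewrite ler_pdivrMr //.
  rewrite mulrDr mulr1 -addrA (le_trans (ler_normD _ _)) // lerD //.
  rewrite (le_trans (ler_normD _ _)) // mulrDr !normrM (ger0_norm a0) (ger0_norm b0).
  by rewrite lerD // mulrC ler_wpM2r.
pose w i := limn (fun n => w_ n i).
exists w.
  apply: (@linf_bdd _ _ c) => i; rewrite /w -lim_norm //.
  apply: limr_le; first exact: is_cvg_norm.
  by apply: nearW => n; exact: wb.
apply/funext => i; rewrite AE.
have wi : w i = T v w i.
  have c1 : w_ n.+1 i @[n --> \oo] --> w i.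
    by rewrite (cvg_shiftS (fun n => w_ n i)); exact: cw.
  have c2 : T v (w_ n) i @[n --> \oo] --> T v w i.
    apply: cvgM; last exact: cvg_cst.
    apply: cvgD; first apply: cvgD.
    - exact: cvg_cst.
    - by apply: cvgM; [exact: cvg_cst|exact: cw].
    - by apply: cvgM; [exact: cvg_cst|exact: cw].
  exact: cvg_unique c1 c2.
rewrite {1}wi /T mulrC divfK ?gt_eqF //; lra.
Qed.

(** [linf_inverse] is a choice by [get]; existence makes the chosen sequence a true solution, and
    the maximum principle bounds it. *)
Lemma linf_inverseP v c : bdd v c ->
  [/\ linf (linf_inverse A v), matvec A (linf_inverse A v) = v &
      bdd (linf_inverse A v) c].
Proof.
move=> vc; have [w0 w0l w0A] := upwind_surjective vc.
have [wl wA] : [set w | linf w /\ matvec A w = v] (linf_inverse A v).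
  exact: (@getI _ [set w | linf w /\ matvec A w = v] w0 (conj w0l w0A)).
by split => //; apply: upwind_max_principle vc.
Qed.

Lemma linf_inverse_unique v w c : bdd v c -> linf w -> matvec A w = v ->
  linf_inverse A v = w.
Proof.
move=> vc wl wA; have [l e _] := linf_inverseP vc.
apply/funext => i; apply/eqP; rewrite -subr_eq0 -normr_eq0 eq_le normr_ge0 andbT.
set D := fun j => linf_inverse A v j - w j.
have [c1 b1] := bdd_linf l; have [c2 b2] := bdd_linf wl.
have Dl : linf D.
  apply: (@linf_bdd _ _ (c1 + c2)) => j.
  by rewrite (le_trans (ler_normB _ _)) // lerD.
apply: (@upwind_max_principle (fun=> 0) D 0 Dl); last by move=> j; rewrite normr0.
apply/funext => j; rewrite AE /D.
by have := congr1 (@^~ j) e; have := congr1 (@^~ j) wA; rewrite !AE => <-; lra.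
Qed.

Lemma linf_inverseD v w c c' : bdd v c -> bdd w c' ->
  linf_inverse A (fun i => v i + w i) =
  fun i => linf_inverse A v i + linf_inverse A w i.
Proof.
move=> vc wc; have [lv ev bv] := linf_inverseP vc.
have [lw ew bw] := linf_inverseP wc.
apply: (@linf_inverse_unique _ _ (c + c')).
- by move=> i; rewrite (le_trans (ler_normD _ _)) // lerD.
- apply: (@linf_bdd _ _ (c + c')) => i.
  by rewrite (le_trans (ler_normD _ _)) // lerD.
- apply/funext => j.
  by have := congr1 (@^~ j) ev; have := congr1 (@^~ j) ew; rewrite !AE => <- <-; lra.
Qed.

Lemma linf_inverseZ v k c : bdd v c ->
  linf_inverse A (fun i => k * v i) = fun i => k * linf_inverse A v i.
Proof.
move=> vc; have [lv ev bv] := linf_inverseP vc.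
apply: (@linf_inverse_unique _ _ (`|k| * c)).
- by move=> i; rewrite normrM ler_wpM2l.
- by apply: (@linf_bdd _ _ (`|k| * c)) => i; rewrite normrM ler_wpM2l.
- by apply/funext => j; have := congr1 (@^~ j) ev; rewrite !AE => <-; lra.
Qed.

End upwind_inverse.

Section upwind_matrix.
Context {R : realType} (M : model R).
Variables h dx y : R.
Hypotheses (h0 : 0 < h) (dx0 : 0 < dx).
Let alpha := h / dx * muX M y.
Let beta := h / (2 * dx ^+ 2) * sigX M y ^+ 2.

(** The opposites of the off-diagonal entries: the first component weighs the left neighbour
    [i - 1], the second the right neighbour [i + 1]. The indicators put the drift on the upwind
    side. *)
Definition updown : R * R :=
  (beta + `|alpha| * (alpha < 0)%R%:R, beta + `|alpha| * (alpha > 0)%R%:R).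

Lemma updown_ge0 : 0 <= updown.1 /\ 0 <= updown.2.
Proof.
have b0 : 0 <= beta.
  by apply: mulr_ge0; [apply: divr_ge0; [exact: ltW|rewrite mulr_ge0 // exprn_ge0 // ltW]|exact: sqr_ge0].
by split; apply: addr_ge0 => //; apply: mulr_ge0.
Qed.

Lemma matvec_matA v i : matvec (matA M h dx y) v i =
  (1 + (updown.1 + updown.2)) * v i - updown.1 * v (i - 1) - updown.2 * v (i + 1).
Proof.
rewrite /matvec sumZE.
rewrite (cvg_lim _ (@cvg_psumZ_tri R (fun j => matA M h dx y i j * v j) i _)) //.
  have -> : matA M h dx y i (i - 1) = - updown.1.
    by rewrite /matA ifT ?opprD //; apply/eqP; lia.
  have -> : matA M h dx y i (i + 1) = - updown.2.
    rewrite /matA ifF; last by apply/negbTE; lia.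
    rewrite ifF; last by apply/negbTE; lia.
    by rewrite ifT ?opprD //; apply/eqP; lia.
  have -> : matA M h dx y i i = 1 + 2 * beta + `|alpha|.
    by rewrite /matA ifF ?eqxx //; apply/negbTE; lia.
  have e : updown.1 + updown.2 = 2 * beta + `|alpha|.
    rewrite /updown /=; case: (ltgtP alpha 0) => [_|_|al0] /=; rewrite ?mulr1 ?mulr0 ?addr0; try by ring.
    by rewrite al0 normr0; ring.
  by rewrite -(addrA 1) -e; ring.
move=> j j1 j2 j3; rewrite /matA !ifF ?mul0r //; apply/negbTE; lia.
Qed.

End upwind_matrix.

(** * Bilateral Riemann sums *)

Section quadrature.
Context {R : realType}.
Local Notation mu := (@lebesgue_measure R).
Implicit Types (f g F : R -> R).

Lemma psumZ_rev (G : int -> R) n : psumZ (fun j => G (- j)) n = psumZ G n.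
Proof.
rewrite /psumZ (reindex_inj rev_ord_inj); apply: eq_bigr => k _ /=.
by congr G; have := ltn_ord k; lia.
Qed.

(** With a primitive vanishing at -oo, integrals over cells are differences, so that the errors of
    successive cells telescope. *)
Definition lower_integral g (x : R) : R := \int[mu]_(z in `]-oo, x]) g z.
Local Notation I := lower_integral.

Let intS g (D : set R) : measurable D -> mu.-integrable setT (EFin \o g) ->
  mu.-integrable D (EFin \o g).
Proof. by move=> mD; exact: integrableS. Qed.

Let int_abs g : mu.-integrable setT (EFin \o g) ->
  mu.-integrable setT (EFin \o (fun x => `|g x|)).
Proof. by move=> /integrable_norm. Qed.

Let intB g1 g2 (D : set R) : measurable D -> mu.-integrable D (EFin \o g1) ->
  mu.-integrable D (EFin \o g2) ->
  mu.-integrable D (EFin \o (fun x => g1 x - g2 x)).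
Proof. by move=> mD i1 i2; exact: (integrableB _ i1 i2). Qed.

Lemma lower_integralB g a b : a <= b -> mu.-integrable setT (EFin \o g) ->
  I g b - I g a = \int[mu]_(z in `]a, b]) g z.
Proof.
move=> ab ig; rewrite /I Rintegral_itvB //.
exact: intS.
Qed.

Lemma norm_lower_integralB g a b : a <= b -> mu.-integrable setT (EFin \o g) ->
  `|I g b - I g a| <= I (fun x => `|g x|) b - I (fun x => `|g x|) a.
Proof.
move=> ab ig; rewrite !lower_integralB //; last exact: int_abs.
by apply: le_normr_Rintegral => //; exact: intS.
Qed.

Lemma lower_integral_le g a b : a <= b -> mu.-integrable setT (EFin \o g) ->
  (forall x, 0 <= g x) -> I g a <= I g b.
Proof.
move=> ab ig g0; rewrite -subr_ge0 lower_integralB //.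
exact: Rintegral_ge0.
Qed.

Lemma lower_integral_ge0 g a : (forall x, 0 <= g x) -> 0 <= I g a.
Proof. by move=> g0; exact: Rintegral_ge0. Qed.

Lemma lower_integral_leT g a : mu.-integrable setT (EFin \o g) ->
  (forall x, 0 <= g x) -> I g a <= \int[mu]_z g z.
Proof.
move=> ig g0; rewrite -lee_fin /I /Rintegral !fineK.
- apply: ge0_subset_integral => //; first exact: measurable_int ig.
  by move=> x _; rewrite lee_fin.
- exact: integrable_fin_num.
- by apply: integrable_fin_num => //; exact: intS.
Qed.

(** Dominated convergence. The predicate [P] treats both ends of the line at once: constantly true
    when [u] tends to +oo, constantly false when it tends to -oo. *)
Lemma cvg_lower_integral g (u : nat -> R) (P : R -> bool) :
  mu.-integrable setT (EFin \o g) ->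
  (forall x, \forall n \near \oo, (x <= u n) = P x) ->
  I g (u n) @[n --> \oo] --> \int[mu]_z (if P z then g z else 0).
Proof.
move=> ig uP; rewrite /I.
pose f_ n z := (if z <= u n then g z else 0)%:E.
pose f z := (if P z then g z else 0)%:E.
have mg : measurable_fun (setT : set (measurableTypeR R)) g by apply/measurable_EFinP; exact: measurable_int ig.
have mf_ n : measurable_fun (setT : set (measurableTypeR R)) (f_ n).
  apply/measurable_EFinP; apply: measurable_fun_ifT => //.
  exact: measurable_fun_ler.
have cf z : f_ n z @[n --> \oo] --> f z.
  apply: cvg_near_cst; near=> n; rewrite /f_ /f; congr (if _ then _ else _)%:E.
  by near: n; exact: uP.
have mf : measurable_fun (setT : set (measurableTypeR R)) f.
  by apply: (emeasurable_fun_cvg _ _ mf_) => z _; exact: cf.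
have [||intf _] := dominated_convergence measurableT mf_ mf _ (int_abs ig).
- by apply: aeW => z _; exact: cf.
- apply: aeW => z n _ /=; rewrite lee_fin; case: ifP => // _.
  by rewrite normr0.
have -> : [sequence (\int[mu]_(x in setT) f_ n x)%E]_n =
    fun n => (\int[mu]_(z in `]-oo, u n]) (g z)%:E)%E.
  apply/funext => n /=; rewrite [RHS]integral_mkcond; apply: eq_integral => z _.
  by rewrite /f_ patchE mem_setE in_itv /=; case: ifP.
rewrite -[X in _ --> X]fineK; last exact: (integrable_fin_num _ intf).
by move=> /fine_cvg.
Unshelve. all: by end_near. Qed.

Variables (F dF : R -> R).
Hypothesis FdF : forall x, is_derive x (1 : R) F (dF x).
Hypothesis dFc : continuous dF.
Hypothesis iF : mu.-integrable setT (EFin \o F).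
Hypothesis idF : mu.-integrable setT (EFin \o dF).

Let adF (x : R) : R := `|dF x|.

Lemma increment_le a b : a <= b -> `|F b - F a| <= I adF b - I adF a.
Proof.
rewrite le_eqVlt => /predU1P[<-|ab]; first by rewrite !subrr normr0.
have Fc : continuous F.
  by move=> x; apply/differentiable_continuous/derivable1_diffP; case: (FdF x).
have e : F b - F a = I dF b - I dF a.
  rewrite lower_integralB ?ltW // Rintegral_itv_obnd_cbnd; last exact: intS.
  rewrite /Rintegral (@continuous_FTC2 _ _ F) //.
  - by apply: continuous_subspaceT => x; exact: dFc.
  - split.
    + by move=> x _; case: (FdF x).
    + by apply: cvg_at_right_filter; exact: Fc.
    + by apply: cvg_at_left_filter; exact: Fc.
  - by move=> x _; rewrite derive1E; apply: derive_val.
by rewrite e norm_lower_integralB // ltW.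
Qed.

(** Left rectangle rule: on a cell, [F] departs from its left value by at most the integral of
    [|F'|] over that cell. Summed over cells, the error is the step times the total variation. *)
Lemma cell_error a (de : R) : 0 < de ->
  `|de * F a - (I F (a + de) - I F a)| <= de * (I adF (a + de) - I adF a).
Proof.
move=> de0; have ab : a <= a + de by rewrite lerDl ltW.
rewrite lower_integralB //.
have mitv : mu `]a, a + de] = de%:E.
  by rewrite lebesgue_measure_itv /= lte_fin ltrDl de0 -EFinB addrC addKr.
have icst (c : R) : mu.-integrable `]a, (a + de)] (EFin \o cst c).
  apply/integrableP; split; first exact/measurable_EFinP.
  rewrite (eq_integral (cst `|c|%:E)) // integral_cst //.
  by rewrite [X in (_ * X)%E]mitv -EFinM ltry.
have cstE (c : R) : de * c = \int[mu]_(z in `]a, a + de]) c.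
  by rewrite Rintegral_cst // mulrC; congr (_ * _); rewrite [X in fine X]mitv.
rewrite !cstE -RintegralB //; [|exact: icst|exact: intS].
have iB : mu.-integrable `]a, (a + de)] (EFin \o (fun t => F a - F t)).
  by apply: intB => //; [exact: icst|exact: intS].
apply: (le_trans (le_normr_Rintegral _ iB)) => //.
apply: le_Rintegral => //.
- exact: (integrable_norm iB).
- exact: icst.
- move=> z /=; rewrite in_itv /= => /andP[az zb].
  rewrite distrC (le_trans (increment_le (ltW az))) // lerD2r.
  by apply: lower_integral_le => //; [exact: int_abs|move=> x; rewrite /adF].
Qed.

Lemma riemann_sum_error a (de : R) m : 0 < de ->
  `|\sum_(k < m) F (a + k%:R * de) * de - (I F (a + m%:R * de) - I F a)| <=
  de * (I adF (a + m%:R * de) - I adF a).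
Proof.
move=> de0; elim: m => [|m IH].
  by rewrite big_ord0 mul0r addr0 !subrr mulr0 normr0.
rewrite big_ord_recr /=.
have H := cell_error (a + m%:R * de) de0.
have e : a + m%:R * de + de = a + m.+1%:R * de by rewrite -natr1; ring.
rewrite e in H; move: IH H.
set s := \sum_(i < m) _; set b := I F _; set c := I F _; set d := I F _ => IH H.
rewrite (_ : _ - _ = (s - (b - c)) + (de * F (a + m%:R * de) - (d - b))); last by rewrite mulrC; ring.
rewrite (le_trans (ler_normD _ _)) // (le_trans (lerD IH H)) // -mulrDr.
by rewrite le_eqVlt; apply/orP; left; apply/eqP; congr (_ * _); ring.
Qed.

Let V := \int[mu]_z adF z.

Let shift_sum (i : int) (de : R) n : psumZ (fun j => F ((j - i)%:~R * de) * de) n =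
  \sum_(k < n.*2.+1) F ((- n%:Z - i)%:~R * de + k%:R * de) * de.
Proof.
apply: eq_bigr => k _; congr (F _ * _); rewrite -mulrDl; congr (_ * _).
by rewrite -[k%:R]/(k%:Z%:~R) -intrD; congr (_%:~R); ring.
Qed.

Let psum_error (i : int) (de : R) n : 0 < de ->
  `|psumZ (fun j => F ((j - i)%:~R * de) * de) n -
    (I F ((n%:Z + 1 - i)%:~R * de) - I F ((- n%:Z - i)%:~R * de))| <= de * V.
Proof.
move=> de0; rewrite shift_sum.
set a := (- n%:Z - i)%:~R * de.
have -> : (n%:Z + 1 - i)%:~R * de = a + n.*2.+1%:R * de.
  rewrite /a -mulrDl; congr (_ * _).
  rewrite -[n.*2.+1%:R]/(n.*2.+1%:Z%:~R) -intrD; congr (_%:~R); lia.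
apply: (le_trans (riemann_sum_error _ _ de0)).
rewrite ler_pM2l // lerBlDr (le_trans (lower_integral_leT _ _ _)) //.
- exact: int_abs.
- by rewrite /adF.
- by rewrite -/V lerDl; apply: lower_integral_ge0 => x; rewrite /adF.
Qed.

Let psum_le (i : int) (de : R) n : (forall x, 0 <= F x) -> 0 < de ->
  psumZ (fun j => F ((j - i)%:~R * de) * de) n <= \int[mu]_z F z + de * V.
Proof.
move=> F0 de0; have := psum_error i n de0; rewrite ler_norml => /andP[_].
have := lower_integral_leT ((n%:Z + 1 - i)%:~R * de) iF F0.
have := lower_integral_ge0 ((- n%:Z - i)%:~R * de) F0.
by lra.
Qed.

Let sum_error (i : int) (de : R) : 0 < de ->
  let G j := F ((j - i)%:~R * de) * de in
  cvgn (psumZ G) -> `|sumZ G - \int[mu]_z F z| <= de * V.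
Proof.
move=> de0 G cG; rewrite sumZE.
have c1 : I F ((n%:Z + 1 - i)%:~R * de) @[n --> \oo] --> \int[mu]_z F z.
  apply: (@cvg_lower_integral _ _ xpredT) => // x.
  exists (`|i| + Num.truncn (`|x| / de) + 1)%N => // n /= ni.
  rewrite -ler_pdivrMr // (le_trans (ler_norm _)) // normrM normfV (gtr0_norm de0).
  rewrite (le_trans (ltW (truncnS_gt _))) //.
  move: (Num.truncn _) ni => m ni; rewrite -[m.+1%:R]/(m.+1%:Z%:~R) ler_int; lia.
have c2 : I F ((- n%:Z - i)%:~R * de) @[n --> \oo] --> 0.
  have -> : 0 = \int[mu]_z (if xpred0 z then F z else 0) :> R.
    by rewrite Rintegral_cst // mul0r.
  apply: (@cvg_lower_integral _ _ xpred0) => // x.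
  exists (`|i| + Num.truncn (`|x| / de) + 2)%N => // n /= ni.
  apply/negbTE; rewrite -ltNge -ltr_pdivlMr // -ltrN2.
  rewrite (@le_lt_trans _ _ (`|x| / de)) //.
    by rewrite -mulNr ler_pM2r ?invr_gt0 // lerNl lerNnormlW.
  rewrite (lt_le_trans (truncnS_gt _)) // -intrN.
  move: (Num.truncn _) ni => m ni; rewrite -[m.+1%:R]/(m.+1%:Z%:~R) ler_int; lia.
have c3 : `|psumZ G n - (I F ((n%:Z + 1 - i)%:~R * de) - I F ((- n%:Z - i)%:~R * de))|
    @[n --> \oo] --> `|limn (psumZ G) - (\int[mu]_z F z - 0)|.
  by apply: cvg_norm; apply: cvgB => //; exact: cvgB.
rewrite -[\int[mu]_z F z]subr0 -(cvg_lim _ c3) //.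
apply: limr_le; first by apply/cvg_ex; eexists; exact: c3.
by apply: nearW => n; exact: psum_error.
Qed.

(** A negative jump coefficient produces a negative step. Symmetric partial sums are invariant under
    reflection, which restores a positive step and replaces the shift [i] by [- i]. *)
Let neg_step (i : int) (de : R) : de < 0 ->
  psumZ (fun j => F ((j - i)%:~R * de) * `|de|) =
  psumZ (fun j => F ((j - (- i))%:~R * - de) * - de).
Proof.
move=> de0; apply/funext => n; rewrite -psumZ_rev; apply: eq_bigr => k _.
rewrite ltr0_norm //; congr (F _ * _); rewrite mulrN -mulNr; congr (_ * _).
by rewrite -intrN; congr (_%:~R); ring.
Qed.

Lemma bilateral_riemann_sum_le (i : int) (de : R) n :
  (forall x, 0 <= F x) -> de != 0 ->
  psumZ (fun j => F ((j - i)%:~R * de) * `|de|) n <=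
  \int[mu]_z F z + `|de| * \int[mu]_z `|dF z|.
Proof.
move=> F0; case: (ltgtP de 0) => // de0 _; last first.
  by rewrite gtr0_norm //; exact: psum_le.
by rewrite neg_step // ltr0_norm // psum_le // oppr_gt0.
Qed.

Lemma bilateral_riemann_sum_error (i : int) (de : R) : de != 0 ->
  let G j := F ((j - i)%:~R * de) * `|de| in
  cvgn (psumZ G) ->
  `|sumZ G - \int[mu]_z F z| <= `|de| * \int[mu]_z `|dF z|.
Proof.
case: (ltgtP de 0) => // de0 _ G; last first.
  by rewrite /G gtr0_norm //; exact: sum_error.
rewrite /G sumZE neg_step // (ltr0_norm de0).
by apply: sum_error; rewrite oppr_gt0.
Qed.

End quadrature.

(** * Derivatives relative to a set and Taylor bounds *)

Section derivatives_within.
Context {R : realType}.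
Implicit Types (D : set R) (f g : R -> R) (x y z l : R).

(** Giving the difference quotient the value [l] at [x] removes the puncture from the filter, so
    derivatives within [D] and ordinary ones are compared through plain limits. *)
Lemma is_derive_within_caratheodory D f x l : is_derive_within D f x l <->
  exists q : R -> R, [/\ forall z, f z - f x = q z * (z - x), q x = l &
    q z @[z --> within D (nbhs x)] --> l].
Proof.
split=> [fl|[q [fq qx ql]]].
  exists (fun z => if z == x then l else diff_quot f x z); split.
  - move=> z; case: eqVneq => [->|zx]; first by rewrite !subrr mulr0.
    by rewrite /diff_quot divfK // subr_eq0.
  - by rewrite eqxx.
  - move=> B Bl.
    have H : nbhs x (fun z => z != x -> D z -> B (diff_quot f x z)) := fl B Bl.
    apply: (filterS _ H) => z Hz Dz /=; case: eqVneq => [_|zx].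
      exact: nbhs_singleton.
    exact: Hz.
move=> B Bl; have H : nbhs x (fun z => D z -> B (q z)) := ql B Bl.
apply: (filterS _ H) => z Hz zx Dz.
by rewrite /= /diff_quot fq mulfK ?subr_eq0 //; exact: Hz.
Qed.

Lemma is_derive_within_of f x l D : is_derive x (1 : R) f l ->
  is_derive_within D f x l.
Proof.
move=> /is_derive1_caratheodory[q [fq qc qx]].
apply/is_derive_within_caratheodory; exists q; split => //.
by apply: cvg_within_filter; rewrite -qx; exact: qc.
Qed.

Lemma is_derive_of_within f x l D : nbhs x D -> is_derive_within D f x l ->
  is_derive x (1 : R) f l.
Proof.
move=> Dx /is_derive_within_caratheodory[q [fq qx ql]].
apply/is_derive1_caratheodory; exists q; split => //.
move=> B; rewrite qx => Bl; have := ql B Bl; rewrite /= !nbhs_simpl /= /within /=.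
by move=> H; near=> z; apply: (near H z) => //; near: z.
Unshelve. all: by end_near. Qed.

Lemma is_derive_within_continuous D f x l : is_derive_within D f x l ->
  f z @[z --> within D (nbhs x)] --> f x.
Proof.
move=> /is_derive_within_caratheodory[q [fq qx ql]].
have -> : f = fun z => f x + q z * (z - x).
  by apply/funext => z; rewrite -fq addrC subrK.
suff : f x + q z * (z - x) @[z --> within D (nbhs x)] --> f x + l * (x - x).
  by rewrite !subrr !mulr0 !addr0.
apply: cvgD; first exact: cvg_cst.
apply: cvgM => //; apply: cvgB; last exact: cvg_cst.
exact: cvg_within.
Qed.

Lemma is_derive_withinB D f g x l m : is_derive_within D f x l ->
  is_derive_within D g x m -> is_derive_within D (fun z => f z - g z) x (l - m).
Proof.
move=> fl gm; rewrite /is_derive_within.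
have -> : diff_quot (fun z => f z - g z) x =
    fun z => diff_quot f x z - diff_quot g x z.
  by apply/funext => z; rewrite /diff_quot -mulrBl; congr (_ / _); ring.
exact: cvgB.
Qed.

Lemma is_derive_within_monomial D c y n x :
  is_derive_within D (fun z => c * (z - y) ^+ n.+1) x
    (c * (n.+1%:R * (x - y) ^+ n)).
Proof.
apply: is_derive_within_of.
have dB : is_derive x (1 : R) (fun z : R => z - y) 1.
  by apply: is_derive_eq; rewrite subr0.
have := is_deriveX n.+1 dB => dX.
have dcX := is_deriveZ c dX.
have -> : (fun z => c * (z - y) ^+ n.+1) = c \*: (fun z : R => z - y) ^+ n.+1.
  by apply/funext => z; rewrite /= exprfctE.
by apply: (is_derive_eq dcX); rewrite /GRing.scale /= mulr1.
Qed.

(** Every point strictly between [a] and [b] is interior to [D], so the derivative there is an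
    ordinary one; at the endpoints only continuity within [D] is used. *)
Lemma MVT_within D f df a b : is_interval D ->
  (forall x, D x -> is_derive_within D f x (df x)) -> D a -> D b -> a < b ->
  exists c, [/\ a < c < b, D c & f b - f a = df c * (b - a)].
Proof.
move=> Di Df Da Db ab.
have Dab c : a <= c <= b -> D c by apply: Di.
have [||c] := @MVT _ f df a b ab.
- move=> x; rewrite in_itv /= => /andP[ax xb].
  apply: (@is_derive_of_within _ _ _ D); last by apply: Df; apply: Dab; rewrite !ltW.
  have : \forall z \near x, z \in `]a, b[ by apply: near_in_itvoo; rewrite in_itv /= ax.
  by apply: filterS => z; rewrite in_itv /= => /andP[az zb]; apply: Dab; rewrite !ltW.
- apply/subspace_continuousP => x; rewrite /= in_itv /= => xab.
  have := is_derive_within_continuous (Df x (Dab _ xab)).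
  move=> H B Bx; have := H B Bx; rewrite /= !nbhs_simpl /= /within /=.
  by apply: filterS => z Hz; rewrite /= in_itv /= => zab; apply: Hz; exact: Dab.
rewrite in_itv /= => /andP[ac cb] e; exists c; split => //; first by rewrite ac.
by apply: Dab; rewrite !ltW.
Qed.

Definition between (a b c : R) := Num.min a b <= c <= Num.max a b.

Lemma betweenl a b : between a b a.
Proof. by rewrite /between ge_min le_max !lexx. Qed.

Lemma betweenr a b : between a b b.
Proof. by rewrite /between ge_min le_max !lexx !orbT. Qed.

Lemma between_trans a b c e : between a b c -> between a c e -> between a b e.
Proof. by rewrite /between; case: (leP a b); case: (leP a c) => *; apply/andP; split; lra. Qed.

Lemma between_dist a b c : between a b c -> `|c - a| <= `|b - a|.
Proof.
rewrite /between; case: (leP a b) => ab /andP[h1 h2].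
  by rewrite !ger0_norm; lra.
by rewrite !ler0_norm; lra.
Qed.

Lemma between_itv D a b c : is_interval D -> D a -> D b -> between a b c -> D c.
Proof.
rewrite /between => Di Da Db; case: (leP a b) => ab h; [exact: Di h|].
by apply: Di h.
Qed.

Lemma increment_bound D f df a b K : is_interval D ->
  (forall x, D x -> is_derive_within D f x (df x)) -> D a -> D b ->
  (forall c, between a b c -> `|df c| <= K) ->
  `|f b - f a| <= K * `|b - a|.
Proof.
move=> Di Df Da Db dfK.
case: (ltgtP a b) => ab.
- have [c [/andP[ac cb] _ ->]] := MVT_within Di Df Da Db ab.
  rewrite normrM ler_wpM2r // dfK // /between.
  by rewrite min_l ?max_r ?ltW // !ltW.
- have [c [/andP[ac cb] _ e]] := MVT_within Di Df Db Da ab.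
  rewrite distrC e normrM [`|b - a|]distrC ler_wpM2r // dfK // /between.
  by rewrite min_r ?max_l ?ltW // !ltW.
- by rewrite ab !subrr normr0 mulr0.
Qed.

(* The crude constant [K] instead of [K / n!] lets each order follow from the
   previous one by the mean value inequality alone. *)
Lemma taylor1 D f f1 f2 a b K : is_interval D ->
  (forall x, D x -> is_derive_within D f x (f1 x)) ->
  (forall x, D x -> is_derive_within D f1 x (f2 x)) -> D a -> D b ->
  (forall c, between a b c -> `|f2 c| <= K) ->
  `|f b - f a - f1 a * (b - a)| <= K * `|b - a| ^+ 2.
Proof.
move=> Di Df Df1 Da Db fK.
pose g z := f z - f1 a * (z - a) ^+ 1.
pose dg z := f1 z - f1 a * (1%:R * (z - a) ^+ 0).
have := @increment_bound D g dg a b (K * `|b - a|) Di _ Da Db.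
rewrite /g subrr expr0n /= mulr0 subr0 expr1 expr2 mulrA (addrAC (f b)).
apply.
  by move=> x Dx; apply: is_derive_withinB; [exact: Df|exact: is_derive_within_monomial].
move=> c ac; rewrite /dg expr0 !mulr1.
have K0 : 0 <= K by apply: le_trans (fK a (betweenl _ _)).
apply: (le_trans (@increment_bound D f1 f2 a c K Di Df1 Da _ _)).
- exact: between_itv ac.
- by move=> e ace; apply: fK; exact: between_trans ace.
- by rewrite ler_wpM2l // between_dist.
Qed.

Lemma taylor2 D f f1 f2 f3 a b K : is_interval D ->
  (forall x, D x -> is_derive_within D f x (f1 x)) ->
  (forall x, D x -> is_derive_within D f1 x (f2 x)) ->
  (forall x, D x -> is_derive_within D f2 x (f3 x)) -> D a -> D b ->
  (forall c, between a b c -> `|f3 c| <= K) ->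
  `|f b - f a - f1 a * (b - a) - 2^-1 * f2 a * (b - a) ^+ 2| <= K * `|b - a| ^+ 3.
Proof.
move=> Di Df Df1 Df2 Da Db fK.
pose g z := f z - f1 a * (z - a) ^+ 1 - 2^-1 * f2 a * (z - a) ^+ 2.
pose dg z := f1 z - f1 a * (1%:R * (z - a) ^+ 0) - 2^-1 * f2 a * (2%:R * (z - a) ^+ 1).
have := @increment_bound D g dg a b (K * `|b - a| ^+ 2) Di _ Da Db.
rewrite /g subrr !expr0n /= !mulr0 !subr0 expr1 -(mulrA K) -exprSr.
rewrite [f b - _ - _ - f a]addrAC [f b - _ - f a]addrAC.
apply.
  move=> x Dx; apply: is_derive_withinB; last exact: is_derive_within_monomial.
  by apply: is_derive_withinB; [exact: Df|exact: is_derive_within_monomial].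
move=> c ac; rewrite /dg expr0 !mulr1 expr1.
rewrite (_ : _ - _ - _ = f1 c - f1 a - f2 a * (c - a)); last by field.
have K0 : 0 <= K by apply: le_trans (fK a (betweenl _ _)).
apply: (le_trans (@taylor1 D f1 f2 f3 a c K Di Df1 Df2 Da _ _)).
- exact: between_itv ac.
- by move=> e ace; apply: fK; exact: between_trans ace.
- by rewrite ler_wpM2l // lerXn2r ?nnegrE ?between_dist.
Qed.

Lemma taylor3 D f f1 f2 f3 f4 a b K : is_interval D ->
  (forall x, D x -> is_derive_within D f x (f1 x)) ->
  (forall x, D x -> is_derive_within D f1 x (f2 x)) ->
  (forall x, D x -> is_derive_within D f2 x (f3 x)) ->
  (forall x, D x -> is_derive_within D f3 x (f4 x)) -> D a -> D b ->
  (forall c, between a b c -> `|f4 c| <= K) ->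
  `|f b - f a - f1 a * (b - a) - 2^-1 * f2 a * (b - a) ^+ 2
    - 6^-1 * f3 a * (b - a) ^+ 3| <= K * `|b - a| ^+ 4.
Proof.
move=> Di Df Df1 Df2 Df3 Da Db fK.
pose g z := f z - f1 a * (z - a) ^+ 1 - 2^-1 * f2 a * (z - a) ^+ 2
  - 6^-1 * f3 a * (z - a) ^+ 3.
pose dg z := f1 z - f1 a * (1%:R * (z - a) ^+ 0)
  - 2^-1 * f2 a * (2%:R * (z - a) ^+ 1) - 6^-1 * f3 a * (3%:R * (z - a) ^+ 2).
have := @increment_bound D g dg a b (K * `|b - a| ^+ 3) Di _ Da Db.
rewrite /g subrr !expr0n /= !mulr0 !subr0 expr1 -(mulrA K) -exprSr.
rewrite (_ : f b - _ - _ - _ - f a = f b - f a - f1 a * (b - a)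
  - 2^-1 * f2 a * (b - a) ^+ 2 - 6^-1 * f3 a * (b - a) ^+ 3); last by ring.
apply.
  move=> x Dx; apply: is_derive_withinB; last exact: is_derive_within_monomial.
  apply: is_derive_withinB; last exact: is_derive_within_monomial.
  by apply: is_derive_withinB; [exact: Df|exact: is_derive_within_monomial].
move=> c ac; rewrite /dg expr0 !mulr1 expr1.
rewrite (_ : _ - _ - _ - _ = f1 c - f1 a - f2 a * (c - a) - 2^-1 * f3 a * (c - a) ^+ 2);
  last by field.
have K0 : 0 <= K by apply: le_trans (fK a (betweenl _ _)).
apply: (le_trans (@taylor2 D f1 f2 f3 f4 a c K Di Df1 Df2 Df3 Da _ _)).
- exact: between_itv ac.
- by move=> e ace; apply: fK; exact: between_trans ace.
- by rewrite ler_wpM2l // lerXn2r ?nnegrE ?between_dist.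
Qed.

End derivatives_within.

(** * The Levy density *)

Section levy_density.
Context {R : realType}.
Variable M : model R.
Hypothesis lam0 : 0 < intensity M.
Hypothesis dens : probability_density (jumpdens M).
Hypothesis reg : levy_regular M.
Local Notation mu := (@lebesgue_measure R).
Local Notation nu := (levy M).

Lemma levy_ge0 x : 0 <= nu x.
Proof. by case: dens => _ p0 _; rewrite /levy mulr_ge0 // ltW. Qed.

Lemma levy_is_derive x : is_derive x (1 : R) nu (derive1 nu x).
Proof. by case: reg => d1 _ _ _; rewrite derive1E; exact: derivableP. Qed.

Lemma levy_continuous : continuous nu.
Proof.
by case: reg => d1 _ _ _ x; apply/differentiable_continuous/derivable1_diffP/d1.
Qed.

Lemma dlevy_continuous : continuous (derive1 nu).
Proof.
by case: reg => _ d2 _ _ x; apply/differentiable_continuous/derivable1_diffP/d2.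
Qed.

Lemma levy_integrable : mu.-integrable setT (EFin \o nu).
Proof.
case: dens => mp p0 p1.
have ip : mu.-integrable setT (EFin \o jumpdens M).
  apply/integrableP; split; first exact/measurable_EFinP.
  have -> : (\int[mu]_x `|(EFin \o jumpdens M) x| = 1)%E; last by rewrite ltry.
  by rewrite -p1; apply: eq_integral => x _ /=; rewrite ger0_norm.
have := integrableZl measurableT (intensity M) ip.
by apply: eq_integrable.
Qed.

(* A zero of the nonnegative density is a minimum, so there [nu' / nu * nu = 0]
   agrees with [nu']. *)
Lemma dlevy_integrable : mu.-integrable setT (EFin \o derive1 nu).
Proof.
case: reg => d1 _ i1 _; move: i1; rewrite /L1_levy.
apply: eq_integrable => // x _ /=; congr EFin.
have [n0|n0] := eqVneq (nu x) 0; last by rewrite divfK.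
rewrite n0 mulr0 derive1E.
have := @derive1_at_min _ nu (x - 1) (x + 1) x.
case; [lra|by move=> *|by rewrite in_itv /=; lra|by move=> *; rewrite n0 levy_ge0|].
by move=> _ ->.
Qed.

Definition levy_mass : R := \int[mu]_z nu z.
Definition dlevy_mass : R := \int[mu]_z `|derive1 nu z|.

Lemma levy_mass_ge0 : 0 <= levy_mass.
Proof. by apply: Rintegral_ge0 => x _; exact: levy_ge0. Qed.

Lemma dlevy_mass_ge0 : 0 <= dlevy_mass.
Proof. exact: Rintegral_ge0. Qed.

Lemma bounded_levy_integrable (g f : R -> R) (K : R) : continuous g ->
  (forall x, `|g x| <= K) -> continuous f -> mu.-integrable setT (EFin \o f) ->
  mu.-integrable setT (EFin \o (fun x => g x * f x)).
Proof.
move=> gc gK fc fi.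
have iKf : mu.-integrable setT (fun x => (K%:E * (EFin \o (fun x => `|f x|)%R) x)%E).
  by apply: integrableZl => //; exact: (integrable_norm fi).
apply: le_integrable iKf => //.
  apply/measurable_EFinP; apply: measurable_funM;
    exact: continuous_measurable_fun.
move=> x _ /=; rewrite lee_fin normrM [leRHS]normrM normr_id ler_wpM2r //.
by rewrite (le_trans (gK x)) // ler_norm.
Qed.

Variables (g dg : R -> R) (K ga x0 : R).
Hypothesis gd : forall x, is_derive x (1 : R) g (dg x).
Hypothesis dgc : continuous dg.
Hypothesis gK : forall x, `|g x| <= K.
Hypothesis dgK : forall x, `|dg x| <= K.

Let F z := g (x0 + ga * z) * nu z.
Let dF z := ga * dg (x0 + ga * z) * nu z + g (x0 + ga * z) * derive1 nu z.

Let affc : continuous (fun z : R => x0 + ga * z).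
Proof.
by move=> z; apply: cvgD; [exact: cvg_cst|apply: cvgM; [exact: cvg_cst|exact: cvg_id]].
Qed.

Let gc : continuous g.
Proof.
by move=> x; apply/differentiable_continuous/derivable1_diffP; case: (gd x).
Qed.

Let gac : continuous (fun z => g (x0 + ga * z)).
Proof. by move=> z; apply: continuous_comp; [exact: affc|exact: gc]. Qed.

Let dgac : continuous (fun z => dg (x0 + ga * z)).
Proof. by move=> z; apply: continuous_comp; [exact: affc|exact: dgc]. Qed.

Lemma jump_integrable : mu.-integrable setT (EFin \o F).
Proof.
apply: (@bounded_levy_integrable _ _ K); [exact: gac|by []|exact: levy_continuous|].
exact: levy_integrable.
Qed.

Let dF1_int : mu.-integrable setT (EFin \o (fun z => dg (x0 + ga * z) * nu z)).
Proof.
apply: (@bounded_levy_integrable _ _ K); [exact: dgac|by []|exact: levy_continuous|].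
exact: levy_integrable.
Qed.

Let dF2_int : mu.-integrable setT (EFin \o (fun z => g (x0 + ga * z) * derive1 nu z)).
Proof.
apply: (@bounded_levy_integrable _ _ K); [exact: gac|by []|exact: dlevy_continuous|].
exact: dlevy_integrable.
Qed.

Let dF_int : mu.-integrable setT (EFin \o dF).
Proof.
have i1 := integrableZl measurableT ga dF1_int.
have := integrableD measurableT i1 dF2_int.
by apply: eq_integrable => // z _ /=; rewrite -EFinM -EFinD mulrA.
Qed.

Let F_derive z : is_derive z (1 : R) F (dF z).
Proof.
have da : is_derive z (1 : R) (fun z : R => x0 + ga * z) ga.
  have H : is_derive z (1 : R) (ga \*: id) (ga *: 1) := is_deriveZ ga (is_derive_id z 1).
  have H' : is_derive z (1 : R) (fun z : R => x0 + ga * z) (0 + ga *: 1) :=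
    is_deriveD (is_derive_cst x0 z 1) H.
  by apply: (is_derive_eq H'); rewrite /GRing.scale /= add0r mulr1.
have dga : is_derive z (1 : R) (g \o (fun z : R => x0 + ga * z)) (ga * dg (x0 + ga * z)).
  have gd' := gd (x0 + ga * z).
  rewrite mulrC; exact: (@is_derive1_comp R g (fun z => x0 + ga * z) z _ _ gd' da).
apply: (is_derive_eq (is_deriveM dga (levy_is_derive z))); rewrite /dF /GRing.scale /= addrC; congr (_ + _).
by rewrite mulrC.
Qed.

Let dF_cont : continuous dF.
Proof.
move=> z; apply: cvgD; apply: cvgM.
- by apply: cvgM; [exact: cvg_cst|exact: dgac].
- exact: levy_continuous.
- exact: gac.
- exact: dlevy_continuous.
Qed.

Let K0 : 0 <= K. Proof. exact: le_trans (gK 0). Qed.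

Let dF_mass : \int[mu]_z `|dF z| <= `|ga| * K * levy_mass + K * dlevy_mass.
Proof.
have i1 : mu.-integrable setT (EFin \o (fun z => `|ga| * K * nu z)).
  have := integrableZl measurableT (`|ga| * K) levy_integrable.
  by apply: eq_integrable.
have i2 : mu.-integrable setT (EFin \o (fun z => K * `|derive1 nu z|)).
  have := integrableZl measurableT K (integrable_norm dlevy_integrable).
  by apply: eq_integrable.
have -> : `|ga| * K * levy_mass + K * dlevy_mass =
    \int[mu]_z (`|ga| * K * nu z + K * `|derive1 nu z|).
  rewrite RintegralD //; congr (_ + _); apply/esym/RintegralZl => //.
    exact: levy_integrable.
  exact: (integrable_norm dlevy_integrable).
apply: le_Rintegral => //.
- exact: (integrable_norm dF_int).
- by have := integrableD measurableT i1 i2; apply: eq_integrable.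
- move=> z _; rewrite /dF (le_trans (ler_normD _ _)) // lerD //.
    rewrite 2!normrM (ger0_norm (levy_ge0 z)) ler_wpM2r ?levy_ge0 //.
    by rewrite ler_wpM2l.
  by rewrite normrM ler_wpM2r.
Qed.

(** After the change of variable the sum is a Riemann sum of [F] with step [dx / ga]. The factor
    [ga] that the chain rule puts on [dg] cancels the one in the step, so only the term with the
    derivative of [nu] keeps [1 / |ga|], which is at most [e^-1]. *)
Lemma jump_quadrature (i : int) (dx e : R) : 0 < dx -> 0 < e -> e <= `|ga| ->
  let G j := g (x0 + (j - i)%:~R * dx) * (`|ga|^-1 * nu ((j - i)%:~R * dx / ga) * dx) in
  cvgn (psumZ G) ->
  `|sumZ G - \int[mu]_z F z| <= dx * K * (levy_mass + e^-1 * dlevy_mass).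
Proof.
move=> dx0 e0 ega G cG.
have ga0 : ga != 0 by rewrite -normr_eq0 gt_eqF // (lt_le_trans e0).
have de0 : dx / ga != 0 by rewrite mulf_neq0 ?invr_eq0 // gt_eqF.
have nde : `|dx / ga| = dx / `|ga| by rewrite normrM normfV gtr0_norm.
have GE : G = fun j => F ((j - i)%:~R * (dx / ga)) * `|dx / ga|.
  apply/funext => j; rewrite /G /F nde.
  have -> : ga * ((j - i)%:~R * (dx / ga)) = (j - i)%:~R * dx by field.
  have -> : (j - i)%:~R * (dx / ga) = (j - i)%:~R * dx / ga by rewrite mulrA.
  by move: (g _) (nu _) => a b; ring.
have := @bilateral_riemann_sum_error R F dF F_derive dF_cont jump_integrable dF_int i _ de0.
rewrite /= -GE => /(_ cG) /le_trans; apply.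
rewrite nde (@le_trans _ _ (dx / `|ga| * (`|ga| * K * levy_mass + K * dlevy_mass))) //.
  by rewrite ler_wpM2l // divr_ge0 // ltW.
rewrite -!mulrA ler_pM2l // mulrDr.
have ga1 : 0 < `|ga| by rewrite normr_gt0.
rewrite [X in X + _]mulKf ?gt_eqF // mulrDr lerD2l.
rewrite mulrCA ler_wpM2l // ler_wpM2r ?dlevy_mass_ge0 //.
by rewrite lef_pV2.
Qed.

End levy_density.

(** * One step of the scheme in the x direction *)

Section jump_operator.
Context {R : realType}.
Variable M : model R.
Hypothesis std : standing_coefficients M.
Hypothesis reg : levy_regular M.
Local Notation mu := (@lebesgue_measure R).
Local Notation nu := (levy M).

Let lam0 : 0 < intensity M. Proof. by case: std => -[]. Qed.
Let dens : probability_density (jumpdens M). Proof. by case: std => -[]. Qed.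

Definition weight dx y (i j : int) : R := nu_y M y ((j - i)%:~R * dx) * dx.

Lemma nu_y_ge0 y x : 0 <= nu_y M y x.
Proof.
rewrite /nu_y; case: ifPn => // _; rewrite mulr_ge0 ?invr_ge0 //.
exact: levy_ge0.
Qed.

Lemma weight_ge0 dx y i j : 0 < dx -> 0 <= weight dx y i j.
Proof. by move=> dx0; rewrite mulr_ge0 ?nu_y_ge0 // ltW. Qed.

(** [nu_y] branches on whether [gamX] vanishes on the whole domain, so the second alternative
    carries the negation needed to select its branch. *)
Lemma gamX_dichotomy : exists2 e, 0 < e &
  forall y, dom M y -> (forall z, dom M z -> gamX M z = 0) \/
    (~ (forall z, dom M z -> gamX M z = 0) /\ e <= `|gamX M y|).
Proof.
case: std => _ [_ [_ [g0|[e e0 ge]]]]; first by exists 1 => // y _; left.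
exists e => // y Dy; right; split; last exact: ge.
by move=> /(_ y Dy) g0; have := ge y Dy; rewrite g0 normr0 leNgt e0.
Qed.

Definition jump_rate (e : R) : R := levy_mass M + e^-1 * dlevy_mass M.

Section at_point.
Variables (e dx y : R).
Hypothesis e0 : 0 < e.
Hypothesis dx0 : 0 < dx.
Hypothesis dx1 : dx < 1.
Hypothesis Dy : dom M y.
Hypothesis ga : (forall z, dom M z -> gamX M z = 0) \/
    (~ (forall z, dom M z -> gamX M z = 0) /\ e <= `|gamX M y|).
Local Notation L := (jump_rate e).

Lemma jump_rate_ge0 : 0 <= L.
Proof.
rewrite addr_ge0 ?levy_mass_ge0 // mulr_ge0 ?dlevy_mass_ge0 //.
by rewrite invr_ge0 ltW.
Qed.

(** A row is a shifted Riemann sum of [nu] with step [dx / gamX M y], of modulus at most [e^-1]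
    because [dx < 1]; hence a bound uniform in the row, in [dx] and in [y]. *)
Lemma psumZ_weight_le i n : psumZ (weight dx y i) n <= L.
Proof.
case: ga => [g0|[ng0 ega]].
  rewrite /weight /nu_y asboolT // (_ : psumZ _ n = 0) ?jump_rate_ge0 //.
  by apply: big1 => k _; rewrite mul0r.
have ga0 : gamX M y != 0 by rewrite -normr_eq0 gt_eqF // (lt_le_trans e0).
have de0 : dx / gamX M y != 0 by rewrite mulf_neq0 ?invr_eq0 // gt_eqF.
have nde : `|dx / gamX M y| = dx / `|gamX M y| by rewrite normrM normfV gtr0_norm.
have := @bilateral_riemann_sum_le R nu (derive1 nu) (levy_is_derive reg)
  (dlevy_continuous reg) (levy_integrable dens) (dlevy_integrable lam0 dens reg) i _ n
  (levy_ge0 lam0 dens) de0.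
rewrite nde (_ : (fun j => _) = weight dx y i); last first.
  apply/funext => j; rewrite /weight /nu_y asboolF // mulrA.
  have -> : (j - i)%:~R * (dx / gamX M y) = (j - i)%:~R * dx / gamX M y by rewrite mulrA.
  by move: (nu _) => a; ring.
move=> /le_trans; apply; rewrite lerD2l ler_wpM2r ?dlevy_mass_ge0 //.
rewrite -[leRHS]mul1r ler_pM ?invr_ge0 ?(ltW dx0) ?(ltW dx1) //.
by rewrite lef_pV2 // posrE (lt_le_trans e0).
Qed.

Lemma psumZ_weight_bdd i v c n : bdd v c ->
  psumZ (fun j => `|weight dx y i j * v j|) n <= L * c.
Proof.
move=> vc; have c0 : 0 <= c by apply: le_trans (vc 0).
apply: le_trans (ler_wpM2r c0 (psumZ_weight_le i n)).
rewrite mulrC -psumZM; apply: ler_psumZ => j.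
by rewrite normrM (ger0_norm (weight_ge0 _ _ _ dx0)) mulrC ler_wpM2r ?weight_ge0.
Qed.

Lemma weight_summable i v c : bdd v c -> summableZ (fun j => weight dx y i j * v j).
Proof. by move=> vc; exists (L * c) => n; exact: psumZ_weight_bdd. Qed.

Definition jump_sum i (v : int -> R) := sumZ (fun j => weight dx y i j * v j).

Lemma jump_sum_bdd i v c : bdd v c -> `|jump_sum i v| <= L * c.
Proof. by move=> vc; apply: norm_sumZ_le => n; exact: psumZ_weight_bdd. Qed.

(** Discrete jump generator, [B] being the identity plus [h] times it. The mass is that of row 0
    because the diagonal of [matB] sums [nu_y] over unshifted nodes. *)
Definition jump_op (v : int -> R) i := jump_sum i v - jump_sum 0 (fun=> 1) * v i.

Lemma jump_op_bdd v c : bdd v c -> bdd (jump_op v) (2 * L * c).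
Proof.
move=> vc i; rewrite /jump_op (le_trans (ler_normB _ _)) //.
rewrite (_ : 2 * L * c = L * c + L * 1 * c); last by ring.
rewrite lerD ?jump_sum_bdd // normrM ler_pM //.
by apply: jump_sum_bdd => j; rewrite normr1.
Qed.

Lemma matvec_matB h v c i : bdd v c ->
  matvec (matB M h dx y) v i = v i + h * jump_op v i.
Proof.
move=> vc; set s := jump_sum 0 (fun=> 1).
have sE : sumZ (fun l => nu_y M y (l%:~R * dx) * dx) = s.
  by congr sumZ; apply/funext => l; rewrite /weight subr0 mulr1.
(* The term [nu_y 0 * dx] in the diagonal entry is the missing weight [j = i] of the quadrature;
   what remains on the diagonal is [1 - h * s]. *)
pose d j := if j == i then (1 - h * s) * v i else 0.
have -> : matvec (matB M h dx y) v i = sumZ (fun j => h * (weight dx y i j * v j) + d j).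
  congr sumZ; apply/funext => j; rewrite /matB sE /d /weight.
  by case: eqVneq => [->|_]; rewrite ?subrr ?mul0r; ring.
have cd : psumZ d n @[n --> \oo] --> (1 - h * s) * v i by exact: cvg_psumZ_delta.
have cw : psumZ (fun j => weight dx y i j * v j) n @[n --> \oo] --> jump_sum i v.
  exact: summableZ_cvg (weight_summable i vc).
rewrite sumZE (_ : psumZ _ = fun n => h * psumZ (fun j => weight dx y i j * v j) n + psumZ d n); last first.
  by apply/funext => n; rewrite psumZD psumZM.
apply/cvg_lim => //.
rewrite (_ : v i + _ = h * jump_sum i v + (1 - h * s) * v i).
  by apply: cvgD cd; apply: cvgM cw; exact: cvg_cst.
by rewrite /jump_op -/s; ring.
Qed.

Lemma jump_opD v w c c' : bdd v c -> bdd w c' ->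
  jump_op (fun i => v i + w i) = fun i => jump_op v i + jump_op w i.
Proof.
move=> vc wc; apply/funext => i; rewrite /jump_op /jump_sum.
rewrite (_ : (fun j => weight dx y i j * (v j + w j)) =
  fun j => weight dx y i j * v j + weight dx y i j * w j); last first.
  by apply/funext => j; rewrite mulrDr.
by rewrite sumZD; [ring|exact: weight_summable vc|exact: weight_summable wc].
Qed.

Lemma jump_opZ k v c : bdd v c ->
  jump_op (fun i => k * v i) = fun i => k * jump_op v i.
Proof.
move=> vc; apply/funext => i; rewrite /jump_op /jump_sum.
rewrite (_ : (fun j => weight dx y i j * (k * v j)) =
  fun j => k * (weight dx y i j * v j)); last by apply/funext => j; ring.
by rewrite sumZM; [ring|exact: weight_summable vc].
Qed.

Definition jump_generator (g : R -> R) x : R :=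
  \int[mu]_z ((g (x + gamX M y * z) - g x) * nu z).

Lemma jump_sum_error (g dg : R -> R) K i :
  ~ (forall z, dom M z -> gamX M z = 0) -> e <= `|gamX M y| ->
  (forall x, is_derive x (1 : R) g (dg x)) -> continuous dg ->
  (forall x, `|g x| <= K) -> (forall x, `|dg x| <= K) ->
  `|jump_sum i (fun j => g (node M dx j)) -
    \int[mu]_z (g (node M dx i + gamX M y * z) * nu z)| <= dx * K * L.
Proof.
move=> ng0 ega gd dgc gK dgK.
have := @jump_quadrature R M lam0 dens reg g dg K (gamX M y) (node M dx i)
  gd dgc gK dgK i dx e dx0 e0 ega.
rewrite /= (_ : (fun j => _) = fun j => weight dx y i j * g (node M dx j)); last first.
  apply/funext => j; rewrite /weight /nu_y asboolF //.
  have -> : node M dx i + (j - i)%:~R * dx = node M dx j.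
    by rewrite /node intrB; ring.
  by rewrite mulrC.
apply; apply: summableZ_cvg.
by apply: (@weight_summable i _ K) => j.
Qed.

Lemma jump_op_consistent (g dg : R -> R) K i :
  (forall x, is_derive x (1 : R) g (dg x)) -> continuous dg ->
  (forall x, `|g x| <= K) -> (forall x, `|dg x| <= K) ->
  `|jump_op (fun j => g (node M dx j)) i - jump_generator g (node M dx i)|
  <= 2 * (dx * K * L).
Proof.
move=> gd dgc gK dgK; have K0 : 0 <= K by apply: le_trans (gK 0).
have R0 : 0 <= 2 * (dx * K * L) by rewrite !mulr_ge0 ?jump_rate_ge0 // ltW.
case: ga => [g0|[ng0 ega]].
  (* Without jumps the discrete weights vanish, and so does the exact generator, since its
     increments of [g] are zero. *)
  have s0 j v : jump_sum j v = 0.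
    rewrite /jump_sum sumZE (_ : psumZ _ = fun=> 0) ?lim_cst //.
    apply/funext => n; apply: big1 => k _.
    by rewrite /weight /nu_y asboolT // !mul0r.
  rewrite /jump_op !s0 mul0r subr0 sub0r normrN /jump_generator.
  rewrite g0 //; under eq_Rintegral => z _ do rewrite mul0r addr0 subrr mul0r.
  by rewrite Rintegral_cst // mul0r normr0.
have E1 := jump_sum_error i ng0 ega gd dgc gK dgK.
have c1 (x : R) : `|(fun=> 1 : R) x| <= (1 : R) by rewrite normr1.
have c0 (x : R) : `|(fun=> 0 : R) x| <= (1 : R) by rewrite normr0.
have d1 (x : R) : is_derive x (1 : R) (fun=> 1 : R) 0 by exact: is_derive_cst.
have k0 : continuous ((fun=> 0) : R -> R) by move=> x; exact: cvg_cst.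
(* The constant function 1 gives the quadrature error on the total mass, which multiplies [g] in the
   loss term. *)
have E2 := @jump_sum_error (fun=> 1) (fun=> 0) 1 0 ng0 ega d1 k0 c1 c0.
have iF := @jump_integrable R M dens reg g dg K (gamX M y) (node M dx i) gd gK.
have inu : mu.-integrable setT (EFin \o (fun z => g (node M dx i) * nu z)).
  by have := integrableZl measurableT (g (node M dx i)) (levy_integrable dens); apply: eq_integrable.
have -> : jump_generator g (node M dx i) =
    \int[mu]_z (g (node M dx i + gamX M y * z) * nu z) - levy_mass M * g (node M dx i).
  rewrite /jump_generator; under eq_Rintegral do rewrite mulrBl.
  rewrite RintegralB //; congr (_ - _); rewrite mulrC; apply: RintegralZl => //.
  exact: levy_integrable.
have e2 : \int[mu]_z ((fun=> 1) (node M dx 0 + gamX M y * z) * nu z) = levy_mass M.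
  by apply: eq_Rintegral => z _ /=; rewrite mul1r.
rewrite e2 mulr1 in E2.
rewrite /jump_op; set s1 := jump_sum i _; set s0 := jump_sum 0 _; set I := \int[mu]_z _.
rewrite (_ : _ - _ = (s1 - I) - (s0 - levy_mass M) * g (node M dx i)); last by ring.
rewrite (le_trans (ler_normB _ _)) //.
rewrite (_ : 2 * _ = dx * K * L + dx * L * K); last by ring.
by rewrite lerD // normrM ler_pM.
Qed.

(** * Stability and consistency of the one-step operator *)

Section step_operator.
Variable h : R.
Hypothesis h0 : 0 < h.
Local Notation A := (matA M h dx y).
Local Notation B := (matB M h dx y).
Local Notation Pi := (Pi_op M h dx y).

Let AE v i : matvec A v i = (1 + ((updown M h dx y).1 + (updown M h dx y).2)) * v i
  - (updown M h dx y).1 * v (i - 1) - (updown M h dx y).2 * v (i + 1).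
Proof. exact: matvec_matA. Qed.

Let up0 : 0 <= (updown M h dx y).1.
Proof. by case: (updown_ge0 M y h0 dx0). Qed.

Let down0 : 0 <= (updown M h dx y).2.
Proof. by case: (updown_ge0 M y h0 dx0). Qed.

Lemma matvec_matB_bdd v c : bdd v c -> bdd (matvec B v) ((1 + 2 * h * L) * c).
Proof.
move=> vc i; rewrite (matvec_matB h i vc) (le_trans (ler_normD _ _)) //.
rewrite mulrDl mul1r lerD // normrM gtr0_norm //.
have -> : 2 * h * L * c = h * (2 * L * c) by ring.
by rewrite ler_pM2l // jump_op_bdd.
Qed.

Lemma Pi_op_bdd v c : bdd v c -> bdd (Pi v) ((1 + 2 * h * L) * c).
Proof.
move=> vc; rewrite /Pi_op.
by have [_ _] := linf_inverseP up0 down0 AE (matvec_matB_bdd vc).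
Qed.

Lemma Pi_opD v w c c' : bdd v c -> bdd w c' ->
  Pi (fun i => v i + w i) = fun i => Pi v i + Pi w i.
Proof.
move=> vc wc; rewrite /Pi_op.
have -> : matvec B (fun i => v i + w i) = fun i => matvec B v i + matvec B w i.
  apply/funext => i; rewrite (matvec_matB h i vc) (matvec_matB h i wc).
  have vwc : bdd (fun i => v i + w i) (c + c').
    by move=> j; rewrite (le_trans (ler_normD _ _)) // lerD.
  by rewrite (matvec_matB h i vwc) (jump_opD vc wc); ring.
exact: (linf_inverseD up0 down0 AE (matvec_matB_bdd vc) (matvec_matB_bdd wc)).
Qed.

Lemma Pi_opZ k v c : bdd v c -> Pi (fun i => k * v i) = fun i => k * Pi v i.
Proof.
move=> vc; rewrite /Pi_op.
have -> : matvec B (fun i => k * v i) = fun i => k * matvec B v i.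
  apply/funext => i; rewrite (matvec_matB h i vc).
  have kvc : bdd (fun i => k * v i) (`|k| * c).
    by move=> j; rewrite normrM ler_wpM2l.
  by rewrite (matvec_matB h i kvc) (jump_opZ k vc); ring.
exact: (linf_inverseZ up0 down0 AE k (matvec_matB_bdd vc)).
Qed.

(** The difference [Pi v - w] solves the upwind equation with right-hand side [B v - A w].
    Consistency can thus be checked by applying [A] to a smooth function, without expanding its
    inverse. *)
Lemma Pi_op_residual v w c c' r : bdd v c -> bdd w c' ->
  bdd (fun i => matvec B v i - matvec A w i) r -> bdd (fun i => Pi v i - w i) r.
Proof.
move=> vc wc; have [lv ev bv] := linf_inverseP up0 down0 AE (matvec_matB_bdd vc).
apply: (upwind_max_principle up0 down0 AE).
  apply: (@linf_bdd _ _ ((1 + 2 * h * L) * c + c')) => i.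
  by rewrite (le_trans (ler_normB _ _)) // lerD //; exact: bv.
apply/funext => i; have := congr1 (@^~ i) ev; rewrite !AE -/(Pi_op M h dx y v) => <-.
by ring.
Qed.

(** The one-sided difference has error of order [dx], so order [dx] is all that is asked of the
    second difference: its two cubic Taylor remainders, divided by [dx^2], give it from a bound on
    [g3]. *)
Lemma matA_consistent (g g1 g2 g3 : R -> R) K i :
  (forall x, is_derive x (1 : R) g (g1 x)) ->
  (forall x, is_derive x (1 : R) g1 (g2 x)) ->
  (forall x, is_derive x (1 : R) g2 (g3 x)) ->
  (forall x, `|g2 x| <= K) -> (forall x, `|g3 x| <= K) ->
  `|g (node M dx i) - matvec A (fun j => g (node M dx j)) i - h *
    (muX M y * g1 (node M dx i) + 2^-1 * sigX M y ^+ 2 * g2 (node M dx i))|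
  <= h * dx * (K * (`|muX M y| + sigX M y ^+ 2)).
Proof.
move=> d0 d1 d2 gK2 gK3; set x := node M dx i.
have D1 f f' : (forall x, is_derive x (1 : R) f (f' x)) ->
    forall x, [set: R] x -> is_derive_within [set: R] f x (f' x).
  by move=> H z _; apply: is_derive_within_of.
have iT : is_interval [set: R] by [].
have T1 z : `|g z - g x - g1 x * (z - x)| <= K * `|z - x| ^+ 2.
  by apply: (taylor1 iT (D1 _ _ d0) (D1 _ _ d1)).
have T2 z : `|g z - g x - g1 x * (z - x) - 2^-1 * g2 x * (z - x) ^+ 2| <= K * `|z - x| ^+ 3.
  by apply: (taylor2 iT (D1 _ _ d0) (D1 _ _ d1) (D1 _ _ d2)).
have nS : node M dx (i + 1) = x + dx by rewrite /x /node intrD; ring.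
have nP : node M dx (i - 1) = x - dx by rewrite /x /node intrB; ring.
have sS : x + dx - x = dx by ring.
have sP : x - dx - x = - dx by ring.
have := T1 (x + dx); have := T1 (x - dx); have := T2 (x + dx); have := T2 (x - dx).
rewrite sS sP !normrN !(gtr0_norm dx0) AE nS nP -/x.
set a := g (x + dx); set b := g (x - dx); set c := g x.
set p := g1 x; set q := g2 x => Tm2 Tp2 Tm1 Tp1.
set mX := muX M y; set s := sigX M y.
have dxn : dx != 0 by rewrite gt_eqF.
have K0 : 0 <= K by apply: le_trans (gK2 0).
have diffusion : `|h / (2 * dx ^+ 2) * s ^+ 2 * (a + b - 2 * c) - h * (2^-1 * s ^+ 2 * q)|
    <= h * dx * (K * s ^+ 2).
  rewrite (_ : _ - _ = h / (2 * dx ^+ 2) * s ^+ 2 *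
     ((b - c - p * - dx - 2^-1 * q * (- dx) ^+ 2)
      + (a - c - p * dx - 2^-1 * q * dx ^+ 2))); last by field.
  have s0 : 0 <= h / (2 * dx ^+ 2) * s ^+ 2.
    by rewrite mulr_ge0 ?sqr_ge0 // divr_ge0 ?(ltW h0) // mulr_ge0 ?sqr_ge0.
  rewrite normrM (ger0_norm s0).
  have -> : h * dx * (K * s ^+ 2) =
    h / (2 * dx ^+ 2) * s ^+ 2 * (K * dx ^+ 3 + K * dx ^+ 3) by field.
  by rewrite ler_wpM2l // (le_trans (ler_normD _ _)) // lerD.
have drift : `| `|h / dx * mX| * (h / dx * mX > 0)%R%:R * (a - c)
    + `|h / dx * mX| * (h / dx * mX < 0)%R%:R * (b - c) - h * (mX * p)|
    <= h * dx * (K * `|mX|).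
  have hdx : 0 < h / dx by rewrite divr_gt0.
  have -> : h * dx * (K * `|mX|) = h / dx * `|mX| * (K * dx ^+ 2) by field.
  rewrite pmulr_rgt0 // pmulr_rlt0 // normrM (gtr0_norm hdx).
  case: (ltgtP mX 0) => m0; rewrite ?mulr1 ?mulr0 ?mul0r ?addr0 ?add0r.
  - rewrite (ltr0_norm m0).
    rewrite (_ : _ - _ = h / dx * - mX * (b - c - p * - dx)); last by field.
    by rewrite normrM ger0_norm ?ler_wpM2l // mulr_ge0 ?(ltW hdx) // oppr_ge0 ltW.
  - rewrite (gtr0_norm m0).
    rewrite (_ : _ - _ = h / dx * mX * (a - c - p * dx)); last by field.
    by rewrite normrM ger0_norm ?ler_wpM2l // mulr_ge0 ?(ltW hdx) // ltW.
  - by rewrite m0 mul0r mulr0 oppr0 !normr0 !(mulr0, mul0r).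
rewrite /updown /= -/mX -/s.
move: drift diffusion.
set be := h / (2 * dx ^+ 2) * s ^+ 2.
set u1 := `|h / dx * mX| * _; set u2 := `|h / dx * mX| * _ => drift diffusion.
rewrite (_ : c - _ - _ = (u1 * (a - c) + u2 * (b - c) - h * (mX * p)) +
  (be * (a + b - 2 * c) - h * (2^-1 * s ^+ 2 * q))); last by ring.
by rewrite (le_trans (ler_normD _ _)) // (le_trans (lerD drift diffusion)) // -mulrDr -mulrDr.
Qed.

End step_operator.
End at_point.
End jump_operator.

(** * Local expansion of the value function *)

Section polynomial_weight.
Context {R : realType}.

(** A substitute for [1 + |y| ^ a] that is at least 1, monotone in the exponent, multiplicative and
    polynomial, so that all growth bounds can be merged by raising [m]. *)
Definition wt (m : nat) (y : R) : R := (1 + y ^+ 2) ^+ m.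

Lemma wt_ge1 m y : 1 <= wt m y.
Proof. by rewrite exprn_ege1 // lerDl sqr_ge0. Qed.

Lemma wt_ge0 m y : 0 <= wt m y.
Proof. exact: le_trans ler01 (wt_ge1 m y). Qed.

Lemma wtD m k y : wt (m + k) y = wt m y * wt k y.
Proof. exact: exprD. Qed.

Lemma le_wt m k y : (m <= k)%N -> wt m y <= wt k y.
Proof. by move=> mk; rewrite ler_weXn2l // lerDl sqr_ge0. Qed.

Lemma powR_le_wt (a : R) : 0 < a -> exists m, forall y : R, 1 + `|y| `^ a <= 2 * wt m y.
Proof.
move=> a0; exists (Num.truncn a).+1 => y.
suff H : `|y| `^ a <= wt (Num.truncn a).+1 y.
  by have := wt_ge1 (Num.truncn a).+1 y; lra.
have [y1|y1] := leP `|y| 1.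
  apply: le_trans (wt_ge1 _ _); apply: (@le_trans _ _ (1 `^ a)); last by rewrite powR1.
  by apply: ge0_ler_powR; rewrite ?nnegrE // ltW.
rewrite (@le_trans _ _ (`|y| `^ (Num.truncn a).+1%:R)) //.
  by apply: ler_powR; [exact: ltW|exact/ltW/truncnS_gt].
rewrite powR_mulrn // /wt lerXn2r ?nnegrE //; first by rewrite addr_ge0 ?sqr_ge0.
rewrite -real_normK ?num_real // (@le_trans _ _ (`|y| ^+ 2)) ?lerDr //.
by rewrite expr2 ler_peMr // ltW.
Qed.

(** The square attains its maximum over a segment at an endpoint. *)
Lemma between_wt m a b c : between a b c -> wt m c <= wt m a + wt m b.
Proof.
move=> abc; have c2 : c ^+ 2 <= Num.max (a ^+ 2) (b ^+ 2).
  rewrite le_max; move: abc; rewrite /between; case: (leP a b) => ab /andP[h1 h2].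
    have [c0|c0] := leP 0 c; apply/orP; [right|left]; nra.
  have [c0|c0] := leP 0 c; apply/orP; [left|right]; nra.
move: c2; rewrite le_max => /orP[] c2; [rewrite -[leLHS]addr0|rewrite -[leLHS]add0r];
  by rewrite lerD ?wt_ge0 // lerXn2r ?nnegrE ?addr_ge0 ?sqr_ge0 // lerD2l.
Qed.

Lemma poly_growth_wt (D : set R) (g : R -> R) : poly_growth D g ->
  exists (C : R) (m : nat), 0 < C /\ forall y, D y -> `|g y| <= C * wt m y.
Proof.
move=> [C [a [C0 a0 gC]]]; have [m mP] := powR_le_wt a0.
exists (C * 2), m; split; first by rewrite mulr_gt0.
by move=> y Dy; rewrite -mulrA (le_trans (gC y Dy)) // ler_pM2l.
Qed.

End polynomial_weight.

Section sup_norm.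
Context {R : realType}.

(** If a continuous function exceeded [K] somewhere in modulus, it would do so on a ball, which has
    positive measure. *)
Lemma Lnorm_oo_continuous (g : R -> R) (K : R) : continuous g ->
  (Lnorm (@lebesgue_measure R) +oo%E (fun x => (g x)%:E) <= K%:E)%E ->
  forall x, `|g x| <= K.
Proof.
(* The norm of index [+oo] is an essential supremum only on a space of positive measure; the unit
   interval witnesses this. *)
move=> gc; rewrite unlock ifT; last first.
  rewrite (@lt_le_trans _ _ (lebesgue_measure `[0, (1 : R)])) //.
    by rewrite lebesgue_measure_itv /= lte01 oppr0 adde0 lte01.
  by apply: le_measure; rewrite ?inE.
move=> /ess_supP[N [mN N0 subN]] x; rewrite leNgt; apply/negP => Kx.
have gxc : `|g z| @[z --> x] --> `|g x| by apply: cvg_norm; exact: gc.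
have /nbhs_ballP[e /= e0 xe] : \forall z \near x, K < `|g z|.
  by apply: cvgr_gt gxc _ Kx.
have : lebesgue_measure (ball x e) = 0%E.
  apply: (subset_measure0 _ mN _ N0); first exact: measurable_ball.
  move=> z /xe Kz; apply: subN => /=; rewrite lee_fin leNgt.
  by rewrite Kz.
rewrite lebesgue_measure_ball ?ltW // => /eqP; rewrite eqe => /eqP.
lra.
Qed.

End sup_norm.

Section derive_within_values.
Context {R : realType}.

(** [lim] recovers a derivative only along a proper filter, that is, at an accumulation point of
    [D]. Moving from [x] a small fraction of the way to [x'] stays in the interval and provides such
    points. *)
Lemma dnbhs_within_proper (D : set R) x x' : is_interval D -> D x -> D x' ->
  x' != x -> ProperFilter (within D x^').
Proof.
move=> Di Dx Dx' xx'; apply: Build_ProperFilter; move=> /nbhs_ballP[e /= e0 He].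
have n0 : 0 < `|x' - x| by rewrite normr_gt0 subr_eq0.
pose s := Num.min 1 (e / (2 * `|x' - x|)).
have s0 : 0 < s by rewrite lt_min ltr01 divr_gt0 // mulr_gt0.
have s1 : s <= 1 by rewrite ge_min lexx.
have se : s * `|x' - x| < e.
  rewrite (@le_lt_trans _ _ (e / 2)) //; last by lra.
  rewrite -ler_pdivlMr // (_ : e / 2 / _ = e / (2 * `|x' - x|)); last by field; rewrite gt_eqF.
  by rewrite ge_min lexx orbT.
pose z := x + s * (x' - x).
have zx : z != x.
  apply/eqP => zx; have /eqP : s * (x' - x) = 0 by move: zx; rewrite /z; lra.
  by rewrite mulf_eq0 gt_eqF //= subr_eq0 (negbTE xx').
apply: (He z) => //.
  by rewrite /= /ball /= /z opprD addNKr normrN normrM gtr0_norm.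
have : between x x' z.
  rewrite /between /z; case: (leP x x') => h; apply/andP; split; nra.
exact: between_itv.
Qed.

Lemma derive_within_val (D : set R) (f g : R -> R) x l :
  ProperFilter (within D x^') -> D x -> (forall z, D z -> f z = g z) ->
  is_derive_within D g x l -> derive_within D f x = l.
Proof.
move=> PF Dx fg gl; apply/cvg_lim => //.
apply: cvg_trans gl; apply: near_eq_cvg.
have : within D x^' D by exact: withinT.
by apply: filterS => z Dz; rewrite /diff_quot !fg.
Qed.

End derive_within_values.

Section value_function.
Context {R : realType}.
Variables (M : model R) (u : R -> R -> R -> R).
Hypothesis std : standing_coefficients M.
Hypothesis pide : solves_pide M u.
Local Notation T := (horizon M).
Local Notation D := (dom M).

Lemma dom_interval : is_interval D.
Proof.
case: std => -[_ [U [_ _ Ui [->|->]]] _ _ _] _ //.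
by apply/connected_intervalP/connected_closure/connected_intervalP.
Qed.

Lemma dom_two_points y : exists2 y', D y' & y' != y.
Proof.
case: std => -[_ [U [Uo [p Up] _ DU]] _ _ _] _.
have UD : U `<=` D by case: DU => ->; [|exact: subset_closure].
have [/eqP py|py] := boolP (p == y); last by exists p => //; exact: UD.
have : nbhs p U by exact: open_nbhs_nbhs.
move=> /nbhs_ballP[e /= e0 He]; exists (p + e / 2).
  by apply/UD/He; rewrite /ball /= opprD addNKr normrN gtr0_norm; lra.
by apply/eqP; rewrite -py; lra.
Qed.

Lemma horizon_gt0 : 0 < T. Proof. by case: std => -[]. Qed.

Variable w : nat -> nat -> nat -> R -> R -> R -> R.
Hypothesis pd : partial_derivatives T D 4 u w.
Variables (C1 : R) (m : nat).
Hypothesis wb : forall k l' l t x y, (2 * k + l' + l <= 4)%N -> 0 <= t < T -> D y ->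
  `|w k l' l t x y| <= C1 * wt m y.

Lemma w_continuous_x k l' l t y : (2 * k + l' + l <= 4)%N -> 0 <= t < T -> D y ->
  continuous (fun x => w k l' l t x y).
Proof.
move=> q tT Dy; have /subspace_continuousP wc := (pd.2 k l' l).1 q.
move=> x; have := wc (t, x, y) (conj tT Dy) => H.
apply: (@cvg_comp _ _ _ (fun x => (t, x, y)) _ _ _ _ _ H).
move=> P; rewrite /= !nbhs_simpl /= => -[[A B] [[[A1 A2] [/= nA1 nA2] sA] nB] sAB].
have H' : nbhs x (fun z => P (t, z, y)).
  apply: filterS nA2 => z Az; apply: (sAB (t, z, y)) => /=; last by split.
  split; last exact: nbhs_singleton nB.
  by apply: sA; split => //=; exact: nbhs_singleton nA1.
exact: H'.
Qed.

Lemma w_is_derive_x k l' l t x y : (2 * k + l'.+1 + l <= 4)%N -> 0 <= t < T -> D y ->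
  is_derive x (1 : R) (fun z => w k l' l t z y) (w k l'.+1 l t x y).
Proof. by move=> q tT Dy; have [_ + _] := (pd.2 k l' l).2 t x y tT Dy; apply. Qed.

Lemma w_is_derive_y k l' l t x y : (2 * k + l' + l.+1 <= 4)%N -> 0 <= t < T -> D y ->
  is_derive_within D (fun z => w k l' l t x z) y (w k l' l.+1 t x y).
Proof. by move=> q tT Dy; have [_ _ +] := (pd.2 k l' l).2 t x y tT Dy; apply. Qed.

Lemma w_is_derive_t k l' l t x y : (2 * k.+1 + l' + l <= 4)%N -> 0 <= t < T -> D y ->
  is_derive_within `[0, T[ (fun s => w k l' l s x y) t (w k.+1 l' l t x y).
Proof. by move=> q tT Dy; have [+ _ _] := (pd.2 k l' l).2 t x y tT Dy; apply. Qed.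

Lemma uE t x y : 0 <= t < T -> D y -> u t x y = w 0 0 0 t x y.
Proof. by move=> tT Dy; rewrite pd.1. Qed.

(** The equation is stated through limits of difference quotients of [u]; uniqueness of these limits
    identifies them with the members of the family [w], which is the one that carries the bounds. *)
Lemma pideE t x y : 0 <= t < T -> D y ->
  w 1 0 0 t x y + 2^-1 * sigX M y ^+ 2 * w 0 2 0 t x y
  + 2^-1 * sigY M y ^+ 2 * w 0 0 2 t x y + muX M y * w 0 1 0 t x y
  + muY M y * w 0 0 1 t x y + jump_generator M y (fun x => w 0 0 0 t x y) x = 0.
Proof.
move=> tT Dy; have [/(_ t x y tT Dy)] := pide.
have [y' Dy' yy'] := dom_two_points y.
have PFy z : D z -> ProperFilter (within D z^').
  move=> Dz; have [z' Dz' zz'] := dom_two_points z.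
  exact: (dnbhs_within_proper dom_interval Dz Dz' zz').
have PFt : ProperFilter (within `[0, T[ t^').
  have [t' Dt' tt'] : exists2 t', `[0, T[%classic t' & t' != t.
    exists ((t + T) / 2); first by rewrite /= in_itv /=; lra.
    by apply/eqP; lra.
  apply: (dnbhs_within_proper _ _ Dt' tt'); last by rewrite /= in_itv.
  exact: interval_is_interval.
rewrite (@derive_within_val _ _ _ (fun s => w 0 0 0 s x y) _ (w 1 0 0 t x y)) //; last 2 first.
- by move=> s; rewrite /= in_itv /= => sT; rewrite uE.
- exact: w_is_derive_t.
have uyE : u t ^~ y = fun x => w 0 0 0 t x y by apply/funext => z; rewrite uE.
have d1 : derive1 (u t ^~ y) = fun x => w 0 1 0 t x y.
  apply/funext => z; rewrite uyE derive1E.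
  by have [_ ->] := @w_is_derive_x 0 0 0 t z y isT tT Dy.
have d2 : derive1n 2 (u t ^~ y) x = w 0 2 0 t x y.
  rewrite /derive1n /= d1 derive1E.
  by have [_ ->] := @w_is_derive_x 0 1 0 t x y isT tT Dy.
have e1 z : D z -> derive_within D (u t x) z = w 0 0 1 t x z.
  move=> Dz; apply: (@derive_within_val _ _ _ (fun z => w 0 0 0 t x z)) => //.
  - exact: PFy.
  - by move=> s Ds; rewrite uE.
  - exact: w_is_derive_y.
have e2 : derive_within D (derive_within D (u t x)) y = w 0 0 2 t x y.
  apply: (@derive_within_val _ _ _ (fun z => w 0 0 1 t x z)) => //.
  - exact: PFy.
  - exact: w_is_derive_y.
rewrite /generator d2 d1 e2 e1 // => + _; rewrite /jump_generator -!addrA.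
by under eq_Rintegral do rewrite !uE //.
Qed.

(** Since [u] is differentiated only on [[0, T[], estimates at the horizon come from earlier times
    by the left limit in the terminal condition. *)
Lemma u_limit (P e : R -> R) (x z t : R) : 0 <= t < T -> D z ->
  continuous P -> continuous e ->
  (forall s, t < s -> s < T -> `|u s x z - P s| <= e s) ->
  `|u T x z - P T| <= e T.
Proof.
move=> /andP[t0 tT] Dz Pc ec H; have [_ /(_ x z Dz)[-> uT]] := pide.
have c1 : `|u s x z - P s| @[s --> T^'-] --> `|payoff M x z - P T|.
  apply: cvg_norm; apply: cvgB => //.
  by apply: cvg_at_left_filter; exact: Pc.
have c2 : e s @[s --> T^'-] --> e T by apply: cvg_at_left_filter; exact: ec.
rewrite -(cvg_lim _ c1) // -(cvg_lim _ c2) //.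
apply: ler_lim; [by apply/cvg_ex; eexists; exact: c1|by apply/cvg_ex; eexists; exact: c2|].
have h1 : \forall s \near T^'-, t < s by exact: nbhs_left_gt.
have h2 : \forall s \near T^'-, s < T by exact: nbhs_left_lt.
by move: h1 h2; apply: filterS2 => s; exact: H.
Qed.

Lemma u_bound s x z : 0 <= s <= T -> D z -> `|u s x z| <= C1 * wt m z.
Proof.
move=> /andP[s0]; rewrite le_eqVlt => /predU1P[->|sT] Dz; last first.
  by rewrite uE ?s0 // wb // s0.
have := @u_limit (fun=> 0) (fun=> C1 * wt m z) x z 0.
rewrite subr0; apply => //; first by rewrite lexx horizon_gt0.
- by move=> ?; exact: cvg_cst.
- by move=> ?; exact: cvg_cst.
- by move=> r r0 rT; rewrite subr0 uE ?wb // ltW.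
Qed.

(** Coefficient of [(z - y)^k]. The mixed term [h * w 1 0 1] and the cubic term are kept because
    only their conditional means are of order [h^2], their absolute moments being controlled only at
    order [h^(3/2)]. A time correction to the quadratic term would be of size [h (z - y)^2], which
    the remainder allows. *)
Definition taylor_coef t y (h : R) (k : nat) (x : R) : R :=
  match k with
  | 0 => w 0 0 0 t x y + h * w 1 0 0 t x y
  | 1 => w 0 0 1 t x y + h * w 1 0 1 t x y
  | 2 => 2^-1 * w 0 0 2 t x y
  | 3 => 6^-1 * w 0 0 3 t x y
  | _ => 0
  end.

(** First [u] is expanded in time at [z], then its time derivative and [u] itself in [z] around [y].
    The remainders involve the partials [w 2 0 0], [w 1 0 2] and [w 0 0 4], all of parabolic order
    exactly 4. *)
Lemma u_taylor t h x y z : 0 <= t -> 0 < h -> t + h <= T -> D y -> D z ->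
  `|u (t + h) x z - \sum_(k < 4) taylor_coef t y h k x * (z - y) ^+ k|
  <= C1 * (wt m y + wt m z) * (h ^+ 2 + h * (z - y) ^+ 2 + (z - y) ^+ 4).
Proof.
move=> t0 h0 thT Dy Dz; set K := C1 * _; set De := z - y.
have tT : 0 <= t < T by rewrite t0 (lt_le_trans _ thT) // ltrDl.
have wK k l' l s x' c : (2 * k + l' + l <= 4)%N -> 0 <= s < T -> D c ->
    between y z c -> `|w k l' l s x' c| <= K.
  move=> q sT Dc yzc; rewrite (le_trans (wb _ q sT Dc)) // ler_wpM2l ?between_wt //.
  have := wb 0 (isT : (2 * 0 + 0 + 0 <= 4)%N) tT Dy.
  move=> /(le_trans (normr_ge0 _)).
  by rewrite pmulr_lge0 // (lt_le_trans ltr01 (wt_ge1 _ _)).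
have key r : 0 < r -> t + r < T ->
  `|u (t + r) x z - \sum_(k < 4) taylor_coef t y r k x * De ^+ k|
  <= K * (r ^+ 2 + r * De ^+ 2 + De ^+ 4).
  move=> r0 trT; have trT' : 0 <= t + r < T by rewrite trT addr_ge0 // ltW.
  have I1 : is_interval (`[0, T[%classic : set R) by exact: interval_is_interval.
  have E1 : `|w 0 0 0 (t + r) x z - w 0 0 0 t x z - w 1 0 0 t x z * (t + r - t)|
      <= K * `|t + r - t| ^+ 2.
    apply: (taylor1 I1 (f := fun s => w 0 0 0 s x z) (f1 := fun s => w 1 0 0 s x z)
      (f2 := fun s => w 2 0 0 s x z)).
    - by move=> s; rewrite /= in_itv /= => sT; exact: w_is_derive_t.
    - by move=> s; rewrite /= in_itv /= => sT; exact: w_is_derive_t.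
    - by rewrite /= in_itv.
    - by rewrite /= in_itv.
    - move=> c; rewrite /between => tc; apply: wK => //; last exact: betweenr.
      have ttr : t <= t + r by rewrite lerDl ltW.
      move: tc; rewrite (min_idPl ttr) (max_idPr ttr) => /andP[c1 c2].
      by rewrite (le_trans t0 c1) (le_lt_trans c2).
  have E2 : `|w 1 0 0 t x z - w 1 0 0 t x y - w 1 0 1 t x y * De| <= K * `|De| ^+ 2.
    apply: (taylor1 dom_interval (f := fun s => w 1 0 0 t x s)
      (f1 := fun s => w 1 0 1 t x s) (f2 := fun s => w 1 0 2 t x s)) => //.
    - by move=> s Ds; exact: w_is_derive_y.
    - by move=> s Ds; exact: w_is_derive_y.
    - by move=> c yc; apply: wK => //; exact: (between_itv dom_interval Dy Dz).
  have E3 : `|w 0 0 0 t x z - w 0 0 0 t x y - w 0 0 1 t x y * De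
      - 2^-1 * w 0 0 2 t x y * De ^+ 2 - 6^-1 * w 0 0 3 t x y * De ^+ 3|
      <= K * `|De| ^+ 4.
    apply: (taylor3 dom_interval (f := fun s => w 0 0 0 t x s)
      (f1 := fun s => w 0 0 1 t x s) (f2 := fun s => w 0 0 2 t x s)
      (f3 := fun s => w 0 0 3 t x s) (f4 := fun s => w 0 0 4 t x s)) => //.
    - by move=> s Ds; exact: w_is_derive_y.
    - by move=> s Ds; exact: w_is_derive_y.
    - by move=> s Ds; exact: w_is_derive_y.
    - by move=> s Ds; exact: w_is_derive_y.
    - by move=> c yc; apply: wK => //; exact: (between_itv dom_interval Dy Dz).
  have ev2 a : `|a| ^+ 2 = a ^+ 2 :> R by rewrite real_normK // num_real.
  have ev4 a : `|a| ^+ 4 = a ^+ 4 :> R.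
    by rewrite -[4%N]/(2 * 2)%N !exprM ev2.
  rewrite uE // !big_ord_recr big_ord0 /= add0r expr0 mulr1 expr1.
  have tr : t + r - t = r by ring.
  rewrite tr ev2 in E1; rewrite ev2 in E2; rewrite ev4 in E3.
  set a1 := _ - _ - _ in E1; set a2 := _ - _ - _ in E2; set a3 := _ - _ in E3.
  rewrite (_ : _ - _ = a1 + r * a2 + a3); last by rewrite /a1 /a2 /a3; ring.
  rewrite (_ : K * _ = K * r ^+ 2 + r * (K * De ^+ 2) + K * De ^+ 4); last by ring.
  rewrite (le_trans (ler_normD _ _)) // lerD //.
  rewrite (le_trans (ler_normD _ _)) // lerD //.
  by rewrite normrM gtr0_norm // ler_pM2l.
(* When [t + h = T], the estimate holds at all times strictly between [t] and [T], and both the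
   polynomial and the bound are continuous in time. *)
move: thT; rewrite le_eqVlt => /predU1P[thT|]; last exact: key.
pose P s := \sum_(k < 4) taylor_coef t y (s - t) k x * De ^+ k.
pose e s := K * ((s - t) ^+ 2 + (s - t) * De ^+ 2 + De ^+ 4).
have sc : continuous (fun s : R => s - t).
  by move=> s; apply: cvgB; [exact: cvg_id|exact: cvg_cst].
have ht : h = T - t by rewrite -thT; ring.
have := @u_limit P e x z t tT Dz.
rewrite /P /e -ht thT; apply.
- rewrite (_ : (fun s => _) = fun s => (w 0 0 0 t x y + (s - t) * w 1 0 0 t x y) * De ^+ 0
    + (w 0 0 1 t x y + (s - t) * w 1 0 1 t x y) * De ^+ 1
    + 2^-1 * w 0 0 2 t x y * De ^+ 2 + 6^-1 * w 0 0 3 t x y * De ^+ 3); last first.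
    by apply/funext => s; rewrite !big_ord_recr big_ord0 /= add0r.
  move=> s; repeat apply: cvgD; try exact: cvg_cst; apply: cvgM; try exact: cvg_cst;
    by apply: cvgD; [exact: cvg_cst|apply: cvgM; [exact: sc|exact: cvg_cst]].
- move=> s; apply: cvgM; first exact: cvg_cst.
  apply: cvgD; last exact: cvg_cst.
  apply: cvgD; first by rewrite expr2; under eq_fun do rewrite expr2; apply: cvgM; exact: sc.
  by apply: cvgM; [exact: sc|exact: cvg_cst].
- move=> s ts sT; have ts' : t + (s - t) = s by ring.
  by have := key (s - t); rewrite ts' subr_gt0; exact.
Qed.

(** * Local error from a fixed state *)

Section local_error.
Hypothesis reg : levy_regular M.
Variables (e t h dx y : R).
Hypothesis e0 : 0 < e.
Hypothesis ge : forall y, D y -> (forall z, D z -> gamX M z = 0) \/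
    (~ (forall z, D z -> gamX M z = 0) /\ e <= `|gamX M y|).
Hypotheses (t0 : 0 <= t) (h0 : 0 < h) (thT : t + h <= T).
Hypotheses (dx0 : 0 < dx) (dx1 : dx < 1) (Dy : D y).
Local Notation L := (jump_rate M e).
Local Notation Pi := (Pi_op M h dx y).
Local Notation K := (C1 * wt m y).

Let gy := ge Dy.

Let tT : 0 <= t < T.
Proof. by rewrite t0 (lt_le_trans _ thT) // ltrDl. Qed.

Let wK k l' l x : (2 * k + l' + l <= 4)%N -> `|w k l' l t x y| <= K.
Proof. by move=> q; exact: wb. Qed.

Let K0 : 0 <= K.
Proof. exact: le_trans (wK 0 (isT : (2 * 0 + 0 + 0 <= 4)%N)). Qed.

Let half_norm (a b : R) : `|a| <= b -> `|2^-1 * a| <= b.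
Proof.
by move=> ab; rewrite normrM gtr0_norm ?invr_gt0 // (le_trans _ ab) // ler_piMl //; lra.
Qed.

Let sixth_norm (a b : R) : `|a| <= b -> `|6^-1 * a| <= b.
Proof.
by move=> ab; rewrite normrM gtr0_norm ?invr_gt0 // (le_trans _ ab) // ler_piMl //; lra.
Qed.

Lemma taylor_coef_bdd k : bdd (fun j => taylor_coef t y h k (node M dx j)) ((1 + h) * K).
Proof.
have hK : 0 <= h * K by rewrite mulr_ge0 // ltW.
move=> j; case: k => [|[|[|[|k]]]] /=; rewrite ?normr0 mulrDl mul1r ?addr_ge0 //.
- by rewrite (le_trans (ler_normD _ _)) // lerD ?wK // normrM gtr0_norm // ler_pM2l // wK.
- by rewrite (le_trans (ler_normD _ _)) // lerD ?wK // normrM gtr0_norm // ler_pM2l // wK.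
- by rewrite -[leLHS]addr0 lerD // half_norm // wK.
- by rewrite -[leLHS]addr0 lerD // sixth_norm // wK.
Qed.

(** It does not depend on [z], so integrating against the kernel will only see powers of [z - y]. *)
Definition taylor_image k (i : int) : R :=
  Pi (fun j => taylor_coef t y h k (node M dx j)) i.

(** Linearity of [Pi] holds only on bounded sequences, so the bound is proved in the same induction.
    The scalars [m_] will be the powers of [z - y] in one use and the moments of the kernel in
    another. *)
Lemma Pi_op_taylor (m_ : nat -> R) n :
  Pi (fun j => \sum_(k < n) taylor_coef t y h k (node M dx j) * m_ k) =
  (fun i => \sum_(k < n) taylor_image k i * m_ k) /\
  bdd (fun j => \sum_(k < n) taylor_coef t y h k (node M dx j) * m_ k)
    (\sum_(k < n) (1 + h) * K * `|m_ k|).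
Proof.
elim: n => [|n [IH IHb]].
  split; last by move=> j; rewrite !big_ord0 normr0.
  under eq_fun do rewrite big_ord0; under [RHS]eq_fun do rewrite big_ord0.
  have b0 : bdd (fun=> 0 : R) (0 : R) by move=> j; rewrite normr0.
  have := Pi_opZ std reg e0 dx0 dx1 gy h0 0 b0.
  rewrite (_ : (fun=> 0 * 0) = fun=> 0); last by apply/funext => ?; rewrite mul0r.
  by move=> ->; apply/funext => ?; rewrite mul0r.
have nb : bdd (fun j => m_ n * taylor_coef t y h n (node M dx j)) ((1 + h) * K * `|m_ n|).
  by move=> j; rewrite normrM mulrC ler_wpM2r // taylor_coef_bdd.
split; last first.
  move=> j; rewrite !big_ord_recr /= (le_trans (ler_normD _ _)) // lerD //.
  by rewrite [X in `|X|]mulrC; exact: nb.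
under eq_fun do rewrite big_ord_recr /= [X in _ + X]mulrC.
rewrite (Pi_opD std reg e0 dx0 dx1 gy h0 IHb nb) IH.
rewrite (Pi_opZ std reg e0 dx0 dx1 gy h0 _ (taylor_coef_bdd n)).
by apply/funext => i; rewrite big_ord_recr /= [X in _ + X]mulrC.
Qed.

Lemma taylor_residual z : D z ->
  bdd (fun i => Pi (fun j => u (t + h) (node M dx j) z) i
                - \sum_(k < 4) taylor_image k i * (z - y) ^+ k)
    ((1 + 2 * h * L) * (C1 * (wt m y + wt m z) *
      (h ^+ 2 + h * (z - y) ^+ 2 + (z - y) ^+ 4))).
Proof.
move=> Dz; set r := _ * (_ + _ + _).
have rb : bdd (fun j => u (t + h) (node M dx j) z
    - \sum_(k < 4) taylor_coef t y h k (node M dx j) * (z - y) ^+ k) r.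
  by move=> j; exact: u_taylor.
have [PE Pb] := Pi_op_taylor (fun k => (z - y) ^+ k) 4.
have := Pi_opD std reg e0 dx0 dx1 gy h0 rb Pb.
rewrite PE (_ : (fun i => _ - _ + _) = fun j => u (t + h) (node M dx j) z); last first.
  by apply/funext => j; rewrite subrK.
move=> -> i; rewrite addrK.
exact: (Pi_op_bdd std reg e0 dx0 dx1 gy h0 rb).
Qed.

(** With the powers of [z - y] averaged to [m1], [m2], [m3], the residual of the upwind equation is
    compared with [h] times the PIDE: the first two moments supply the y-derivatives, [A] the local
    x-derivatives and [B] the jumps. *)
Lemma taylor_consistency (m1 m2 m3 : R) :
  bdd (fun i => taylor_image 0 i + taylor_image 1 i * m1 + taylor_image 2 i * m2
                + taylor_image 3 i * m3 - u t (node M dx i) y)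
    (K * (`|m1 - muY M y * h| + `|m2 - sigY M y ^+ 2 * h| + `|m3| + h * `|m1|
      + 2 * L * h * (h + (1 + h) * `|m1| + `|m2| + `|m3|)
      + h * dx * (`|muX M y| + sigX M y ^+ 2) + 2 * L * h * dx)).
Proof.
pose m_ k : R := match k with 0 => 1 | 1 => m1 | 2 => m2 | _ => m3 end.
have [PE Pb] := Pi_op_taylor m_ 4.
rewrite (_ : (fun i => _) = fun i =>
  Pi (fun j => \sum_(k < 4) taylor_coef t y h k (node M dx j) * m_ k) i
  - u t (node M dx i) y); last first.
  by apply/funext => i; rewrite PE !big_ord_recr big_ord0 /= add0r mulr1.
have ub : bdd (fun i => u t (node M dx i) y) K.
  by move=> i; rewrite uE //; exact: wK.
apply: (Pi_op_residual std reg e0 dx0 dx1 gy h0 Pb ub) => i.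
rewrite (matvec_matB std reg e0 dx0 dx1 gy h i Pb).
have b0 : bdd (fun j => w 0 0 0 t (node M dx j) y) K by move=> j; exact: wK.
(* All of the averaged expansion except [u] itself. It is small with [h] and the moments, so the
   discrete jump operator needs only its norm bound there; consistency is required on [u] alone. *)
pose rest j := h * w 1 0 0 t (node M dx j) y + (w 0 0 1 t (node M dx j) y
  + h * w 1 0 1 t (node M dx j) y) * m1 + 2^-1 * w 0 0 2 t (node M dx j) y * m2
  + 6^-1 * w 0 0 3 t (node M dx j) y * m3.
have restb : bdd rest (K * (h + (1 + h) * `|m1| + `|m2| + `|m3|)).
  move=> j; rewrite /rest !mulrDr.
  rewrite (le_trans (ler_normD _ _)) // lerD //; last first.
    by rewrite normrM ler_wpM2r // sixth_norm // wK.
  rewrite (le_trans (ler_normD _ _)) // lerD //; last first.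
    by rewrite normrM ler_wpM2r // half_norm // wK.
  rewrite (le_trans (ler_normD _ _)) // lerD //.
    by rewrite normrM gtr0_norm // mulrC ler_wpM2r ?wK // ltW.
  rewrite normrM mulrA ler_wpM2r // mulrDr mulr1 (le_trans (ler_normD _ _)) //.
  by rewrite lerD ?wK // normrM gtr0_norm // mulrC ler_wpM2r ?wK // ltW.
have cE : (fun j => \sum_(k < 4) taylor_coef t y h k (node M dx j) * m_ k) =
    fun j => w 0 0 0 t (node M dx j) y + rest j.
  by apply/funext => j; rewrite !big_ord_recr big_ord0 /= /rest; ring.
have cEi := congr1 (@^~ i) cE; rewrite /= in cEi; rewrite cEi.
rewrite cE (jump_opD std reg e0 dx0 dx1 gy b0 restb).
have uvE : (fun j => u t (node M dx j) y) = fun j => w 0 0 0 t (node M dx j) y.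
  by apply/funext => j; rewrite uE.
rewrite uvE.
have EA := @matA_consistent R M dx y dx0 h h0 (fun x => w 0 0 0 t x y)
  (fun x => w 0 1 0 t x y) (fun x => w 0 2 0 t x y) (fun x => w 0 3 0 t x y) K i
  (fun x => w_is_derive_x x (isT : (2 * 0 + 1 + 0 <= 4)%N) tT Dy)
  (fun x => w_is_derive_x x (isT : (2 * 0 + 2 + 0 <= 4)%N) tT Dy)
  (fun x => w_is_derive_x x (isT : (2 * 0 + 3 + 0 <= 4)%N) tT Dy)
  (fun x => wK x (isT : (2 * 0 + 2 + 0 <= 4)%N))
  (fun x => wK x (isT : (2 * 0 + 3 + 0 <= 4)%N)).
have EJ := @jump_op_consistent R M std reg e dx y e0 dx0 dx1 Dy gy
  (fun x => w 0 0 0 t x y) (fun x => w 0 1 0 t x y) K i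
  (fun x => w_is_derive_x x (isT : (2 * 0 + 1 + 0 <= 4)%N) tT Dy)
  (w_continuous_x (isT : (2 * 0 + 1 + 0 <= 4)%N) tT Dy)
  (fun x => wK x (isT : (2 * 0 + 0 + 0 <= 4)%N))
  (fun x => wK x (isT : (2 * 0 + 1 + 0 <= 4)%N)).
have ER := jump_op_bdd std reg e0 dx0 dx1 gy restb i.
have EP := pideE (node M dx i) tT Dy.
have rE : rest i = h * w 1 0 0 t (node M dx i) y + (w 0 0 1 t (node M dx i) y
  + h * w 1 0 1 t (node M dx i) y) * m1 + 2^-1 * w 0 0 2 t (node M dx i) y * m2
  + 6^-1 * w 0 0 3 t (node M dx i) y * m3 by [].
move: EA EJ ER EP; rewrite /= rE.
set x := node M dx i; set j0 := jump_op _ _ _ (fun j => w 0 0 0 t (node M dx j) y) i.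
set j1 := jump_op _ _ _ rest i; set Aw := matvec _ _ i; set gen := jump_generator _ _ _ _.
move=> EA EJ ER EP.
have w1 := wK x (isT : (2 * 0 + 0 + 1 <= 4)%N).
have w2 := half_norm (wK x (isT : (2 * 0 + 0 + 2 <= 4)%N)).
have w3 := sixth_norm (wK x (isT : (2 * 0 + 0 + 3 <= 4)%N)).
have w11 := wK x (isT : (2 * 1 + 0 + 1 <= 4)%N).
set a := w 0 0 0 t x y in EA EJ EP *; set a_t := w 1 0 0 t x y in EP *.
set ax := w 0 1 0 t x y in EA EP *; set axx := w 0 2 0 t x y in EA EP *.
set ay := w 0 0 1 t x y in EP w1 *; set ayy := w 0 0 2 t x y in EP w2 *.
set ay3 := w 0 0 3 t x y in w3 *; set aty := w 1 0 1 t x y in w11 *.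
set A := a - Aw - _ in EA.
(* Adding and subtracting the exact generator isolates [h] times the PIDE in the last group; every
   other group carries a defect. *)
have dec : a + (h * a_t + (ay + h * aty) * m1 + 2^-1 * ayy * m2 + 6^-1 * ay3 * m3)
    + h * (j0 + j1) - Aw =
  A + h * (j0 - gen) + h * j1 + ay * (m1 - muY M y * h)
  + 2^-1 * ayy * (m2 - sigY M y ^+ 2 * h) + 6^-1 * ay3 * m3 + aty * (h * m1)
  + h * (a_t + 2^-1 * sigX M y ^+ 2 * axx + 2^-1 * sigY M y ^+ 2 * ayy
    + muX M y * ax + muY M y * ay + gen) by rewrite /A; ring.
rewrite dec EP mulr0 addr0.
have n1 : `|A| <= h * dx * (K * (`|muX M y| + sigX M y ^+ 2)) by exact: EA.
have n2 : `|h * (j0 - gen)| <= h * (2 * (dx * K * L)).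
  by rewrite normrM gtr0_norm // ler_pM2l.
have n3 : `|h * j1| <= h * (2 * L * (K * (h + (1 + h) * `|m1| + `|m2| + `|m3|))).
  by rewrite normrM gtr0_norm // ler_pM2l.
have n4 : `|ay * (m1 - muY M y * h)| <= K * `|m1 - muY M y * h|.
  by rewrite normrM ler_wpM2r.
have n5 : `|2^-1 * ayy * (m2 - sigY M y ^+ 2 * h)| <= K * `|m2 - sigY M y ^+ 2 * h|.
  by rewrite normrM ler_wpM2r.
have n6 : `|6^-1 * ay3 * m3| <= K * `|m3| by rewrite normrM ler_wpM2r.
have n7 : `|aty * (h * m1)| <= K * (h * `|m1|).
  by rewrite 2!normrM (gtr0_norm h0) ler_wpM2r // mulr_ge0 // ltW.
apply: (le_trans (ler_normD _ _)); apply: (le_trans (lerD (ler_normD _ _) n7)).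
apply: (le_trans (lerD (lerD (ler_normD _ _) n6) (lexx _))).
apply: (le_trans (lerD (lerD (lerD (ler_normD _ _) n5) (lexx _)) (lexx _))).
apply: (le_trans (lerD (lerD (lerD (lerD (ler_normD _ _) n4) (lexx _)) (lexx _)) (lexx _))).
apply: (le_trans (lerD (lerD (lerD (lerD (lerD (ler_normD _ _) n3) (lexx _)) (lexx _)) (lexx _)) (lexx _))).
have n12 := lerD n1 n2.
apply: (le_trans (lerD (lerD (lerD (lerD (lerD n12 (lexx _)) (lexx _)) (lexx _)) (lexx _)) (lexx _))).
by rewrite le_eqVlt; apply/orP; left; apply/eqP; ring.
Qed.

End local_error.
End value_function.

Lemma Cpol_partials {R : realType} (M : model R) (u : R -> R -> R -> R) :
  Cpol (horizon M) (dom M) +oo%E 4 u ->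
  exists (w : nat -> nat -> nat -> R -> R -> R -> R) (C : R) (m : nat),
  [/\ partial_derivatives (horizon M) (dom M) 4 u w, 0 < C &
  forall k l' l t x y, (2 * k + l' + l <= 4)%N -> 0 <= t < horizon M -> dom M y ->
    `|w k l' l t x y| <= C * wt m y].
Proof.
move=> [w [pd [_ [C [a [C0 a0 wb]]]]]]; have [m mP] := powR_le_wt a0.
exists w, (C * 2), m; split => //; first by rewrite mulr_gt0.
move=> k l' l t x y q tT Dy.
have H := wb k l' l t y q tT Dy.
apply: (Lnorm_oo_continuous (w_continuous_x pd q tT Dy) (le_trans H _)).
by rewrite lee_fin -mulrA ler_pM2l.
Qed.

(** * Disintegration along a Markov kernel *)

Section disintegration.
Context d d1 d2 (Om : measurableType d) (U : measurableType d1)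
  (V : measurableType d2) (R : realType).
Variables (P : probability Om R) (Y : Om -> U) (Z : Om -> V) (k : R.-pker U ~> V).
Hypotheses (mY : measurable_fun setT Y) (mZ : measurable_fun setT Z).
Hypothesis rect : forall A B, measurable A -> measurable B ->
  P (Y @^-1` A `&` Z @^-1` B) = (\int[P]_(w in Y @^-1` A) k (Y w) B)%E.

Let p w := (Y w, Z w).

Let mp : measurable_fun setT p.
Proof. exact: measurable_fun_pair. Qed.

Let mpE (E : set (U * V)) : measurable E -> measurable (p @^-1` E).
Proof. by move=> mE; rewrite -[X in measurable X]setTI; exact: mp. Qed.

Let mkE (E : set (U * V)) : measurable E ->
  measurable_fun setT (fun w => k (Y w) (xsection E (Y w))).
Proof.
move=> mE.
have mk := measurable_fun_xsection_finite_kernel k (mem_set mE).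
exact: (measurableT_comp mk mY).
Qed.

Let H := [set E : set (U * V) | measurable E /\
  P (p @^-1` E) = (\int[P]_w k (Y w) (xsection E (Y w)))%E].

(** Dynkin's theorem: rectangles are stable under intersection and satisfy the identity by [rect];
    proper differences and increasing unions preserve it. *)
Let H_measurable : measurable `<=` H.
Proof.
rewrite measurable_prod_measurableType.
set C := [set A `*` B | A in measurable & B in measurable].
have CI : setI_closed C.
  move=> _ _ [X1 mX1 [X2 mX2 <-]] [Y1 mY1 [Y2 mY2 <-]].
  exists (X1 `&` Y1); first exact: measurableI.
  by exists (X2 `&` Y2); [exact: measurableI|rewrite setXI].
have CH : C `<=` H.
  move=> _ [A mA [B mB <-]]; split; first exact: measurableX.
  rewrite (_ : p @^-1` _ = Y @^-1` A `&` Z @^-1` B); last by apply/seteqP; split.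
  rewrite rect // integral_mkcond; apply: eq_integral => w _.
  rewrite patchE; case: ifPn => wA.
    by rewrite in_xsectionX //; move: wA; rewrite !inE.
  by rewrite notin_xsectionX ?measure0 //; apply: contra wA; rewrite !inE.
suff lH : lambda_system setT H by exact: lambda_system_subset.
split => //.
- by apply: CH; exists setT => //; exists setT => //; rewrite setXTT.
- move=> A B BA [mA eA] [mB eB]; have mAB : measurable (A `\` B) by exact: measurableD.
  split => //.
  have e1 : P (p @^-1` A) = (P (p @^-1` (A `\` B)) + P (p @^-1` B))%E.
    rewrite -measureU; [|exact: mpE|exact: mpE|].
      by congr (P _); rewrite -preimage_setU setUC setDUK.
    by rewrite -preimage_setI setIC setDIK preimage_set0.
  have e2 : (\int[P]_w k (Y w) (xsection A (Y w)) =
      \int[P]_w k (Y w) (xsection (A `\` B) (Y w)) +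
      \int[P]_w k (Y w) (xsection B (Y w)))%E.
    rewrite -ge0_integralD //; [|exact: mkE|exact: mkE].
    apply: eq_integral => w _; rewrite -measureU; [|exact: measurable_xsection..|].
      by congr (k _ _); rewrite xsectionD setUC setDUK //; exact: le_xsection.
    by rewrite xsectionD setIC setDIK.
  have fB : P (p @^-1` B) \is a fin_num by exact: fin_num_measure (mpE mB).
  move: e2; rewrite -eA -eB e1 => e2.
  by have := congr1 (fun t => t - P (p @^-1` B))%E e2; rewrite !addeK.
- move=> F ndF HF.
  have mF i : measurable (F i) by case: (HF i).
  have mU : measurable (\bigcup_i F i) by exact: bigcupT_measurable.
  split => //.
  have c1 : P (p @^-1` F n) @[n --> \oo] --> P (p @^-1` \bigcup_i F i).
    rewrite preimage_bigcup; apply: nondecreasing_cvg_mu.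
    - by move=> i; exact: mpE.
    - by apply: bigcupT_measurable => i; exact: mpE.
    - by move=> a b ab; apply/subsetPset => w /=; have /subsetPset := ndF a b ab; apply.
  have c2 : (\int[P]_w k (Y w) (xsection (F n) (Y w)))%E @[n --> \oo] -->
      (\int[P]_w k (Y w) (xsection (\bigcup_i F i) (Y w)))%E.
    rewrite (_ : (\int[P]_w _)%E = (\int[P]_w limn (fun n => k (Y w) (xsection (F n) (Y w))))%E).
      apply: cvg_monotone_convergence => //; first by move=> n; exact: mkE.
      move=> w _ a b ab; apply: le_measure; rewrite ?inE; try exact: measurable_xsection.
      by apply: le_xsection; have /subsetPset := ndF a b ab.
    apply: eq_integral => w _; apply/esym/cvg_lim => //.
    rewrite xsection_bigcup; apply: nondecreasing_cvg_mu.
    - by move=> i; exact: measurable_xsection.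
    - by apply: bigcupT_measurable => i; exact: measurable_xsection.
    - by move=> a b ab; apply/subsetPset/le_xsection; have /subsetPset := ndF a b ab.
  have e n : P (p @^-1` F n) = (\int[P]_w k (Y w) (xsection (F n) (Y w)))%E.
    by case: (HF n).
  have := cvg_lim (@ereal_hausdorff R) c1; rewrite (funext e) => <-.
  exact: cvg_lim c2.
Qed.

Import HBNNSimple.

Let scaled_indic dT (T : measurableType dT) (m : probability T R) (F : set T) (r : R) :
  measurable F -> (\int[m]_x (r * \1_F x)%:E = r%:E * m F)%E.
Proof.
move=> mF; under eq_integral do rewrite EFinM.
rewrite integralZl //; first by rewrite integral_indic // setIT.
apply/integrableP; split; first exact/measurable_EFinP/measurable_indic.
rewrite (eq_integral (fun x => (\1_F x)%:E)); last first.
  by move=> x _; rewrite gee0_abs // lee_fin.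
by rewrite integral_indic // setIT (le_lt_trans (probability_le1 m mF)) // ltry.
Qed.

Let inner_indic (E : set (U * V)) (r : R) w : measurable E ->
  (\int[k (Y w)]_v (r * \1_E (Y w, v))%:E = r%:E * k (Y w) (xsection E (Y w)))%E.
Proof.
move=> mE; have mX := measurable_xsection (Y w) mE.
have k1 : k (Y w) setT = 1%E by exact: prob_kernel.
have -> : (fun v => (r * \1_E (Y w, v))%:E) = fun v => (r%:E * (\1_(xsection E (Y w)) v)%:E)%E.
  by apply/funext => v; rewrite EFinM !indicE mem_xsection.
rewrite integralZl //; first by rewrite integral_indic // setIT.
apply/integrableP; split; first exact/measurable_EFinP/measurable_indic.
rewrite (eq_integral (fun x => (\1_(xsection E (Y w)) x)%:E)); last first.
  by move=> x _; rewrite gee0_abs // lee_fin.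
rewrite integral_indic // setIT (@le_lt_trans _ _ (k (Y w) setT)) ?k1 ?ltry //.
by rewrite -k1; apply: le_measure; rewrite ?inE.
Qed.

Let integral_disintegration_nnsfun (f : {nnsfun (U * V)%type >-> R}) :
  (\int[P]_w (f (p w))%:E = \int[P]_w \int[k (Y w)]_v (f (Y w, v))%:E)%E.
Proof.
have mf r : measurable (f @^-1` [set r]) by exact: measurable_sfunP.
under eq_integral do rewrite fimfunE -fsumEFin//.
rewrite ge0_integral_fsum//; last 2 first.
  - move=> r; apply/measurable_EFinP/measurable_funM => //.
    exact: measurableT_comp mp.
  - by move=> r z _; rewrite EFinM nnfun_muleindic_ge0.
under [in RHS]eq_integral.
  move=> w _.
  under eq_integral.
    by move=> v _; rewrite fimfunE -fsumEFin//; over.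
  rewrite /= ge0_integral_fsum//; last 2 first.
    - move=> r; apply/measurable_EFinP/measurable_funM => //.
      rewrite (_ : (fun v => _) = \1_(xsection (f @^-1` [set r]) (Y w))).
        exact/measurable_indic/measurable_xsection.
      by apply/funext => v; rewrite !indicE mem_xsection.
    - by move=> r v _; rewrite EFinM nnfun_muleindic_ge0.
  under eq_fsbigr do rewrite inner_indic //.
  over.
rewrite /= ge0_integral_fsum//; last 2 first.
- by move=> r; apply: measurable_funeM; exact: mkE.
- move=> r w _; have [r0|r0] := leP 0 r; first by rewrite mule_ge0 // lee_fin.
  by rewrite preimage_nnfun0 // xsection0 measure0 mule0.
apply: eq_fsbigr => r _.
rewrite (_ : (fun w => _) = fun w => (r * \1_(p @^-1` (f @^-1` [set r])) w)%:E); last first.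
  by apply/funext => w; rewrite !indicE.
rewrite scaled_indic; last exact: mpE.
have [_ ->] := H_measurable (mf r).
rewrite integralZl //.
apply/integrableP; split; first exact: mkE.
rewrite (@le_lt_trans _ _ (\int[P]_w 1)%E) //; last first.
  by rewrite integral_cst // mul1e (le_lt_trans (probability_le1 P measurableT)) // ltry.
apply: ge0_le_integral => //.
- by apply: measurableT_comp => //; exact: mkE.
- move=> w _; rewrite gee0_abs //.
  have <- : k (Y w) setT = 1%E by exact: prob_kernel.
  by apply: le_measure; rewrite ?inE //; exact: measurable_xsection.
Qed.

(** Simple functions reduce to measurable sets; monotone convergence is then applied twice on the
    kernel side, in the inner and in the outer integral. *)
Lemma integral_disintegration (f : U * V -> \bar R) : (forall z, 0 <= f z)%E ->
  measurable_fun setT f ->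
  (\int[P]_w f (Y w, Z w) = \int[P]_w \int[k (Y w)]_v f (Y w, v))%E.
Proof.
move=> f0 mf; pose f_ := nnsfun_approx measurableT mf.
have fc z : (f_ n z)%:E @[n --> \oo] --> f z by exact: cvg_nnsfun_approx.
have ndf z a b : (a <= b)%N -> ((f_ a z)%:E <= (f_ b z)%:E)%E.
  by move=> ab; rewrite lee_fin; exact/lefP/nd_nnsfun_approx.
have mfY n w : measurable_fun setT (fun v => (f_ n (Y w, v))%:E).
  by apply/measurable_EFinP; apply: measurableT_comp => //; exact: measurable_pair1.
have mI n : measurable_fun setT (fun w => \int[k (Y w)]_v (f_ n (Y w, v))%:E)%E.
  have mk := @measurable_fun_integral_finite_kernel _ _ U V R (fun z => (f_ n z)%:E) k.
  have {}mk : measurable_fun setT (fun x => \int[k x]_v (f_ n (x, v))%:E)%E.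
    by apply: mk; [move=> z; rewrite lee_fin|exact/measurable_EFinP].
  exact: (measurableT_comp mk mY).
have c1 : (\int[P]_w (f_ n (p w))%:E)%E @[n --> \oo] --> (\int[P]_w f (p w))%E.
  rewrite (_ : (\int[P]_w f (p w))%E = (\int[P]_w limn (fun n => (f_ n (p w))%:E))%E); last first.
    by apply: eq_integral => w _; apply/esym/cvg_lim => //; exact: fc.
  apply: cvg_monotone_convergence => //.
  - by move=> n; apply/measurable_EFinP; apply: measurableT_comp => //.
  - by move=> n w _; rewrite lee_fin.
  - by move=> w _ a b; exact: ndf.
have c2 : (\int[P]_w \int[k (Y w)]_v (f_ n (Y w, v))%:E)%E @[n --> \oo] -->
    (\int[P]_w \int[k (Y w)]_v f (Y w, v))%E.
  rewrite (_ : (\int[P]_w \int[k (Y w)]_v f (Y w, v))%E =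
    (\int[P]_w limn (fun n => \int[k (Y w)]_v (f_ n (Y w, v))%:E))%E); last first.
    apply: eq_integral => w _.
    rewrite -monotone_convergence //.
    - by apply: eq_integral => v _; apply/esym/cvg_lim => //; exact: fc.
    - by move=> n v _; rewrite lee_fin.
    - by move=> v _ a b; exact: ndf.
  apply: cvg_monotone_convergence => //.
  - by move=> n w _; apply: integral_ge0 => v _; rewrite lee_fin.
  - move=> w _ a b ab; apply: ge0_le_integral => //.
    + by move=> v _; rewrite lee_fin.
    + by move=> v _; exact: ndf.
have := cvg_lim (@ereal_hausdorff R) c1.
rewrite (funext (fun n => integral_disintegration_nnsfun (f_ n))) => <-.
exact: cvg_lim c2.
Qed.

Lemma integral_disintegration_set (f : U * V -> \bar R) (E : set U) :
  (forall z, 0 <= f z)%E -> measurable_fun setT f -> measurable E ->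
  (\int[P]_(w in Y @^-1` E) f (Y w, Z w) =
   \int[P]_(w in Y @^-1` E) \int[k (Y w)]_v f (Y w, v))%E.
Proof.
move=> f0 mf mE.
pose g (z : U * V) := if z.1 \in E then f z else 0%E.
have g0 z : (0 <= g z)%E by rewrite /g; case: ifP.
have mg : measurable_fun setT g.
  rewrite (_ : g = f \_ (fst @^-1` E)); last first.
    by apply/funext => z; rewrite patchE /g; congr (if _ then _ else _); apply/idP/idP; rewrite !inE.
  apply/(measurable_restrictT _ _).1 => //; last exact: measurable_funTS.
  by rewrite -[X in measurable X]setTI; exact: measurable_fst.
rewrite integral_mkcond [RHS]integral_mkcond.
transitivity (\int[P]_w g (Y w, Z w))%E.
  by apply: eq_integral => w _; rewrite patchE /g /=; congr (if _ then _ else _); apply/idP/idP; rewrite !inE.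
rewrite integral_disintegration //; apply: eq_integral => w _.
have Ew : (w \in Y @^-1` E) = (Y w \in E) by apply/idP/idP; rewrite !inE.
rewrite patchE /g /= Ew; case: (Y w \in E) => //.
by rewrite integral0.
Qed.

End disintegration.

(** * Conditional expectations as kernel integrals *)

Section condexp_kernel.
Context d (Om : measurableType d) (R : realType).
Local Notation RM := (measurableTypeR R).
Variables (P : probability Om R) (Y Z : Om -> RM) (k : R.-pker RM ~> RM).
Hypotheses (mY : measurable_fun setT Y) (mZ : measurable_fun setT Z).
Hypothesis rect : forall A B : set RM, measurable A -> measurable B ->
  P (Y @^-1` A `&` Z @^-1` B) = (\int[P]_(w in Y @^-1` A) k (Y w) B)%E.

(** Both sides are functions of [Y] with equal integrals over every event of its law, hence equal
    almost everywhere for that law. Positive and negative parts are kept apart because the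
    disintegration is for nonnegative functions and the kernel integral may be undefined on a null
    set. *)
Lemma condexp_kernel (g : RM * RM -> R) (phi : RM -> R) :
  measurable_fun setT g -> measurable_fun setT phi ->
  is_condexp P (fun w => g (Y w, Z w)) Y phi ->
  {ae P, forall w, \int[k (Y w)]_v g (Y w, v) = phi (Y w)}.
Proof.
move=> mg mphi [ig iphi eq].
have mge : measurable_fun setT (EFin \o g) by exact/measurable_EFinP.
pose G1 y := (\int[k y]_v (EFin \o g)^\+ (y, v))%E.
pose G2 y := (\int[k y]_v (EFin \o g)^\- (y, v))%E.
have mG1 : measurable_fun setT G1.
  have mk := @measurable_fun_integral_finite_kernel _ _ RM RM R ((EFin \o g)^\+)%E k.
  by apply: mk; [move=> z; exact: funepos_ge0|exact: measurable_funepos].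
have mG2 : measurable_fun setT G2.
  have mk := @measurable_fun_integral_finite_kernel _ _ RM RM R ((EFin \o g)^\-)%E k.
  by apply: mk; [move=> z; exact: funeneg_ge0|exact: measurable_funeneg].
pose m := pushforward P Y.
have D1 E : measurable E -> (\int[m]_(y in E) G1 y =
    \int[P]_(w in Y @^-1` E) (EFin \o g)^\+ (Y w, Z w))%E.
  move=> mE; rewrite (integral_disintegration_set mY mZ rect) //; last exact: measurable_funepos.
  rewrite ge0_integral_pushforward //; first exact: measurable_funTS.
  by move=> y _; apply: integral_ge0.
have D2 E : measurable E -> (\int[m]_(y in E) G2 y =
    \int[P]_(w in Y @^-1` E) (EFin \o g)^\- (Y w, Z w))%E.
  move=> mE; rewrite (integral_disintegration_set mY mZ rect) //; last exact: measurable_funeneg.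
  rewrite ge0_integral_pushforward //; first exact: measurable_funTS.
  by move=> y _; apply: integral_ge0.
have iG1 : m.-integrable setT G1.
  apply/integrableP; split => //; under eq_integral => y _ do
    rewrite gee0_abs ?integral_ge0 //.
  rewrite D1 // preimage_setT; have /integrableP[_] := integrable_funepos measurableT ig.
  apply: le_lt_trans; rewrite le_eqVlt; apply/orP; left; apply/eqP.
  apply: eq_integral => w _; rewrite gee0_abs; last exact: funepos_ge0.
  by rewrite !funeposE.
have iG2 : m.-integrable setT G2.
  apply/integrableP; split => //; under eq_integral => y _ do
    rewrite gee0_abs ?integral_ge0 //.
  rewrite D2 // preimage_setT; have /integrableP[_] := integrable_funeneg measurableT ig.
  apply: le_lt_trans; rewrite le_eqVlt; apply/orP; left; apply/eqP.
  apply: eq_integral => w _; rewrite gee0_abs; last exact: funeneg_ge0.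
  by rewrite !funenegE.
have iphim : m.-integrable setT (EFin \o phi).
  apply/integrableP; split; first exact/measurable_EFinP.
  rewrite ge0_integral_pushforward //; last first.
    by apply: measurableT_comp => //; exact/measurable_EFinP.
  by rewrite preimage_setT; case/integrableP : iphi.
have /(_ mY)[N [mN N0 subN]] : ae_eq m setT (EFin \o phi) (fun y => G1 y - G2 y)%E.
  move=> mY'; apply: integral_ae_eq => //; first exact: emeasurable_funB.
  move=> E _ mE.
  have mYE : measurable (Y @^-1` E) by rewrite -[X in measurable X]setTI; exact: mY.
  rewrite integralB //; [|exact: integrableS iG1|exact: integrableS iG2].
  rewrite D1 // D2 // integral_pushforward //; last first.
  - exact: integrableS iphi.
  - exact/measurable_EFinP.
  rewrite -[LHS]eq // [LHS]integralE; congr (_ - _)%E; apply: eq_integral => w _.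
    by rewrite !funeposE.
  by rewrite !funenegE.
exists (Y @^-1` N); split => //.
  by rewrite -[X in measurable X]setTI; exact: mY.
move=> w /= ne; apply: subN => /= /(_ I) e; apply: ne.
rewrite /Rintegral integralE -[RHS]/(fine (EFin (phi (Y w)))) [in RHS]e.
congr (fine (_ - _)%E); apply: eq_integral => v _.
  by rewrite !funeposE.
by rewrite !funenegE.
Qed.

End condexp_kernel.

Section moments.
Context d (Om : measurableType d) (R : realType) (P : probability Om R).

Lemma powR_moment (X : Om -> R) (p C : R) : 0 < p -> 0 <= C ->
  (Lnorm P p%:E (fun w => (X w)%:E) <= C%:E)%E ->
  (\int[P]_w (`|X w| `^ p)%:E <= (C `^ p)%:E)%E.
Proof.
move=> p0 C0 XC; have := poweR_Lnorm P (fun w => (X w)%:E) (lt0r_neq0 p0).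
rewrite (_ : (\int[P]_x _)%E = (\int[P]_w (`|X w| `^ p)%:E)%E); last first.
  by apply: eq_integral => w _; rewrite -poweR_EFin.
move=> <-; rewrite -poweR_EFin; apply: gt0_ler_poweR => //; first exact: ltW.
  by rewrite in_itv /= Lnorm_ge0 leey.
by rewrite in_itv /= lee_fin C0 leey.
Qed.

Lemma natural_moment (X : Om -> R) n (C : R) : (0 < n)%N -> 0 <= C ->
  (Lnorm P n%:R%:E (fun w => (X w)%:E) <= C%:E)%E ->
  (\int[P]_w (`|X w| ^+ n)%:E <= (C ^+ n)%:E)%E.
Proof.
move=> n0 C0 XC; have := @powR_moment X n%:R C _ C0 XC.
rewrite ltr0n powR_mulrn // => /(_ n0).
by under eq_integral => w _ do rewrite powR_mulrn //.
Qed.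

End moments.

(** * One step of the scheme *)

Section rough_integral.
Context d (T : measurableType d) (R : realType) (m : {measure set T -> \bar R}).
Local Open Scope ereal_scope.

(* The integral is a supremum over simple functions below the integrand, hence
   monotone even for nonmeasurable integrands. *)
Lemma le_integral_rough (S : set T) (f g : T -> \bar R) :
  (forall x, S x -> f x <= g x) -> \int[m]_(x in S) f x <= \int[m]_(x in S) g x.
Proof.
move=> fg; rewrite /integral.
have fgS x : (f \_ S) x <= (g \_ S) x.
  by rewrite !patchE; case: ifPn => // /set_mem; exact: fg.
apply: leeB.
- apply: le_ereal_sup => _ [h hf <-]; exists h => // x.
  apply: (le_trans (hf x)); rewrite !funeposE.
  by rewrite ge_max !le_max fgS lexx !orbT.
- apply: le_ereal_sup => _ [h hf <-]; exists h => // x.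
  apply: (le_trans (hf x)); rewrite !funenegE.
  by rewrite ge_max !le_max leeN2 fgS lexx !orbT.
Qed.

(** No measurability of [f] enters: rough monotonicity traps its integral between those of [g - e]
    and [g + e], which are finite, so [fine] loses nothing. *)
Lemma Rintegral_close (S : set T) (f g : T -> R) (e : T -> \bar R) :
  measurable S -> m.-integrable S (EFin \o g) -> measurable_fun S e ->
  (forall x, S x -> 0 <= e x) -> \int[m]_(x in S) e x < +oo ->
  (forall x, S x -> (`|f x - g x|)%:E <= e x) ->
  (`|(\int[m]_(x in S) f x)%R - (\int[m]_(x in S) g x)%R|)%:E <= \int[m]_(x in S) e x.
Proof.
move=> mS ig me e0 eoo fge.
have ie : m.-integrable S e.
  apply/integrableP; split => //.
  by rewrite (eq_integral e) // => x /set_mem Sx; rewrite gee0_abs // e0.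
have iefin := integrable_fin_num mS ie.
have igfin := integrable_fin_num mS ig.
have up : \int[m]_(x in S) (f x)%:E <= \int[m]_(x in S) (g x)%:E + \int[m]_(x in S) e x.
  rewrite -integralD //; apply: le_integral_rough => x Sx.
  have := fge x Sx; have := e0 x Sx; case: (e x) => [r| |] //=.
    by rewrite !lee_fin => _; rewrite ler_norml; lra.
  by move=> _ _; rewrite addey // leey.
have low : \int[m]_(x in S) (g x)%:E - \int[m]_(x in S) e x <= \int[m]_(x in S) (f x)%:E.
  rewrite -integralB //; apply: le_integral_rough => x Sx.
  have := fge x Sx; have := e0 x Sx; case: (e x) => [r| |] //=.
    by rewrite !lee_fin => _; rewrite ler_norml; lra.
  by move=> _ _; rewrite leNye.
rewrite /Rintegral; move: up low; rewrite -(fineK iefin) -(fineK igfin) /=.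
set a := fine _; set b := fine _.
case: (\int[m]_(x in S) (f x)%:E) => [r| |] //=.
move=> H1 H2; rewrite -EFinD lee_fin in H1; rewrite -EFinD lee_fin in H2.
by rewrite lee_fin ler_norml; lra.
Qed.

End rough_integral.

Section step_weights.
Context {R : realType}.
Local Notation RM := (measurableTypeR R).
Variables (m : nat) (h : R).

(** The remainder of [u_taylor] up to its constant, as a function of both endpoints. *)
Definition dispersion (yz : RM * RM) : R :=
  (wt m yz.1 + wt m yz.2) *
  (h ^+ 2 + h * (yz.2 - yz.1) ^+ 2 + (yz.2 - yz.1) ^+ 4).

Lemma measurable_wt k : measurable_fun setT (wt k : RM -> RM).
Proof.
by apply: measurable_funX; apply: measurable_funD => //; exact: measurable_funX.
Qed.

Lemma measurable_increment n :
  measurable_fun setT (fun yz : RM * RM => ((yz.2 - yz.1) ^+ n : RM)).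
Proof.
apply: measurable_funX; apply: measurable_funB; [exact: measurable_snd|exact: measurable_fst].
Qed.

Lemma measurable_dispersion : measurable_fun setT (dispersion : RM * RM -> RM).
Proof.
apply: measurable_funM.
  by apply: measurable_funD; apply: (measurableT_comp (measurable_wt m));
    [exact: measurable_fst|exact: measurable_snd].
apply: measurable_funD; last exact: measurable_increment.
by apply: measurable_funD => //; apply: measurable_funM => //; exact: measurable_increment.
Qed.

Lemma dispersion_ge0 yz : 0 <= h -> 0 <= dispersion yz.
Proof.
move=> h0; apply: mulr_ge0; first by rewrite addr_ge0 ?wt_ge0.
apply: addr_ge0; last exact: exprn_even_ge0.
by apply: addr_ge0; [exact: sqr_ge0|apply: mulr_ge0 => //; exact: sqr_ge0].
Qed.

End step_weights.

(** * Error propagation over one time step *)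

Section scheme_step.
Context {R : realType}.
Local Notation RM := (measurableTypeR R).
Variables (M : model R) (u : R -> R -> R -> R).
Hypothesis std : standing_coefficients M.
Hypothesis reg : levy_regular M.
Hypothesis pide : solves_pide M u.
Local Notation T := (horizon M).
Local Notation D := (dom M).
Variable w : nat -> nat -> nat -> R -> R -> R -> R.
Hypothesis pd : partial_derivatives T D 4 u w.
Variables (C1 : R) (m : nat).
Hypothesis C10 : 0 < C1.
Hypothesis wb : forall k l' l t x y, (2 * k + l' + l <= 4)%N -> 0 <= t < T -> D y ->
  `|w k l' l t x y| <= C1 * wt m y.
Variable e : R.
Hypothesis e0 : 0 < e.
Hypothesis ge : forall y, D y -> (forall z, D z -> gamX M z = 0) \/
    (~ (forall z, D z -> gamX M z = 0) /\ e <= `|gamX M y|).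
Local Notation L := (jump_rate M e).

Definition moment (kap : {measure set RM -> \bar R}) (y : R) (j : nat) : R :=
  \int[kap]_z (z - y) ^+ j.

Definition moment_defect (kap : {measure set RM -> \bar R}) (h y : R) : R :=
  `|moment kap y 1 - muY M y * h| + `|moment kap y 2 - sigY M y ^+ 2 * h|
  + `|moment kap y 3|.

Definition coef_weight (y : R) : R :=
  2 + `|muY M y| + `|muX M y| + sigX M y ^+ 2.

Definition step_constant : R := C1 * ((1 + 2 * L) * (1 + T) ^+ 2).

Let L0 : 0 <= L.
Proof. exact: jump_rate_ge0. Qed.

(** Here [a], [b], [c] stand for the three moment defects, and [q] and [m1] for the sizes of the
    second and first moments. The first moment is eliminated through its defect, whereas [h * q] is
    kept, to be absorbed later by the dispersion. *)
Lemma consistency_bound (a b c q m1 muy mux sx h dx : R) :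
  0 <= a -> 0 <= b -> 0 <= c -> 0 <= q -> 0 <= muy -> 0 <= mux -> 0 <= sx ->
  0 < h -> h <= T -> 0 < dx -> 0 <= m1 -> m1 <= a + h * muy ->
  a + b + c + h * m1 + 2 * L * h * (h + (1 + h) * m1 + q + c)
    + h * dx * (mux + sx) + 2 * L * h * dx <=
  (1 + 2 * L) * (1 + T) ^+ 2 *
    (h * q + (a + b + c) + h * (h + dx) * (2 + muy + mux + sx)).
Proof.
move=> a0 b0 c0 q0 my0 mx0 s0 h0 hT dx0 m10 m1a.
set G := (1 + 2 * L) * (1 + T) ^+ 2.
have T0 : 0 <= T by apply: le_trans hT; exact: ltW.
have h0' := ltW h0; have L0' := L0; have LT := mulr_ge0 L0 T0; have TT := mulr_ge0 T0 T0.
have LTT := mulr_ge0 LT T0; have Lh : L * h <= L * T by rewrite ler_wpM2l.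
have Lhh : L * h * h <= L * T * T by rewrite ler_pM ?mulr_ge0.
have Lh0 := mulr_ge0 L0 h0'.
have GE : G = (1 + 2 * L) * (1 + 2 * T + T * T) by rewrite /G; ring.
have hle : 1 + h + 2 * L * h * (1 + h) <= G by rewrite GE; lra.
have G1 : 1 + 2 * L <= G by rewrite GE; lra.
have G2 : 1 + 2 * L * (1 + h) <= G by rewrite GE; lra.
have G3 : 1 + 2 * L * h <= G by lra.
have k1 : h * m1 + 2 * L * h * ((1 + h) * m1) + a <= G * a + G * (h * (h * muy)).
  have : (h + 2 * L * h * (1 + h)) * m1 <= (h + 2 * L * h * (1 + h)) * (a + h * muy).
    by rewrite ler_wpM2l // addr_ge0 ?mulr_ge0 // addr_ge0.
  have : (1 + h + 2 * L * h * (1 + h)) * a <= G * a by rewrite ler_wpM2r.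
  have : (1 + 2 * L * (1 + h)) * (h * (h * muy)) <= G * (h * (h * muy)).
    by rewrite ler_wpM2r // !mulr_ge0 // ltW.
  lra.
have k2 : b <= G * b by rewrite ler_peMl //; lra.
have k3 : c + 2 * L * h * c <= G * c.
  by rewrite -{1}[c]mul1r -mulrDl ler_wpM2r.
have hh : 0 <= h * h by rewrite mulr_ge0 // ltW.
have hd : 0 <= h * dx by rewrite mulr_ge0 // ltW.
have hq : 0 <= h * q by rewrite mulr_ge0 // ltW.
have L2G : 2 * L <= G by lra.
have k4 : 2 * L * (h * h) <= G * (h * h) by rewrite ler_wpM2r.
have k5 : 2 * L * (h * q) <= G * (h * q) by rewrite ler_wpM2r.
have k6 : (h * dx) * (mux + sx) <= G * ((h * dx) * (mux + sx)).
  by rewrite ler_peMl ?mulr_ge0 ?addr_ge0 //; lra.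
have k7 : 2 * L * (h * dx) <= G * (h * dx) by rewrite ler_wpM2r.
have GG : 0 <= G by lra.
have k8 : 0 <= G * (h * h) * (1 + mux + sx).
  by apply: mulr_ge0; [exact: mulr_ge0|lra].
have k9 : 0 <= G * (h * dx) * (1 + muy).
  by apply: mulr_ge0; [exact: mulr_ge0|lra].
lra.
Qed.

Variables (t h dx y : R).
Hypotheses (t0 : 0 <= t) (h0 : 0 < h) (thT : t + h <= T).
Hypotheses (dx0 : 0 < dx) (dx1 : dx < 1) (Dy : D y).
Variables (kap : {measure set RM -> \bar R}) (S : set R).
Hypothesis kapT : kap setT = 1%E.
Hypotheses (mS : measurable (S : set RM)) (SD : S `<=` D) (kS : kap S = 1%E).
Variables (uh : int -> R -> R) (th : RM -> \bar R).
Hypotheses (mth : measurable_fun setT th) (th0 : forall z, (0 <= th z)%E).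
Hypothesis uh_th : forall z, S z -> forall j,
  ((`|u (t + h) (node M dx j) z - uh j z|)%:E <= th z)%E.

Let r (z : R) : R := C1 * dispersion m h (y, z).

Let r0 z : 0 <= r z.
Proof. by rewrite mulr_ge0 ?dispersion_ge0 // ltW. Qed.

Let mr : measurable_fun setT (r : RM -> RM).
Proof.
apply: measurable_funM => //.
by apply: (measurableT_comp (measurable_dispersion m h)); exact: measurable_pair1.
Qed.

Let KL : 0 < 1 + 2 * h * L.
Proof. by rewrite ltr_pwDl // !mulr_ge0 // ltW. Qed.

Let Kmeas : measurable_fun setT (fun z : RM => ((1 + 2 * h * L)%:E * (th z + (r z)%:E))%E).
Proof.
apply: measurable_funeM; apply: emeasurable_funD => //.
exact/measurable_EFinP.
Qed.

(** Where [th z] is infinite there is nothing to prove. Elsewhere [uh] at [z] is a bounded sequence,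
    so [Pi] acts linearly on its error and on the Taylor remainder. *)
Let close i z : S z ->
  ((`|Pi_op M h dx y (fun j => uh j z) i
     - \sum_(k < 4) taylor_image M w t h dx y k i * (z - y) ^+ k|)%:E
   <= (1 + 2 * h * L)%:E * (th z + (r z)%:E))%E.
Proof.
move=> Sz; have := uh_th Sz; have := th0 z.
case: (th z) => [thz| |] //; last first.
  by move=> _ _; rewrite addye // gt0_muley ?lte_fin // leey.
rewrite lee_fin => thz0 uthz; rewrite -EFinD -EFinM lee_fin.
have db : bdd (fun j => uh j z - u (t + h) (node M dx j) z) thz.
  by move=> j; rewrite distrC -lee_fin; exact: uthz.
have ub : bdd (fun j => u (t + h) (node M dx j) z) (C1 * wt m z).
  by move=> j; apply: (u_bound std pide pd wb); [rewrite thT addr_ge0 // ltW|exact: SD].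
have := Pi_opD std reg e0 dx0 dx1 (ge Dy) h0 db ub.
rewrite (_ : (fun j => _ - _ + _) = fun j => uh j z); last first.
  by apply/funext => j; rewrite subrK.
move=> ->; rewrite -addrA (le_trans (ler_normD _ _)) // mulrDr lerD //.
  exact: (Pi_op_bdd std reg e0 dx0 dx1 (ge Dy) h0 db).
have := taylor_residual std pide pd wb reg e0 ge t0 h0 thT dx0 dx1 Dy (SD Sz) i.
by rewrite /r /dispersion /= [C1 * (_ * _)]mulrA.
Qed.

Lemma scheme_step i :
  ((`|u t (node M dx i) y
     - \int[kap]_(z in S) Pi_op M h dx y (fun j => uh j z) i|)%:E
   <= (1 + 2 * h * L)%:E * \int[kap]_z th z
      + ((1 + 2 * T * L) * C1 + step_constant)%:E *
        (\int[kap]_z (dispersion m h (y, z))%:E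
         + (wt m y * (moment_defect kap h y + h * (h + dx) * coef_weight y))%:E))%E.
Proof.
have T0 : 0 <= T by apply: le_trans thT; rewrite addr_ge0 // ltW.
have hT : h <= T by apply: le_trans thT; rewrite lerDr.
have disp0 z : (0 <= (dispersion m h (y, z))%:E)%E by rewrite lee_fin dispersion_ge0 // ltW.
have cw0 : 0 <= coef_weight y by rewrite !addr_ge0 ?sqr_ge0.
have md0 : 0 <= moment_defect kap h y by rewrite !addr_ge0.
have sc0 : 0 <= step_constant.
  by rewrite mulr_ge0 ?(ltW C10) // mulr_ge0 ?exprn_ge0 ?addr_ge0 ?mulr_ge0.
have tail0 : 0 <= wt m y * (moment_defect kap h y + h * (h + dx) * coef_weight y).
  apply: mulr_ge0; first exact: wt_ge0.
  by apply: addr_ge0 => //; apply: mulr_ge0 => //; rewrite mulr_ge0 ?addr_ge0 ?(ltW h0) ?(ltW dx0).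
have CC0 : 0 < (1 + 2 * T * L) * C1 + step_constant.
  by rewrite ltr_pwDl // mulr_gt0 // ltr_pwDl // !mulr_ge0.
have ith0 : (0 <= \int[kap]_z th z)%E by apply: integral_ge0.
have ir0 : (0 <= \int[kap]_z (dispersion m h (y, z))%:E)%E by apply: integral_ge0.
(* An infinite integral on the right makes the claim trivial; once both are finite, the kernel has
   the moments needed to integrate the polynomial. *)
have [thoo|thfin] := eqVneq (\int[kap]_z th z)%E +oo%E.
  rewrite thoo gt0_muley ?lte_fin // addye ?leey //.
  by rewrite gt_eqF // (@lt_le_trans _ _ 0%E) // ?ltNy0 // mule_ge0 ?lee_fin ?(ltW CC0) // adde_ge0 // lee_fin.
have [roo|rfin] := eqVneq (\int[kap]_z (dispersion m h (y, z))%:E)%E +oo%E.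
  rewrite roo addye // gt0_muley ?lte_fin // addey ?leey //.
  by rewrite gt_eqF // (@lt_le_trans _ _ 0%E) // ?ltNy0 // mule_ge0 ?lee_fin ?(ltW KL).
have mdisp : measurable_fun setT (fun z : RM => (dispersion m h (y, z))%:E).
  apply/measurable_EFinP.
  by apply: (measurableT_comp (measurable_dispersion m h)); exact: measurable_pair1.
have idisp : kap.-integrable setT (fun z => (dispersion m h (y, z))%:E).
  apply/integrableP; split => //.
  rewrite (eq_integral (fun z => (dispersion m h (y, z))%:E)); last first.
    by move=> z _; rewrite gee0_abs.
  by rewrite lt_neqAle rfin leey.
have i1 : kap.-integrable setT (cst 1%E).
  apply/integrableP; split => //.
  by rewrite (eq_integral (cst 1%E)) ?integral_cst // ?mul1e ?[X in (X < _)%E]kapT ?ltry // => z _; rewrite gee0_abs.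
(* Powers up to 4 are dominated by [1 + dispersion], which contains [(z - y)^4] with a weight at
   least 1. *)
have iD k : (k <= 4)%N -> kap.-integrable setT (EFin \o (fun z => (z - y) ^+ k)).
  move=> k4; apply: (le_integrable _ _ _ (integrableD measurableT i1 idisp)) => //.
    apply/measurable_EFinP; apply: measurable_funX.
    exact: measurable_funB.
  move=> z _.
  have -> : (`|cst 1 z + (dispersion m h (y, z))%:E| = (1 + dispersion m h (y, z))%:E)%E.
    by congr EFin; rewrite ger0_norm // addr_ge0 // dispersion_ge0 // ltW.
  rewrite /= lee_fin normrX.
  have n4 : `|z - y| ^+ 4 = (z - y) ^+ 4.
    by rewrite -normrX ger0_norm // exprn_even_ge0.
  have d4 : (z - y) ^+ 4 <= dispersion m h (y, z).
    rewrite /dispersion /= -[leLHS]mul1r ler_pM //.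
    - by rewrite -n4 exprn_ge0.
    - by have := wt_ge1 m y; have := wt_ge0 m z; lra.
    - by rewrite lerDr addr_ge0 ?sqr_ge0 // mulr_ge0 ?sqr_ge0 // ltW.
  have [z1|z1] := leP `|z - y| 1.
    by rewrite (@le_trans _ _ 1) ?exprn_ile1 // lerDl dispersion_ge0 // ltW.
  rewrite (@le_trans _ _ (`|z - y| ^+ 4)) //.
    by rewrite ler_weXn2l // ltW.
  by rewrite n4 (le_trans d4) // lerDr.
pose P := fun k => taylor_image M w t h dx y k i.
have iPk k : (k <= 4)%N -> kap.-integrable setT (EFin \o (fun z => P k * (z - y) ^+ k)).
  by move=> k4; have := integrableZl measurableT (P k) (iD k k4); apply: eq_integrable.
have PE : (fun z : R => \sum_(k < 4) P k * (z - y) ^+ k) =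
    fun z => P 0%N * (z - y) ^+ 0 + P 1%N * (z - y) ^+ 1 + P 2%N * (z - y) ^+ 2
             + P 3%N * (z - y) ^+ 3.
  by apply/funext => z; rewrite !big_ord_recr big_ord0 /= add0r.
have iDD (f1 f2 : RM -> R) : kap.-integrable setT (EFin \o f1) ->
    kap.-integrable setT (EFin \o f2) -> kap.-integrable setT (EFin \o (fun z => f1 z + f2 z)).
  by move=> if1 if2; have := integrableD measurableT if1 if2; apply: eq_integrable.
have i01 := iDD _ _ (iPk 0%N isT) (iPk 1%N isT).
have i02 := iDD _ _ i01 (iPk 2%N isT).
have i03 := iDD _ _ i02 (iPk 3%N isT).
have iP : kap.-integrable setT (EFin \o (fun z => \sum_(k < 4) P k * (z - y) ^+ k)).
  by rewrite PE; exact: i03.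
have PZ k : (k <= 4)%N -> \int[kap]_z (P k * (z - y) ^+ k) = P k * \int[kap]_z (z - y) ^+ k.
  by move=> k4; apply: RintegralZl => //; exact: iD.
have intP : \int[kap]_z (\sum_(k < 4) P k * (z - y) ^+ k) =
    P 0%N + P 1%N * moment kap y 1 + P 2%N * moment kap y 2 + P 3%N * moment kap y 3.
  rewrite PE (RintegralD measurableT i02 (iPk 3%N isT)) (RintegralD measurableT i01 (iPk 2%N isT)).
  rewrite (RintegralD measurableT (iPk 0%N isT) (iPk 1%N isT)).
  rewrite !PZ //; congr (_ + _ + _ + _).
  have -> : \int[kap]_z (z - y) ^+ 0 = 1 :> R.
    under eq_Rintegral do rewrite expr0.
    by rewrite Rintegral_cst // mul1r [X in fine X]kapT.
  by rewrite mulr1.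
have kSC : kap (~` S) = 0%E.
  have := kapT; rewrite -(setUv S) measureU //; last exact: setICr.
    rewrite [X in (X + _)%E]kS => /(congr1 (fun x => x - 1)%E).
    by rewrite addeAC subee // add0e.
  exact: measurableC.
(* The scheme integrates over the state space, the moments over the line; the difference is a null
   set for [kap]. *)
have intS : \int[kap]_(z in S) (\sum_(k < 4) P k * (z - y) ^+ k) =
    \int[kap]_z (\sum_(k < 4) P k * (z - y) ^+ k).
  rewrite /Rintegral [in RHS](negligible_integral (measurableC mS) measurableT iP kSC).
  by rewrite setDE setCK setTI.
have eE : (\int[kap]_z ((1 + 2 * h * L)%:E * (th z + (r z)%:E)) =
    (1 + 2 * h * L)%:E * (\int[kap]_z th z + C1%:E * \int[kap]_z (dispersion m h (y, z))%:E))%E.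
  have mrE : measurable_fun setT (fun z : RM => (r z)%:E) by exact/measurable_EFinP.
  have r0E z : (0 <= (r z)%:E)%E by rewrite lee_fin.
  have mtr : measurable_fun setT (fun z : RM => th z + (r z)%:E)%E by exact: emeasurable_funD.
  have tr0 z : (0 <= th z + (r z)%:E)%E by exact: adde_ge0.
  rewrite ge0_integralZl //; last by rewrite lee_fin ltW.
  congr (_ * _)%E; rewrite ge0_integralD //.
  congr (_ + _)%E; under eq_integral do rewrite /r EFinM.
  by rewrite ge0_integralZl // lee_fin ltW.
have thF : (\int[kap]_z th z)%E \is a fin_num by rewrite ge0_fin_numE // lt_neqAle thfin leey.
have rF : (\int[kap]_z (dispersion m h (y, z))%:E)%E \is a fin_num.
  by rewrite ge0_fin_numE // lt_neqAle rfin leey.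
have eS : (\int[kap]_(z in S) ((1 + 2 * h * L)%:E * (th z + (r z)%:E)) <=
    \int[kap]_z ((1 + 2 * h * L)%:E * (th z + (r z)%:E)))%E.
  apply: ge0_subset_integral => //.
  by move=> z _; rewrite mule_ge0 ?lee_fin ?(ltW KL) // adde_ge0 // lee_fin.
have eoo : (\int[kap]_(z in S) ((1 + 2 * h * L)%:E * (th z + (r z)%:E)) < +oo)%E.
  apply: (le_lt_trans eS); rewrite eE lte_mul_pinfty ?lee_fin ?(ltW KL) //.
  by rewrite lte_add_pinfty ?lte_mul_pinfty ?lee_fin ?(ltW C10) // -ge0_fin_numE.
have E1 := @Rintegral_close _ _ _ kap S (fun z => Pi_op M h dx y (fun j => uh j z) i)
  (fun z => \sum_(k < 4) P k * (z - y) ^+ k) _ mS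
  (integrableS measurableT mS (@subsetT _ S) iP)
  (measurable_funTS Kmeas)
  (fun z _ => mule_ge0 (ltW KL : (0 <= (1 + 2 * h * L)%:E)%E) (adde_ge0 (th0 z) (r0 z : (0 <= (r z)%:E)%E)))
  eoo (close i).
have {E1} := le_trans E1 eS; rewrite intS intP eE.
have := taylor_consistency std pide pd wb reg e0 ge t0 h0 thT dx0 dx1 Dy
  (moment kap y 1) (moment kap y 2) (moment kap y 3) i.
rewrite -/(P 0%N) -/(P 1%N) -/(P 2%N) -/(P 3%N).
set p := P 0%N + _ + _ + _; set I := \int[kap]_(z in S) _.
set U := u t (node M dx i) y.
(* The leftover [h * q] of [consistency_bound] is one of the terms of the dispersion, so it adds no
   new quantity to estimate. *)
have m2le : wt m y * (h * `|moment kap y 2|) <= fine (\int[kap]_z (dispersion m h (y, z))%:E)%E.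
  have m20 : 0 <= moment kap y 2 by apply: Rintegral_ge0 => z _; exact: sqr_ge0.
  rewrite ger0_norm // mulrA /moment -(RintegralZl _ measurableT (iD 2%N isT)).
  apply: (@le_Rintegral _ _ _ kap _ _ (fun z => dispersion m h (y, z)) measurableT) => //.
    by have := integrableZl measurableT (wt m y * h) (iD 2%N isT); apply: eq_integrable.
  move=> z _; rewrite /dispersion /= -mulrA; apply: ler_pM.
  - exact: wt_ge0.
  - by apply: mulr_ge0; [exact: ltW|exact: sqr_ge0].
  - by rewrite lerDl wt_ge0.
  - by rewrite addrAC lerDr; apply: addr_ge0; [exact: sqr_ge0|exact: exprn_even_ge0].
move=> E2; rewrite -(fineK thF) -(fineK rF).
set A := fine _ in m2le *; set B := fine _.
have -> : ((1 + 2 * h * L)%:E * (B%:E + C1%:E * A%:E) = ((1 + 2 * h * L) * (B + C1 * A))%:E)%E by [].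
move=> E1.
have m1le : `|moment kap y 1| <= `|moment kap y 1 - muY M y * h| + h * `|muY M y|.
  rewrite -{1}[moment kap y 1](subrK (muY M y * h)) (le_trans (ler_normD _ _)) //.
  by rewrite lerD2l normrM (gtr0_norm h0) mulrC.
have := @consistency_bound _ _ _ _ _ _ _ _ h dx
  (normr_ge0 (moment kap y 1 - muY M y * h)) (normr_ge0 (moment kap y 2 - sigY M y ^+ 2 * h))
  (normr_ge0 (moment kap y 3)) (normr_ge0 (moment kap y 2)) (normr_ge0 (muY M y))
  (normr_ge0 (muX M y)) (sqr_ge0 (sigX M y)) h0 hT dx0 (normr_ge0 (moment kap y 1)) m1le.
rewrite -/(moment_defect kap h y) -/(coef_weight y) => E3.
have tri : `|U - I| <= `|p - U| + `|I - p|.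
  by rewrite [`|p - U|]distrC [`|I - p|]distrC -[U - I](subrKA p) ler_normD.
apply: (le_trans tri); apply: (le_trans (lerD E2 E1)).
have wy0 := wt_ge0 m y.
have E4 : C1 * wt m y * ((1 + 2 * L) * (1 + T) ^+ 2 *
   (h * `|moment kap y 2| + moment_defect kap h y + h * (h + dx) * coef_weight y)) <=
   step_constant * (A + wt m y * (moment_defect kap h y + h * (h + dx) * coef_weight y)).
  rewrite /step_constant -(mulrA C1) -(mulrA C1) ler_pM2l //.
  rewrite mulrCA ler_wpM2l //; first by rewrite mulr_ge0 ?exprn_ge0 ?addr_ge0 ?mulr_ge0.
  by rewrite -(addrA (h * _)) mulrDr lerD2r.
have C1w : 0 <= C1 * wt m y by rewrite mulr_ge0 // ltW.
apply: (le_trans (lerD (le_trans (ler_wpM2l C1w E3) E4) (lexx _))).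
have A0 : 0 <= A by rewrite fine_ge0.
have hTL : (1 + 2 * h * L) * (C1 * A) <= (1 + 2 * T * L) * C1 * A.
  rewrite -[leRHS]mulrA ler_wpM2r ?mulr_ge0 ?(ltW C10) // lerD2l ler_wpM2r //.
  by rewrite ler_wpM2l.
have : 0 <= (1 + 2 * T * L) * C1 * (wt m y * (moment_defect kap h y + h * (h + dx) * coef_weight y)).
  by rewrite mulr_ge0 // mulr_ge0 ?(ltW C10) // addr_ge0 // !mulr_ge0.
move: hTL; set X := wt m y * _; set c1 := (1 + 2 * T * L) * C1; lra.
Qed.

End scheme_step.

(** * Moments along the chain *)

Lemma wt_le_even_power (R : realType) j (y : R) : wt j y <= 2 ^+ j * (1 + `|y| ^+ (2 * j)).
Proof.
have [y1|y1] := leP (y ^+ 2) 1.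
  apply: (@le_trans _ _ (2 ^+ j)); last by rewrite ler_peMr ?exprn_ge0 // lerDl exprn_ge0.
  by rewrite lerXn2r ?nnegrE ?addr_ge0 ?sqr_ge0 //; lra.
apply: (@le_trans _ _ ((2 * y ^+ 2) ^+ j)).
  have y2 := sqr_ge0 y; have y3 : 1 + y ^+ 2 <= 2 * y ^+ 2 by lra.
  by apply: lerXn2r => //; rewrite nnegrE; lra.
by rewrite exprMn ler_wpM2l ?exprn_ge0 // exprM real_normK ?num_real // lerDr.
Qed.

(** Young's inequality scaled so that, for increments of size [sqrt h], each of the three terms is
    of order [h^2]; it also separates the weights from the increments, whose joint moments are not
    given. *)
Lemma dispersion_le (R : realType) m (h : R) y z : 0 < h ->
  dispersion m h (y, z) <=
    4 * h ^+ 2 * (wt (m + m) y + wt (m + m) z) + (z - y) ^+ 4 + (h ^+ 2)^-1 * (z - y) ^+ 8.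
Proof.
move=> h0; rewrite /dispersion /= !wtD.
have := wt_ge1 m y; have := wt_ge1 m z; move: (wt m y) (wt m z) => a b b1 a1.
set x := z - y; have h2 : 0 < h ^+ 2 by rewrite exprn_gt0.
have -> : (h ^+ 2)^-1 * x ^+ 8 = (h^-1 * x ^+ 4) ^+ 2.
  by rewrite exprMn exprVn -exprM.
have e4 : x ^+ 4 = h * (h^-1 * x ^+ 4) by rewrite mulrA divff ?mul1r // gt_eqF.
set v := h^-1 * x ^+ 4 in e4 *.
have e2 : h * x ^+ 2 * (a + b) <= h ^+ 2 * (a + b) ^+ 2 / 2 + x ^+ 4 / 2.
  by have := sqr_ge0 (h * (a + b) - x ^+ 2); rewrite (_ : x ^+ 4 = (x ^+ 2) ^+ 2) ?exprM //; nra.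
have e3 : (a + b) * (h * v) <= h ^+ 2 * (a + b) ^+ 2 / 2 + v ^+ 2 / 2.
  by have := sqr_ge0 (h * (a + b) - v); nra.
have e1 : h ^+ 2 * (a + b) <= h ^+ 2 * (a + b) ^+ 2.
  by rewrite ler_pM2l // expr2 ler_peMl; lra.
have e5 : h ^+ 2 * (a + b) ^+ 2 <= h ^+ 2 * (2 * (a * a + b * b)).
  by rewrite ler_pM2l //; have := sqr_ge0 (a - b); nra.
have v2 := sqr_ge0 v.
have x4 : 0 <= x ^+ 4 by rewrite exprn_even_ge0.
rewrite -e4 in e3; lra.
Qed.

Section expectations.
Context d (Om : measurableType d) (R : realType) (P : probability Om R).
Local Notation RM := (measurableTypeR R).

Lemma expectation_le2 (f g1 g2 : Om -> R) (a1 a2 c1 c2 : R) : 0 <= a1 -> 0 <= a2 ->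
  measurable_fun setT (g1 : Om -> RM) -> measurable_fun setT (g2 : Om -> RM) ->
  (forall w, 0 <= g1 w) -> (forall w, 0 <= g2 w) ->
  (forall w, f w <= a1 * g1 w + a2 * g2 w) ->
  (\int[P]_w (g1 w)%:E <= c1%:E)%E -> (\int[P]_w (g2 w)%:E <= c2%:E)%E ->
  (\int[P]_w (f w)%:E <= (a1 * c1 + a2 * c2)%:E)%E.
Proof.
move=> a10 a20 mg1 mg2 g10 g20 fg I1 I2.
apply: (@le_trans _ _ (\int[P]_w (a1%:E * (g1 w)%:E + a2%:E * (g2 w)%:E))%E).
  by apply: le_integral_rough => w _; rewrite -!EFinM -EFinD lee_fin.
have mg1' : measurable_fun setT (fun w => (g1 w)%:E) by exact/measurable_EFinP.
have mg2' : measurable_fun setT (fun w => (g2 w)%:E) by exact/measurable_EFinP.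
rewrite ge0_integralD //; last 4 first.
- by move=> w _; rewrite mule_ge0 // lee_fin.
- exact: measurable_funeM.
- by move=> w _; rewrite mule_ge0 // lee_fin.
- exact: measurable_funeM.
rewrite !ge0_integralZl ?lee_fin //; last 2 first.
- by move=> w _; rewrite lee_fin.
- by move=> w _; rewrite lee_fin.
by rewrite EFinD !EFinM leeD // lee_pmul ?lee_fin // integral_ge0 // => w _; rewrite lee_fin.
Qed.

(** The exponent is raised to [2 (j + 1)] so that it exceeds 1 even when [j = 0], as H2 requires. *)
Lemma expectation_wt (Y : Om -> RM) j (C : R) : measurable_fun setT Y -> 0 <= C ->
  (Lnorm P (2 * j.+1)%:R%:E (fun w => (Y w)%:E) <= C%:E)%E ->
  (\int[P]_w (wt j (Y w))%:E <= (2 ^+ j.+1 * (1 + C ^+ (2 * j.+1)))%:E)%E.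
Proof.
move=> mY C0 YC.
rewrite mulrDr.
apply: (@expectation_le2 _ (cst 1) (fun w => `|Y w| ^+ (2 * j.+1))) => //.
- by apply: measurable_funX; exact: measurableT_comp.
- move=> w /=; rewrite -mulrDr; apply: le_trans (wt_le_even_power j.+1 (Y w)).
  exact: le_wt.
- by rewrite (eq_integral (cst 1%E)) // integral_cst // mul1e probability_le1.
- exact: natural_moment.
Qed.

(* Young's inequality, with [wt m ^ q] absorbed into a higher weight *)
Lemma expectation_wt_Lnorm (Y F : Om -> RM) m k (p C a A : R) :
  measurable_fun setT Y -> measurable_fun setT F ->
  1 < p -> p / (p - 1) <= k%:R -> 0 <= C -> 0 < a ->
  (Lnorm P p%:E (fun w => (F w)%:E) <= (C * a)%:E)%E ->
  (\int[P]_w (wt (m * k) (Y w))%:E <= A%:E)%E ->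
  (\int[P]_w (wt m (Y w) * `|F w|)%:E <= (a * (A + C `^ p))%:E)%E.
Proof.
move=> mY mF p1 pk C0 a0 FC wA; have p0 : 0 < p by lra.
have I := powR_moment p0 (mulr_ge0 C0 (ltW a0)) FC.
have ai0 : 0 <= a^-1 by rewrite invr_ge0 ltW.
have q0 : 0 < p / (p - 1) by rewrite divr_gt0 //; lra.
have pq : (p / (p - 1))^-1 + p^-1 = 1.
  by rewrite invf_div mulrBl divff ?gt_eqF // mul1r subrK.
(* [F] is divided by [a] before Young's inequality is applied; otherwise the weight term would come
   out without the factor [a], which will be [h^2]. *)
pose c := a^-1 `^ p.
have c0 : 0 <= c by exact: powR_ge0.
have -> : a * (A + C `^ p) = a * A + (a * c) * ((C * a) `^ p).
  rewrite mulrDr -(mulrA a c) /c -powRM ?mulr_ge0 ?(ltW a0) //.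
  by rewrite mulrCA mulVf ?gt_eqF // mulr1.
apply: (@expectation_le2 _ (fun w => wt (m * k) (Y w)) (fun w => `|F w| `^ p)) => //.
- exact: ltW.
- by rewrite mulr_ge0 // ltW.
- exact: (measurableT_comp (measurable_wt _) mY).
- have mn : measurable_fun setT (fun w => `|F w| : RM) by exact: measurableT_comp.
  exact: (measurableT_comp (measurable_powR p) mn).
- by move=> w; exact: wt_ge0.
move=> w; pose G : R := `|F w|; rewrite -/G.
have G0 : 0 <= G by exact: normr_ge0.
have := @conjugate_powR R (wt m (Y w)) (a^-1 * G) (p / (p - 1)) p
  (wt_ge0 _ _) (mulr_ge0 ai0 G0) q0 p0 pq.
rewrite (powRM _ ai0 G0) -/c => H.
have Wk : wt m (Y w) `^ (p / (p - 1)) <= wt (m * k) (Y w).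
  rewrite /wt [(1 + _) ^+ (m * k)]exprM -/(wt m (Y w)) -powR_mulrn ?wt_ge0 //.
  by rewrite ler_powR // wt_ge1.
have -> : wt m (Y w) * G = a * (wt m (Y w) * (a^-1 * G)).
  by rewrite mulrCA [a * (_ * _)]mulrA divff ?gt_eqF // mul1r.
rewrite -mulrA -mulrDr ler_pM2l // (le_trans H) // lerD //.
  rewrite (le_trans _ Wk) // ler_piMr ?powR_ge0 // invf_div ler_pdivrMr; lra.
by rewrite ler_piMr ?mulr_ge0 ?powR_ge0 // invf_le1 // ltW.
Qed.

End expectations.

(** * Moments of the kernels and of the chain *)

Section kernel_moments.
Context {R : realType}.
Local Notation RM := (measurableTypeR R).
Variable M : model R.
Hypothesis std : standing_coefficients M.
Local Notation D := (dom M).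

Lemma measurable_dom : measurable (D : set RM).
Proof. by apply: is_interval_measurable; exact: dom_interval. Qed.

Lemma measurable_patch_dom (f : RM -> RM) : measurable_fun D f -> measurable_fun setT (f \_ D).
Proof. by move=> mf; apply/(measurable_restrictT _ _).1 => //; exact: measurable_dom. Qed.

Variable k : R.-pker RM ~> RM.

Lemma measurable_kernel_integral (f : RM * RM -> \bar R) : (forall z, 0 <= f z)%E ->
  measurable_fun setT f -> measurable_fun setT (fun y => \int[k y]_z f (y, z))%E.
Proof. by move=> f0 mf; exact: measurable_fun_integral_finite_kernel. Qed.

Lemma measurable_moment j : measurable_fun setT (fun y : RM => moment (k y) y j : RM).
Proof.
pose g (yz : RM * RM) := (((yz.2 - yz.1) ^+ j)%:E)%E.
have mg : measurable_fun setT g by apply/measurable_EFinP; exact: measurable_increment.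
have -> : (fun y => moment (k y) y j) =
    (fun y => fine (\int[k y]_z (g^\+)%E (y, z) - \int[k y]_z (g^\-)%E (y, z))%E).
  apply/funext => y; rewrite /moment /Rintegral integralE; congr (fine (_ - _)%E).
    by apply: eq_integral => z _; rewrite !funeposE.
  by apply: eq_integral => z _; rewrite !funenegE.
apply: (measurableT_comp (@fine_measurable R setT measurableT)) => //.
by apply: emeasurable_funB; apply: measurable_kernel_integral => //;
  [exact: measurable_funepos|exact: measurable_funeneg].
Qed.

Lemma measurable_moment_defect h :
  measurable_fun setT ((fun y : RM => moment_defect M (k y) h y : RM) \_ D).
Proof.
case: std => _ [[mmuX msigX _ mmuY msigY] _].
apply: measurable_patch_dom; have mm j := measurable_funTS (measurable_moment j) (D := D).
have mn (f : RM -> RM) : measurable_fun D f -> measurable_fun D (fun y => `|f y| : RM).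
  by move=> mf; exact: (measurableT_comp (@normr_measurable R setT) mf).
apply: measurable_funD; last exact: mn (mm 3%N).
apply: measurable_funD; apply: mn; apply: measurable_funB;
  [exact: mm|exact: measurable_funM|exact: mm|].
by apply: measurable_funM => //; exact: measurable_funX.
Qed.

Lemma measurable_coef_weight : measurable_fun setT ((fun y : RM => coef_weight M y : RM) \_ D).
Proof.
case: std => _ [[mmuX msigX _ mmuY msigY] _].
apply: measurable_patch_dom.
apply: measurable_funD; last exact: measurable_funX.
apply: measurable_funD; last exact: measurableT_comp.
by apply: measurable_funD => //; exact: measurableT_comp.
Qed.

Lemma coef_weight_ge0 y : 0 <= coef_weight M y.
Proof. by rewrite !addr_ge0 ?sqr_ge0. Qed.

Lemma moment_defect_ge0 kap h y : 0 <= moment_defect M kap h y.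
Proof. by rewrite !addr_ge0. Qed.

Lemma coef_weight_wt : exists (C : R) (m : nat),
  0 < C /\ forall y, D y -> coef_weight M y <= C * wt m y.
Proof.
case: std => _ [_ [[/poly_growth_wt[CX [mX [CX0 HX]]] /poly_growth_wt[CY [mY [CY0 HY]]]
  /poly_growth_wt[CS [mS [CS0 HS]]]] _]].
exists (2 + CY + CX + CS ^+ 2), (mX + mY + (mS + mS))%N; split.
  by have := sqr_ge0 CS; lra.
move=> y Dy; set W := wt _ y.
have W1 : 1 <= W by exact: wt_ge1.
have bX : `|muX M y| <= CX * W.
  by rewrite (le_trans (HX y Dy)) // ler_pM2l // le_wt //; lia.
have bY : `|muY M y| <= CY * W.
  by rewrite (le_trans (HY y Dy)) // ler_pM2l // le_wt //; lia.
have bS : sigX M y ^+ 2 <= CS ^+ 2 * W.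
  rewrite -[sigX M y ^+ 2]real_normK ?num_real //.
  apply: (@le_trans _ _ ((CS * wt mS y) ^+ 2)).
    by rewrite lerXn2r ?nnegrE ?mulr_ge0 ?wt_ge0 ?(ltW CS0) // HS.
  rewrite exprMn ler_wpM2l ?sqr_ge0 // expr2 -wtD le_wt //; lia.
rewrite /coef_weight; lra.
Qed.

End kernel_moments.

Section chain_moments.
Context {R : realType} (M : model R).
Local Notation RM := (measurableTypeR R).
Context d (Om : measurableType d) (P : probability Om R).
Hypothesis std : standing_coefficients M.
Local Notation D := (dom M).
Local Notation T := (horizon M).

Section one_chain.
Variables (N : nat) (S : nat -> set R) (K : nat -> R.-pker RM ~> RM) (Y : nat -> Om -> R).
Hypothesis mc : markov_chain M P N S K Y.

Lemma chain_measurable n : (n <= N)%N -> measurable_fun setT (Y n : Om -> RM).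
Proof. by case: mc => H _ _ _ nN; have [] := H n nN. Qed.

Lemma chain_dom n w : (n <= N)%N -> D (Y n w).
Proof. by case: mc => H _ _ _ nN; have [_ _ SD SY] := H n nN; exact: SD. Qed.

Lemma chain_rect n (A B : set RM) : (n < N)%N -> measurable A -> measurable B ->
  P (Y n @^-1` A `&` Y n.+1 @^-1` B) = (\int[P]_(w in Y n @^-1` A) K n (Y n w) B)%E.
Proof.
case: mc => _ _ _ H nN mA mB.
(* Leaving all earlier states unconstrained reduces the path law to the joint law of two consecutive
   states. *)
pose A_ k : set R := if k == n then A else if k == n.+1 then B else setT.
have mA_ k : measurable (A_ k : set RM).
  by rewrite /A_; case: ifP => // _; case: ifP.
have := H n A_ nN mA_.
have -> : A_ n.+1 = B by rewrite /A_ eqxx ifF //; apply/negbTE; lia.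
have -> : [set w | forall k, (k <= n.+1)%N -> A_ k (Y k w)] =
    Y n @^-1` A `&` Y n.+1 @^-1` B.
  apply/seteqP; split => w /=.
    move=> Hw; split; have := Hw n (leqnSn n); have := Hw n.+1 (leqnn _);
      by rewrite /A_ !eqxx ?ifF //; apply/negbTE; lia.
  by move=> [Aw Bw] k _; rewrite /A_; case: eqP => [->|_] //; case: eqP => [->|].
have -> : [set w | forall k, (k <= n)%N -> A_ k (Y k w)] = Y n @^-1` A; last by [].
apply/seteqP; split => w /=; first by move=> /(_ n (leqnn _)); rewrite /A_ eqxx.
move=> Aw k kn; rewrite /A_; case: eqP => [->|_] //; case: eqP => // kn'; lia.
Qed.

(** Transfers a conditional moment from H1 to the kernel that drives the scheme. Extending [phi] by
    0 off the domain makes it measurable on the line and changes nothing on the chain. *)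
Lemma kernel_moment (n j : nat) (phi : RM -> RM) : (n < N)%N -> measurable_fun D phi ->
  is_condexp P (fun w => (Y n.+1 w - Y n w) ^+ j) (Y n) phi ->
  {ae P, forall w, moment (K n (Y n w)) (Y n w) j = phi (Y n w)}.
Proof.
move=> nN mphi ce.
have phiE : (phi \_ D) \o Y n = phi \o Y n.
  by apply/funext => w; rewrite /= patchE mem_set //; exact: chain_dom (ltnW nN).
have ce' : is_condexp P (fun w => (Y n.+1 w - Y n w) ^+ j) (Y n) (phi \_ D).
  case: ce => i1 i2 H; split => //; first by rewrite phiE.
  move=> A mA; rewrite H //; apply: eq_integral => w _.
  by rewrite -[phi (Y n w)]/((phi \o Y n) w) -phiE.
have := @condexp_kernel _ Om R P (Y n) (Y n.+1) (K n) (chain_measurable (ltnW nN))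
  (chain_measurable nN) (fun A B => @chain_rect n A B nN) _ _
  (measurable_increment j) (measurable_patch_dom std mphi) ce'.
apply: filterS => w; rewrite /moment /= => ->.
by rewrite -[LHS]/(((phi \_ D) \o Y n) w) phiE.
Qed.

(** Cut off outside the domain because the coefficients are measurable only there. *)
Definition local_defect (dx : R) m n : RM -> RM :=
  (fun y => wt m y * (moment_defect M (K n y) (step M N) y
                      + step M N * (step M N + dx) * coef_weight M y)) \_ D.

Lemma measurable_local_defect dx m n : measurable_fun setT (local_defect dx m n).
Proof.
have -> : local_defect dx m n = fun y => wt m y *
   (((fun y => moment_defect M (K n y) (step M N) y) \_ D) y
    + step M N * (step M N + dx) * ((coef_weight M : RM -> RM) \_ D) y).
  apply/funext => y; rewrite /local_defect !patchE; case: ifP => // _.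
  by rewrite mulr0 addr0 mulr0.
apply: measurable_funM; first exact: measurable_wt.
apply: measurable_funD; first exact: measurable_moment_defect.
by apply: measurable_funM => //; exact: measurable_coef_weight.
Qed.

Lemma local_defect_ge0 dx m n y : (0 < N)%N -> 0 < dx -> 0 <= local_defect dx m n y.
Proof.
move=> N0 dx0; have h0 : 0 <= step M N by rewrite divr_ge0 // ltW // horizon_gt0.
rewrite /local_defect patchE; case: ifP => // _.
apply: mulr_ge0; first exact: wt_ge0.
apply: addr_ge0; first exact: moment_defect_ge0.
by apply: mulr_ge0; [rewrite mulr_ge0 // addr_ge0 // ltW|exact: coef_weight_ge0].
Qed.

End one_chain.

Variables (S : nat -> nat -> set R) (K : nat -> nat -> R.-pker RM ~> RM)
  (Yh : nat -> nat -> Om -> R).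
Hypothesis mc : forall N, (0 < N)%N -> markov_chain M P N (S N) (K N) (Yh N).

Lemma step_gt0 N : (0 < N)%N -> 0 < step M N.
Proof. by move=> N0; rewrite divr_gt0 ?ltr0n // horizon_gt0. Qed.

Section with_H2.
Variable hb : R.
Hypothesis H2 : forall p : R, 1 < p -> exists Cp : R, [/\ 0 < Cp,
    (forall N n, (0 < N)%N -> step M N < hb -> (n <= N)%N ->
      (Lnorm P p%:E (fun w => (Yh N n w)%:E) <= Cp%:E)%E) &
    (forall N n, (0 < N)%N -> step M N < hb -> (n < N)%N ->
      (Lnorm P p%:E (fun w => (Yh N n.+1 w - Yh N n w)%:E) <=
         (Cp * Num.sqrt (step M N))%:E)%E)].

Lemma chain_wt j : exists A : R, 0 <= A /\ forall N n, (0 < N)%N -> step M N < hb -> (n <= N)%N ->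
  (\int[P]_w (wt j (Yh N n w))%:E <= A%:E)%E.
Proof.
have [|C [C0 HC _]] := H2 (p := (2 * j.+1)%:R); first by rewrite ltr1n; lia.
exists (2 ^+ j.+1 * (1 + C ^+ (2 * j.+1))); split.
  by rewrite mulr_ge0 ?exprn_ge0 // addr_ge0 // exprn_ge0 // ltW.
move=> N n N0 hN nN; apply: expectation_wt; [exact: chain_measurable (mc N0) _ nN|exact: ltW|].
exact: HC.
Qed.

Lemma chain_increment j : exists A : R, 0 <= A /\ forall N n, (0 < N)%N -> step M N < hb ->
  (n < N)%N ->
  (\int[P]_w ((Yh N n.+1 w - Yh N n w) ^+ (2 * j.+1))%:E <= (A * step M N ^+ j.+1)%:E)%E.
Proof.
have [|C [C0 _ HC]] := H2 (p := (2 * j.+1)%:R); first by rewrite ltr1n; lia.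
exists (C ^+ (2 * j.+1)); split; first by rewrite exprn_ge0 // ltW.
move=> N n N0 hN nN; have h0 := step_gt0 N0.
have := natural_moment (n := 2 * j.+1) _ (mulr_ge0 (ltW C0) (sqrtr_ge0 _)) (HC N n N0 hN nN).
rewrite exprMn [Num.sqrt _ ^+ _]exprM sqr_sqrtr ?(ltW h0) // => /(_ isT).
apply: le_trans; rewrite le_eqVlt; apply/orP; left; apply/eqP; apply: eq_integral => w _.
by rewrite -normrX ger0_norm // exprM exprn_ge0 // sqr_ge0.
Qed.

Lemma chain_dispersion m : exists C : R, 0 <= C /\ forall N n, (0 < N)%N -> step M N < hb ->
  (n < N)%N ->
  (\int[P]_w (dispersion m (step M N) (Yh N n w, Yh N n.+1 w))%:E <= (C * step M N ^+ 2)%:E)%E.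
Proof.
(* Indices 1 and, below, 3 of [chain_increment] are the fourth and eighth moments of the increments,
   of orders [h^2] and [h^4]; the latter is divided by [h^2] in [dispersion_le]. *)
have [A [A0 HA]] := chain_wt (m + m); have [B [B0 HB]] := chain_increment 1.
have [E [E0 HE]] := chain_increment 3.
exists (8 * A + B + E); split; first by rewrite !addr_ge0 // mulr_ge0.
move=> N n N0 hN nN; have h0 := step_gt0 N0; set h := step M N in h0 *.
have h2 : 0 < h ^+ 2 by rewrite exprn_gt0.
have mY := chain_measurable (mc N0) (ltnW nN); have mZ := chain_measurable (mc N0) nN.
have mw : measurable_fun setT (fun w => wt (m + m) (Yh N n w) : RM).
  exact: (measurableT_comp (measurable_wt _) mY).
have mw' : measurable_fun setT (fun w => wt (m + m) (Yh N n.+1 w) : RM).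
  exact: (measurableT_comp (measurable_wt _) mZ).
have mi j : measurable_fun setT (fun w => (Yh N n.+1 w - Yh N n w) ^+ j : RM).
  by apply: measurable_funX; exact: measurable_funB.
have i4 w : 0 <= (Yh N n.+1 w - Yh N n w) ^+ 4 by rewrite exprn_even_ge0.
have i8 w : 0 <= (Yh N n.+1 w - Yh N n w) ^+ 8 by rewrite exprn_even_ge0.
have ww := @expectation_le2 _ _ _ P _ _ _ _ _ _ _ (ltW h2) (ltW h2) mw mw'
  (fun w => wt_ge0 _ _) (fun w => wt_ge0 _ _) (fun w => lexx _) (HA N n N0 hN (ltnW nN)) (HA N n.+1 N0 hN nN).
have hi0 : 0 <= (h ^+ 2)^-1 by rewrite invr_ge0 ltW.
have ii := @expectation_le2 _ _ _ P _ _ _ _ _ _ _ (ler01 : 0 <= (1 : R)) hi0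
  (mi 4%N) (mi 8%N) i4 i8 (fun w => lexx _) (HB N n N0 hN nN) (HE N n N0 hN nN).
have -> : (8 * A + B + E) * h ^+ 2 =
    4 * (h ^+ 2 * A + h ^+ 2 * A) + 1 * (1 * (B * h ^+ 2) + (h ^+ 2)^-1 * (E * h ^+ 4)).
  have -> : (h ^+ 2)^-1 * (E * h ^+ 4) = E * h ^+ 2 by field; rewrite gt_eqF.
  by ring.
apply: (expectation_le2 _ _ _ _ _ _ _ ww ii) => //.
- by apply: measurable_funD; apply: measurable_funM.
- by apply: measurable_funD; apply: measurable_funM => //; exact: mi.
- by move=> w; rewrite addr_ge0 // mulr_ge0 ?wt_ge0 // ltW.
- by move=> w; rewrite addr_ge0 // mulr_ge0 // invr_ge0 ltW.
- move=> w; apply: (le_trans (dispersion_le m _ _ h0)).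
  rewrite le_eqVlt; apply/orP; left; apply/eqP; ring.
Qed.

Section with_H1.
Variables fh gh jh : nat -> R -> R.
Hypothesis mfgj : forall N, measurable_fun D (fh N) /\ measurable_fun D (gh N) /\
             measurable_fun D (jh N).
Variable hb1 : R.
Hypothesis H1 : forall N n, (0 < N)%N -> step M N < hb1 -> (n < N)%N ->
    let incr w := Yh N n.+1 w - Yh N n w in
    [/\ is_condexp P incr (Yh N n) (fun y => muY M y * step M N + fh N y),
        is_condexp P (fun w => incr w ^+ 2) (Yh N n)
          (fun y => sigY M y ^+ 2 * step M N + gh N y) &
        is_condexp P (fun w => incr w ^+ 3) (Yh N n) (jh N)].
Variables (p C : R).
Hypotheses (p1 : 1 < p) (C0 : 0 < C).
Hypothesis H1L : forall N n, (0 < N)%N -> step M N < hb1 -> (n <= N)%N ->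
    forall phi, (phi = fh N \/ phi = gh N \/ phi = jh N) ->
      (Lnorm P p%:E (fun w => (phi (Yh N n w))%:E) <=
         (C * step M N ^+ 2)%:E)%E.

Lemma chain_moment_defect m : exists A : R, 0 <= A /\ forall N n, (0 < N)%N ->
  step M N < hb -> step M N < hb1 -> (n < N)%N ->
  (\int[P]_w (wt m (Yh N n w) *
     moment_defect M (K N n (Yh N n w)) (step M N) (Yh N n w))%:E <=
   (A * step M N ^+ 2)%:E)%E.
Proof.
(* An integer above the conjugate exponent of [p], so that this power of [wt m] is at most
   [wt (m * k)], whose expectation H2 bounds. *)
pose k := (Num.truncn (p / (p - 1))).+1.
have kp : p / (p - 1) <= k%:R by rewrite ltW // truncnS_gt.
have [A [A0 HA]] := chain_wt (m * k).
exists (3 * (A + C `^ p)); split; first by rewrite mulr_ge0 // addr_ge0 // powR_ge0.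
move=> N n N0 hN hN1 nN; have h0 := step_gt0 N0; set h := step M N in h0 *.
have h2 : 0 < h ^+ 2 by rewrite exprn_gt0.
have mY := chain_measurable (mc N0) (ltnW nN).
have [c1 c2 c3] := H1 N0 hN1 nN.
have [mf [mg mj]] := mfgj N.
case: (std) => _ [[_ _ _ mmuY msigY] _].
have mpf : measurable_fun D (fun y : RM => muY M y * h + fh N y : RM).
  by apply: measurable_funD => //; exact: measurable_funM.
have mpg : measurable_fun D (fun y : RM => sigY M y ^+ 2 * h + gh N y : RM).
  by apply: measurable_funD => //; apply: measurable_funM => //; exact: measurable_funX.
have a1 := kernel_moment (j := 1) (mc N0) nN mpf c1.
have a2 := kernel_moment (mc N0) nN mpg c2.
have a3 := kernel_moment (mc N0) nN mj c3.
pose patched (phi : R -> R) w := (phi \_ D) (Yh N n w).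
have patchedE phi : patched phi = phi \o Yh N n.
  apply/funext => w; rewrite /patched patchE mem_set //; exact: (chain_dom (mc N0) w (ltnW nN)).
have mp phi : measurable_fun D (phi : RM -> RM) -> measurable_fun setT (phi \o Yh N n : Om -> RM).
  move=> mphi; rewrite -patchedE; exact: (measurableT_comp (measurable_patch_dom std mphi) mY).
have bnd phi : measurable_fun D (phi : RM -> RM) ->
    (phi = fh N \/ phi = gh N \/ phi = jh N) ->
    (\int[P]_w (wt m (Yh N n w) * `|phi (Yh N n w)|)%:E <= (h ^+ 2 * (A + C `^ p))%:E)%E.
  move=> mphi phiP.
  apply: (expectation_wt_Lnorm (F := phi \o Yh N n) mY (mp _ mphi) p1 kp (ltW C0) h2
    (H1L N0 hN1 (ltnW nN) phiP)).
  exact: HA (ltnW nN).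
have mwn phi : measurable_fun D (phi : RM -> RM) ->
    measurable_fun setT (fun w => wt m (Yh N n w) * `|phi (Yh N n w)| : RM).
  move=> mphi; apply: measurable_funM; first exact: (measurableT_comp (measurable_wt m) mY).
  exact: (measurableT_comp (@normr_measurable R setT) (mp _ mphi)).
have wn0 (phi : R -> R) w : 0 <= wt m (Yh N n w) * `|phi (Yh N n w)|.
  by rewrite mulr_ge0 // wt_ge0.
have Ifg := @expectation_le2 _ _ _ P _ _ _ _ _ _ _ (ler01 : 0 <= (1 : R)) (ler01 : 0 <= (1 : R))
  (mwn _ mf) (mwn _ mg) (wn0 _) (wn0 _) (fun w => lexx _)
  (bnd _ mf (or_introl erefl)) (bnd _ mg (or_intror (or_introl erefl))).
pose s w := wt m (Yh N n w) * (`|fh N (Yh N n w)| + `|gh N (Yh N n w)| + `|jh N (Yh N n w)|).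
have Is : (\int[P]_w (s w)%:E <= (3 * (A + C `^ p) * h ^+ 2)%:E)%E.
  have -> : 3 * (A + C `^ p) * h ^+ 2 = 1 * (1 * (h ^+ 2 * (A + C `^ p)) +
    1 * (h ^+ 2 * (A + C `^ p))) + 1 * (h ^+ 2 * (A + C `^ p)) by ring.
  apply: (expectation_le2 _ _ _ _ _ _ _ Ifg (bnd _ mj (or_intror (or_intror erefl)))) => //.
  - by apply: measurable_funD; apply: measurable_funM => //; exact: mwn.
  - exact: mwn.
  - by move=> w; rewrite !mul1r addr_ge0.
  - by move=> w; rewrite /s !mul1r !mulrDr.
(* Almost surely the three kernel defects are the moduli of the remainders [fh], [gh] and [jh] at
   the current state. *)
rewrite (@ae_eq_integral _ _ _ P setT (fun w => (s w)%:E)) //.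
- apply/measurable_EFinP; apply: measurable_funM; first exact: (measurableT_comp (measurable_wt m) mY).
  rewrite (_ : (fun w => _) = ((fun y => moment_defect M (K N n y) h y) \_ D) \o Yh N n).
    exact: (measurableT_comp (measurable_moment_defect std (K N n) h) mY).
  apply/funext => w; rewrite /= patchE mem_set //; exact: (chain_dom (mc N0) w (ltnW nN)).
- apply/measurable_EFinP.
  rewrite (_ : s = fun w => wt m (Yh N n w) * `|fh N (Yh N n w)| + wt m (Yh N n w) * `|gh N (Yh N n w)|
    + wt m (Yh N n w) * `|jh N (Yh N n w)|); last by apply/funext => w; rewrite /s !mulrDr.
  by apply: measurable_funD; [apply: measurable_funD|]; exact: mwn.
- move: a1 a2 a3; apply: filterS3 => w e1 e2 e3 _.
  rewrite /s /moment_defect e1 e2 e3 ![_ + fh N _]addrC ![_ + gh N _]addrC.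
  by rewrite !addrK.
Qed.

Lemma chain_local_defect m : exists A : R, 0 <= A /\ forall N n (dx : R), (0 < N)%N ->
  step M N < hb -> step M N < hb1 -> 0 < dx -> (n < N)%N ->
  (\int[P]_w (local_defect N (K N) dx m n (Yh N n w))%:E <=
   (A * (step M N * (step M N + dx)))%:E)%E.
Proof.
have [A [A0 HA]] := chain_moment_defect m.
have [E [j [E0 HE]]] := coef_weight_wt std.
have [B [B0 HB]] := chain_wt (m + j).
exists (A + E * B); split; first by rewrite addr_ge0 // mulr_ge0 // ltW.
move=> N n dx N0 hN hN1 dx0 nN; have h0 := step_gt0 N0; set h := step M N in h0 *.
have mY := chain_measurable (mc N0) (ltnW nN).
have hd0 : 0 < h * (h + dx) by rewrite mulr_gt0 // addr_gt0.
apply: (@le_trans _ _ (1 * (A * h ^+ 2) + (E * (h * (h + dx))) * B)%:E).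
  apply: (expectation_le2 _ _ _ _ _ _ _ (HA N n N0 hN hN1 nN) (HB N n N0 hN (ltnW nN))) => //.
  - by rewrite mulr_ge0 // ltW.
  - apply: measurable_funM; first exact: (measurableT_comp (measurable_wt m) mY).
    rewrite (_ : (fun w => _) = ((fun y => moment_defect M (K N n y) h y) \_ D) \o Yh N n).
      exact: (measurableT_comp (measurable_moment_defect std (K N n) h) mY).
    apply/funext => w; rewrite /= patchE mem_set //; exact: (chain_dom (mc N0) w (ltnW nN)).
  - exact: (measurableT_comp (measurable_wt _) mY).
  - by move=> w; rewrite mulr_ge0 ?wt_ge0 // moment_defect_ge0.
  - by move=> w; exact: wt_ge0.
  - move=> w; have Dw := chain_dom (mc N0) w (ltnW nN).
    rewrite /local_defect patchE mem_set // mul1r mulrDr lerD2l wtD -/h.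
    have := ler_wpM2l (ltW hd0) (ler_wpM2l (wt_ge0 m (Yh N n w)) (HE _ Dw)).
    lra.
rewrite lee_fin mul1r mulrAC [X in _ <= X]mulrDl lerD2r ler_wpM2l //.
by rewrite expr2 ler_pM2l // lerDl ltW.
Qed.

End with_H1.
End with_H2.
End chain_moments.

(** * The error recursion *)

Section error_recursion.
Context {R : realType}.
Local Notation RM := (measurableTypeR R).
Variables (M : model R) (u : R -> R -> R -> R).
Hypothesis std : standing_coefficients M.
Hypothesis reg : levy_regular M.
Hypothesis pide : solves_pide M u.
Local Notation T := (horizon M).
Local Notation D := (dom M).
Variable w : nat -> nat -> nat -> R -> R -> R -> R.
Hypothesis pd : partial_derivatives T D 4 u w.
Variables (C1 : R) (m : nat).
Hypothesis C10 : 0 < C1.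
Hypothesis wb : forall k l' l t x y, (2 * k + l' + l <= 4)%N -> 0 <= t < T -> D y ->
  `|w k l' l t x y| <= C1 * wt m y.
Variable e : R.
Hypothesis e0 : 0 < e.
Hypothesis ge : forall y, D y -> (forall z, D z -> gamX M z = 0) \/
    (~ (forall z, D z -> gamX M z = 0) /\ e <= `|gamX M y|).
Local Notation L := (jump_rate M e).

Variables (N : nat) (dx : R).
Hypotheses (N0 : (0 < N)%N) (dx0 : 0 < dx) (dx1 : dx < 1).
Local Notation h := (step M N).
Variables (S : nat -> set R) (K : nat -> R.-pker RM ~> RM).

Definition error_constant : R := (1 + 2 * T * L) * C1 + step_constant M C1 e.

(** Indexed, like [scheme_rev], by the number of steps to go, and measurable by construction. It may
    be infinite at states where the kernel lacks moments. *)
Fixpoint error_bound (k : nat) : RM -> \bar R :=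
  if k is k'.+1 then fun y =>
    ((1 + 2 * h * L)%:E * \int[K (N - k)%N y]_z error_bound k' z
     + error_constant%:E * (\int[K (N - k)%N y]_z (dispersion m h (y, z))%:E
                          + (local_defect M N K dx m (N - k)%N y)%:E))%E
  else cst 0%E.

Let h0 : 0 < h. Proof. exact: step_gt0. Qed.
Let L0 : 0 <= L. Proof. exact: jump_rate_ge0. Qed.

Let KL : 0 < 1 + 2 * h * L.
Proof. by have h0' := ltW h0; rewrite ltr_pwDl // mulr_ge0 // mulr_ge0. Qed.

Lemma error_constant_gt0 : 0 < error_constant.
Proof.
have L0' := L0; have T0 := ltW (horizon_gt0 std).
rewrite /error_constant /step_constant; apply: addr_gt0; apply: mulr_gt0 => //.
  by rewrite ltr_pwDl // !mulr_ge0.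
by apply: mulr_gt0; [rewrite ltr_pwDl // mulr_ge0|rewrite exprn_gt0 // ltr_pwDl].
Qed.

Let dispersionE0 yz : (0 <= (dispersion m h yz)%:E)%E.
Proof. by rewrite lee_fin dispersion_ge0 // ltW. Qed.

Let mdispersion : measurable_fun setT (fun yz : RM * RM => (dispersion m h yz)%:E).
Proof. by apply/measurable_EFinP; exact: measurable_dispersion. Qed.

Lemma error_bound_ge0 k y : (0 <= error_bound k y)%E.
Proof.
elim: k y => [|k IH] y //=.
apply: adde_ge0; apply: mule_ge0; rewrite ?lee_fin ?(ltW KL) ?(ltW error_constant_gt0) //.
  by apply: integral_ge0.
by apply: adde_ge0; [exact: integral_ge0|rewrite lee_fin local_defect_ge0].
Qed.

Lemma measurable_error_bound k : measurable_fun setT (error_bound k).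
Proof.
elim: k => [|k IH] /=; first exact: measurable_cst.
apply: emeasurable_funD; apply: measurable_funeM.
  apply: (@measurable_kernel_integral _ (K (N - k.+1)%N) (fun yz => error_bound k yz.2)).
    by move=> z; exact: error_bound_ge0.
  by apply: (measurableT_comp IH); exact: measurable_snd.
apply: emeasurable_funD; last first.
  by apply/measurable_EFinP; exact: measurable_local_defect.
exact: (@measurable_kernel_integral _ (K (N - k.+1)%N) (fun yz => (dispersion m h yz)%:E)).
Qed.

Section on_chain.
Context d (Om : measurableType d) (P : probability Om R).
Variable Y : nat -> Om -> R.
Hypothesis mc : markov_chain M P N S K Y.

Lemma scheme_error_bound k : (k <= N)%N -> forall y, S (N - k)%N y -> forall i,
  ((`|u ((N - k)%:R * h) (node M dx i) y - scheme_rev M S K N dx k i y|)%:E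
    <= error_bound k y)%E.
Proof.
have NhT : N%:R * h = T by rewrite /step mulrC divfK // pnatr_eq0; lia.
case: (mc) => mcS _ mcK _.
elim: k => [|k IH] kN y Sy i /=.
  rewrite subn0 NhT; have [_ SN SD _] := mcS N (leqnn _).
  have [_ /(_ (node M dx i) y)[|-> _]] := pide.
    by rewrite subn0 in Sy; exact: SD.
  by rewrite subrr normr0.
have tS : ((N - k.+1).+1 = N - k)%N by lia.
have [_ mS SD _] := mcS _ (leq_subr k N).
have [_ _ SD' _] := mcS _ (leq_subr k.+1 N).
have Dy := SD' y Sy.
have tE : (N - k.+1)%:R * h + h = (N - k)%:R * h by rewrite -tS -[in RHS]natr1 mulrDl mul1r.
have t0 : 0 <= (N - k.+1)%:R * h by rewrite mulr_ge0 // ltW.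
have thT : (N - k.+1)%:R * h + h <= T.
  by rewrite tE -NhT ler_wpM2r ?(ltW h0) // ler_nat leq_subr.
have kS : K (N - k.+1)%N y (S (N - k)%N) = 1%E.
  by rewrite -tS; apply: mcK => //; lia.
rewrite tS.
have := @scheme_step R M u std reg pide w pd C1 m C10 wb e e0 ge ((N - k.+1)%:R * h) h dx y
  t0 h0 thT dx0 dx1 Dy (K (N - k.+1)%N y) (S (N - k)%N)
  (prob_kernel _) mS SD kS
  (fun j z => scheme_rev M S K N dx k j z) (error_bound k) (measurable_error_bound k)
  (error_bound_ge0 k) _ i.
rewrite tE /local_defect patchE mem_set //; apply.
exact: IH (ltnW kN).
Qed.

Variables (c : R).
Hypothesis c0 : 0 <= c.
Hypothesis step_error : forall n, (n < N)%N ->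
  (\int[P]_w (dispersion m h (Y n w, Y n.+1 w))%:E
   + \int[P]_w (local_defect M N K dx m n (Y n w))%:E <= c%:E)%E.

(** Disintegration turns the expected kernel integral of the bound into its expectation at the next
    state; a discrete Gronwall argument with ratio [1 + 2 h L] follows. *)
Lemma expected_error_bound k : (k <= N)%N ->
  (\int[P]_w error_bound k (Y (N - k)%N w) <=
   (k%:R * (error_constant * c * (1 + 2 * h * L) ^+ k))%:E)%E.
Proof.
have CC0 := error_constant_gt0.
elim: k => [|k IH] kN; first by rewrite integral0 mul0r.
pose n := (N - k.+1)%N; have nN : (n < N)%N by rewrite /n; lia.
have nS : (n.+1 = N - k)%N by rewrite /n; lia.
have mY := chain_measurable mc (ltnW nN); have mZ := chain_measurable mc nN.
have rect A B := @chain_rect _ _ _ _ _ _ _ _ _ mc n A B nN.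
have e1 : (\int[P]_w \int[K n (Y n w)]_z error_bound k z = \int[P]_w error_bound k (Y n.+1 w))%E.
  rewrite (integral_disintegration mY mZ rect (f := fun yz => error_bound k yz.2)) //.
    by move=> z; exact: error_bound_ge0.
  by apply: (measurableT_comp (measurable_error_bound k)); exact: measurable_snd.
have e2 : (\int[P]_w \int[K n (Y n w)]_z (dispersion m h (Y n w, z))%:E =
    \int[P]_w (dispersion m h (Y n w, Y n.+1 w))%:E)%E.
  by rewrite (integral_disintegration mY mZ rect (f := fun yz => (dispersion m h yz)%:E)).
have mI1 : measurable_fun setT (fun w => \int[K n (Y n w)]_z error_bound k z)%E.
  have m2 : measurable_fun setT (fun yz : RM * RM => error_bound k yz.2).
    by apply: (measurableT_comp (measurable_error_bound k)); exact: measurable_snd.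
  have mg := @measurable_kernel_integral _ (K n) _ (fun yz => error_bound_ge0 k yz.2) m2.
  exact: (measurableT_comp mg mY).
have mI2 : measurable_fun setT (fun w => \int[K n (Y n w)]_z (dispersion m h (Y n w, z))%:E)%E.
  have mg := @measurable_kernel_integral _ (K n) _ dispersionE0 mdispersion.
  exact: (measurableT_comp mg mY).
have mI3 : measurable_fun setT (fun w => (local_defect M N K dx m n (Y n w))%:E)%E.
  apply/measurable_EFinP.
  exact: (measurableT_comp (measurable_local_defect std N K dx m n) mY).
have I1 x : (0 <= \int[K n (Y n x)]_z error_bound k z)%E.
  by apply: integral_ge0 => z _; exact: error_bound_ge0.
have I2 x : (0 <= \int[K n (Y n x)]_z (dispersion m h (Y n x, z))%:E)%E by exact: integral_ge0.
have I3 x : (0 <= (local_defect M N K dx m n (Y n x))%:E)%E by rewrite lee_fin local_defect_ge0.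
rewrite /= -/n ge0_integralD //; last 4 first.
- by move=> x _; rewrite mule_ge0 // lee_fin ltW.
- exact: measurable_funeM.
- by move=> x _; apply: mule_ge0; [rewrite lee_fin ltW|exact: adde_ge0].
- by apply: measurable_funeM; exact: emeasurable_funD.
rewrite ge0_integralZl //; last by rewrite lee_fin ltW.
rewrite ge0_integralZl //; last 3 first.
- exact: emeasurable_funD.
- by move=> x _; exact: adde_ge0.
- by rewrite lee_fin ltW.
rewrite e1 (ge0_integralD P measurableT (fun x _ => I2 x) mI2 (fun x _ => I3 x) mI3) e2 nS.
have := IH (ltnW kN); rewrite -nS => {}IH.
apply: (@le_trans _ _ ((1 + 2 * h * L)%:E * (k%:R * (error_constant * c * (1 + 2 * h * L) ^+ k))%:E
   + error_constant%:E * c%:E)%E).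
  apply: leeD; apply: lee_wpmul2l; rewrite ?lee_fin ?(ltW KL) ?(ltW CC0) //.
  exact: step_error.
rewrite -!EFinM -EFinD lee_fin -[k.+1%:R]natr1 exprS [leRHS]mulrDl mul1r.
set q := 1 + 2 * h * L; have q1 : 1 <= q by have h0' := ltW h0; rewrite lerDl mulr_ge0 // mulr_ge0.
have -> : q * (k%:R * (error_constant * c * q ^+ k)) + error_constant * c =
  k%:R * (error_constant * c * (q * q ^+ k)) + error_constant * c by ring.
by rewrite lerD2l -exprS ler_peMr ?mulr_ge0 ?(ltW CC0) // exprn_ege1.
Qed.

Lemma initial_error_le i :
  `|u 0 (node M dx i) (Y0 M) - scheme M S K N dx 0 i (Y0 M)| <=
  N%:R * (error_constant * c * expR (2 * T * L)).
Proof.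
case: (mc) => mcS Y00 _ _.
have [_ _ _ SY] := mcS 0%N (leq0n _).
(* A sample point is needed to know that [Y0] belongs to the initial state space; one exists because
   [P] has mass 1. *)
have w0 : exists w0 : Om, True.
  apply: contrapT => no; have := @probability_setT _ _ _ P.
  rewrite (_ : setT = set0) ?measure0; first by move/eqP; rewrite eqe eq_sym oner_eq0.
  by apply/seteqP; split => // w' _; apply: no; exists w'.
have [w1 _] := w0.
have SY0 : S (N - N)%N (Y0 M) by rewrite subnn -(Y00 w1).
have := scheme_error_bound (leqnn N) SY0 i.
rewrite subnn mul0r /scheme subn0 => H1; rewrite -lee_fin; apply: (le_trans H1).
have := expected_error_bound (leqnn N); rewrite subnn.
rewrite (eq_integral (cst (error_bound N (Y0 M)))); last by move=> w2 _; rewrite Y00.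
rewrite integral_cst // [X in (_ * X)%E](@probability_setT _ _ _ P) mule1 => /le_trans; apply.
rewrite lee_fin ler_wpM2l // ler_wpM2l //; first by rewrite mulr_ge0 // ltW // error_constant_gt0.
apply: (@le_trans _ _ (expR (2 * h * L) ^+ N)).
  by rewrite lerXn2r ?nnegrE ?(ltW KL) ?expR_ge0 // expR_ge1Dx.
rewrite -expRM_natl ler_expR le_eqVlt; apply/orP; left; apply/eqP.
by rewrite /step; field; rewrite pnatr_eq0; lia.
Qed.

End on_chain.
End error_recursion.

Theorem theorem4p8 (R : realType) (M : model R) (u : R -> R -> R -> R)
  (d : measure_display) (Om : measurableType d) (P : probability Om R)
  (F : R -> set (set Om)) (B W H : R -> Om -> R) (tau J : nat -> Om -> R)
  (S : nat -> nat -> set R)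
  (K : nat -> nat -> R.-pker (measurableTypeR R) ~> (measurableTypeR R))
  (Yh : nat -> nat -> Om -> R)
  (M_standing : standing_coefficients M)
  (M_wellposed : weak_wellposed M)
  (noise : driving_noise P F (intensity M) (jumpdens M) B W H tau J)
  (u_value : is_value_function M u)
  (u_pide : solves_pide M u)
  (Yh_markov : forall N, (0 < N)%N -> markov_chain M P N (S N) (K N) (Yh N))
  (Yh_indep : forall N, (0 < N)%N ->
     independent_classes P
       (sigma_process [set n | (n <= N)%N] (Yh N))
       <<s sigma_process `[0, +oo[ B `|` sigma_process `[0, +oo[ H >>)
  (nu_reg : levy_regular M)
  (Yh_H1 : assumption_H1 M P Yh)
  (Yh_H2 : assumption_H2 M P Yh)
  (u_reg : Cpol (horizon M) (dom M) +oo%E 4 u) :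
  exists hbar C : R, [/\ 0 < hbar, 0 < C &
    forall (N : nat) (dx : R),
      (0 < N)%N -> step M N < hbar -> 0 < dx -> dx < 1 ->
      (linf_norm (fun i => u 0 (node M dx i) (Y0 M)
                           - scheme M (S N) (K N) N dx 0 i (Y0 M))%R
       <= (C * (step M N + dx))%:E)%E].
Proof.
have [e e0 ge] := gamX_dichotomy M_standing.
have [w [C1 [m [pd C10 wb]]]] := Cpol_partials u_reg.
have [hb1 [hb10 [fh [gh [jh [mfgj [H1 [p [C [p1 C0 H1L]]]]]]]]]] := Yh_H1.
have [hb2 [hb20 H2]] := Yh_H2.
have [A [A0 HA]] := chain_dispersion M_standing Yh_markov H2 m.
have [E [E0 HE]] := chain_local_defect M_standing Yh_markov H2 mfgj H1 p1 C0 H1L m.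
pose CC := error_constant M C1 e; have CC0 : 0 < CC := error_constant_gt0 M_standing C10 e0.
have T0 := horizon_gt0 M_standing.
(* The horizon appears through [N * h = T], which absorbs one factor [h] of the local errors. *)
pose G := horizon M * (CC * expR (2 * horizon M * jump_rate M e)).
have G0 : 0 < G by rewrite !mulr_gt0 ?expR_gt0.
(* Both thresholds must hold at once; the added 1 keeps the constant positive when [A] and [E]
   vanish. *)
exists (Num.min hb1 hb2), (G * (A + E) + 1); split.
- by rewrite lt_min hb10.
- by rewrite ltr_wpDl // mulr_ge0 ?(ltW G0) // addr_ge0.
move=> N dx N0; rewrite lt_min => /andP[hN1 hN2] dx0 dx1.
have NhT : N%:R * step M N = horizon M by rewrite /step mulrC divfK // pnatr_eq0 -lt0n.
have h0 := step_gt0 M_standing N0; set h := step M N in h0 NhT *.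
apply: ge_ereal_sup => _ [i _ <-]; rewrite lee_fin.
have hd0 : 0 < h * (h + dx) by rewrite mulr_gt0 // addr_gt0.
have c0 : 0 <= (A + E) * (h * (h + dx)) by rewrite mulr_ge0 ?(ltW hd0) // addr_ge0.
apply: (le_trans (initial_error_le M_standing nu_reg u_pide pd C10 wb e0 ge N0 dx0 dx1
  (Yh_markov N N0) c0 _ i)).
  move=> n nN; rewrite mulrDl EFinD leeD ?HE //.
  apply: (le_trans (HA N n N0 hN2 nN)); rewrite lee_fin ler_wpM2l //.
  by rewrite expr2 ler_pM2l // lerDl ltW.
rewrite -/CC.
have -> : N%:R * (CC * ((A + E) * (h * (h + dx))) * expR (2 * horizon M * jump_rate M e)) =
    G * (A + E) * (h + dx).
  by rewrite /G -NhT; ring.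
by rewrite ler_wpM2r ?addr_ge0 ?(ltW h0) ?(ltW dx0) // lerDl.
Qed.
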